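(* There are no unbounded $*$-representations of the $*$-algebra $P(\mathbb{R}P^2_q)$. Up to unitary equivalence, all irreducible (bounded) $*$-representations of this algebra are the following: (i) A family of one-dimensional representations $\rho_\theta:P(\mathbb{R}P^2_q)\to\mathbb{C}$ parameterized by $\theta\in[0,2\pi)$, given by $\rho_\theta(P)=\rho_\theta(T)=0$, $\rho_\theta(R)=e^{i\theta}$. (ii) An infinite-dimensional representation $\rho$ in a Hilbert space $H$ with an orthonormal basis $\{e_k\}_{k\in\mathbb{N}}$ ($k\ge 0$), given by $$\rho(P)e_k=q^{4k}e_k,$$ $$\rho(T)e_k=\begin{cases}0 & k=0,\\ q^{2(k-1)}(1-q^{4k})^{1/2}e_{k-1} & k>0,\end{cases}\qquad \rho(T^* )e_k=q^{2k}(1-q^{4(k+1)})^{1/2}e_{k+1},\quad k\ge0,$$ $$\rho(R)e_k=\begin{cases}0 & k=0,1,\\ (1-q^{4k})^{1/2}(1-q^{4(k-1)})^{1/2}e_{k-2} & k>1,\end{cases}$$ $$\rho(R^* )e_k=(1-q^{4(k+1)})^{1/2}(1-q^{4(k+2)})^{1/2}e_{k+2},\quad k\ge0.$$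
   Context: Fix $q\in\mathbb{R}$ with $0<|q|<1$. All algebras are unital and over $\mathbb{C}$. $P(S^2_{q\infty})$ is the quotient of the free $*$-algebra $\mathbb{C}\langle A,B\rangle$ by the two-sided $*$-ideal generated by $A^*=A$, $BA=q^2AB$, $B^*B=-A^2+I$, $BB^*=-q^4A^2+I$. Let $r_2$ be the $*$-automorphism of $P(S^2_{q\infty})$ with $r_2(A)=-A$, $r_2(B)=-B$, and $P(\mathbb{R}P^2_q):=\{a\in P(S^2_{q\infty})\mid r_2(a)=a\}$. It is the $*$-subalgebra generated by $P:=A^2$, $R:=B^2$, $T:=AB$. A (possibly unbounded) $*$-representation of a unital $*$-algebra $\mathcal{A}$ is a unital homomorphism $\rho$ of $\mathcal{A}$ into the linear operators on a dense subspace $\mathcal{D}$ of a Hilbert space (each $\rho(a)$ mapping $\mathcal{D}$ to $\mathcal{D}$) with $\langle\rho(a)\varphi,\psi\rangle=\langle\varphi,\rho(a^* )\psi\rangle$ for $a\in\mathcal{A}$, $\varphi,\psi\in\mathcal{D}$; it is unbounded if some $\rho(a)$ is an unbounded operator. *)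

(* Defs.v *)
From HB Require Import structures.
From mathcomp Require Import all_boot all_order all_algebra.
From mathcomp Require Import all_classical all_reals.
From mathcomp Require Import topology normedtype trigo.
From mathcomp Require Import finmap complex ring_quotient sesquilinear.
(* the notations of monalg clash with those of the analysis library *)
From mathcomp Require Import -(notations) monalg.

Set Implicit Arguments.
Unset Strict Implicit.
Unset Printing Implicit Defensive.

Import Order.TTheory GRing.Theory Num.Theory.
Import numFieldNormedType.Exports.

Local Open Scope classical_set_scope.
Local Open Scope ring_scope.

HB.mixin Record isStarAlgebra (C : numClosedFieldType) A & GRing.Algebra C A := {
  star : A -> A;
  star_antilinear : forall (c : C) x y, star (c *: x + y) = c^* *: star x + star y;
  starM : forall x y, star (x * y) = star y * star x;
  starK : involutive star
}.

#[short(type="starAlgType")]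
HB.structure Definition StarAlgebra (C : numClosedFieldType) :=
  {A of GRing.Algebra C A & isStarAlgebra C A}.

Section StarTheory.
Variables (C : numClosedFieldType) (A : starAlgType C).
Implicit Types x y : A.

Lemma starD x y : star (x + y) = star x + star y.
Proof. by rewrite -[x]scale1r star_antilinear rmorph1 !scale1r. Qed.

Lemma star0 : star (0 : A) = 0.
Proof. by apply: (addrI (star 0)); rewrite -starD !addr0. Qed.

Lemma starZ (c : C) x : star (c *: x) = c^* *: star x.
Proof. by rewrite -[c *: x]addr0 star_antilinear star0 addr0. Qed.

Lemma starN x : star (- x) = - star x.
Proof. by rewrite -scaleN1r starZ rmorphN rmorph1 scaleN1r. Qed.

Lemma starB x y : star (x - y) = star x - star y.
Proof. by rewrite starD starN. Qed.

Lemma star1 : star (1 : A) = 1.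
Proof. by rewrite -[LHS]mul1r -{1}[1](starK 1) -starM mul1r starK. Qed.

Lemma star_sum I (r : seq I) P (F : I -> A) :
  star (\sum_(i <- r | P i) F i) = \sum_(i <- r | P i) star (F i).
Proof. exact: (big_morph _ starD star0). Qed.

End StarTheory.

Section StarMorphism.
Variables (C : numClosedFieldType) (A B : starAlgType C).

Definition star_hom (f : A -> B) : Prop :=
  [/\ forall (c : C) x y, f (c *: x + y) = c *: f x + f y,
      forall x y, f (x * y) = f x * f y, f 1 = 1 & forall x, f (star x) = star (f x)].

Lemma star_hom0 f : star_hom f -> f 0 = 0.
Proof.
case=> fL _ _ _; have := fL 1 0 0; rewrite !scale1r !addr0 => h.
by apply: (addrI (f 0)); rewrite -h addr0.
Qed.

Lemma star_homD f : star_hom f -> {morph f : x y / x + y}.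
Proof. by case=> fL _ _ _ x y; rewrite -[x]scale1r fL !scale1r. Qed.

Lemma star_homZ f : star_hom f -> forall (c : C) x, f (c *: x) = c *: f x.
Proof.
by move=> fh c x; have [fL _ _ _] := fh; rewrite -[c *: x]addr0 fL star_hom0 ?addr0.
Qed.

Lemma star_homN f : star_hom f -> {morph f : x / - x}.
Proof. by move=> fh x; rewrite -scaleN1r star_homZ ?scaleN1r. Qed.

Lemma star_homX f n : star_hom f -> {morph f : x / x ^+ n}.
Proof.
by move=> [_ fM f1 _] x; elim: n => // n IHn; rewrite !exprS fM IHn.
Qed.

End StarMorphism.

(* The scalars as a one-dimensional $*$-algebra. *)
Section ScalarStar.
Variable C : numClosedFieldType.

Lemma conj_antilinear (c : C) (x y : C^o) : (c *: x + y)^* = c^* *: (x^* : C^o) + y^*.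
Proof. by rewrite rmorphD rmorphM. Qed.
Lemma conjM (x y : C^o) : (x * y)^* = y^* * x^* :> C^o.
Proof. by rewrite rmorphM mulrC. Qed.
HB.instance Definition _ :=
  isStarAlgebra.Build C C^o conj_antilinear conjM (@conjCK C).
End ScalarStar.

(* Facts proved once for an abstract algebra spanned by monomials: the concrete
   monoid algebra below unfolds too eagerly for these computations. *)
Section Monomials.
Variables (C : numClosedFieldType) (F : lalgType C) (W : Type).
Variables (mono : W -> C -> F) (mulw : W -> W -> W).
Hypothesis mono_ind : forall P : F -> Prop, P 0 ->
  (forall x y, P x -> P y -> P (x + y)) -> (forall w c, P (mono w c)) ->
  forall x, P x.
Hypothesis monoZ : forall w c d, c *: mono w d = mono w (c * d).
Hypothesis monoM : forall v w c d, mono v c * mono w d = mono (mulw v w) (c * d).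

Lemma mono_scalerAr (c : C) (x y : F) : c *: (x * y) = x * (c *: y).
Proof.
elim/mono_ind: x => [|x x' IHx IHx'|v a].
- by rewrite !mul0r scaler0.
- by rewrite !mulrDl scalerDr IHx IHx'.
elim/mono_ind: y => [|y y' IHy IHy'|w b]; first by rewrite mulr0 !scaler0 mulr0.
  by rewrite mulrDr !scalerDr mulrDr IHy IHy'.
by rewrite monoM !monoZ monoM mulrCA.
Qed.

Section Star.
Variables (st : F -> F) (wst : W -> W).
Hypothesis st_antilinear :
  forall (c : C) x y, st (c *: x + y) = c^* *: st x + st y.
Hypothesis st_mono : forall w c, st (mono w c) = mono (wst w) c^*.
Hypothesis wstM : forall v w, wst (mulw v w) = mulw (wst w) (wst v).
Hypothesis wstK : involutive wst.

Let stD : {morph st : x y / x + y}.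
Proof. by move=> x y; rewrite -[x]scale1r st_antilinear rmorph1 !scale1r. Qed.
Let st0 : st 0 = 0.
Proof. by apply: (addrI (st 0)); rewrite -stD !addr0. Qed.

Lemma mono_starM x y : st (x * y) = st y * st x.
Proof.
elim/mono_ind: x => [|x x' IHx IHx'|v c].
- by rewrite mul0r st0 mulr0.
- by rewrite mulrDl !stD mulrDr IHx IHx'.
elim/mono_ind: y => [|y y' IHy IHy'|w d]; first by rewrite mulr0 st0 mul0r.
  by rewrite mulrDr !stD mulrDl IHy IHy'.
by rewrite monoM !st_mono monoM wstM rmorphM mulrC.
Qed.

Lemma mono_starK : involutive st.
Proof.
move=> x; elim/mono_ind: x => [|x y IHx IHy|w c]; first by rewrite !st0.
  by rewrite !stD IHx IHy.
by rewrite !st_mono wstK conjCK.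
Qed.
End Star.

Section Lift.
Variables (A : algType C) (f : F -> A) (phi : W -> A).
Hypothesis f_linear : forall (c : C) x y, f (c *: x + y) = c *: f x + f y.
Hypothesis f_mono : forall w c, f (mono w c) = c *: phi w.
Hypothesis phiM : forall v w, phi (mulw v w) = phi v * phi w.

Let fD : {morph f : x y / x + y}.
Proof. by move=> x y; rewrite -[x]scale1r f_linear !scale1r. Qed.
Let f0 : f 0 = 0.
Proof. by apply: (addrI (f 0)); rewrite -fD !addr0. Qed.

Lemma mono_liftM x y : f (x * y) = f x * f y.
Proof.
elim/mono_ind: x => [|x x' IHx IHx'|v c].
- by rewrite mul0r f0 mul0r.
- by rewrite mulrDl !fD mulrDl IHx IHx'.
elim/mono_ind: y => [|y y' IHy IHy'|w d]; first by rewrite mulr0 f0 mulr0.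
  by rewrite mulrDr !fD mulrDr IHy IHy'.
by rewrite monoM !f_mono phiM -scalerAl -scalerAr scalerA.
Qed.
End Lift.

Section LiftStar.
Variables (A : starAlgType C) (f : F -> A) (phi : W -> A).
Variables (st : F -> F) (wst : W -> W).
Hypothesis st_antilinear :
  forall (c : C) x y, st (c *: x + y) = c^* *: st x + st y.
Hypothesis st_mono : forall w c, st (mono w c) = mono (wst w) c^*.
Hypothesis f_linear : forall (c : C) x y, f (c *: x + y) = c *: f x + f y.
Hypothesis f_mono : forall w c, f (mono w c) = c *: phi w.
Hypothesis phi_star : forall w, phi (wst w) = star (phi w).

Let fD : {morph f : x y / x + y}.
Proof. by move=> x y; rewrite -[x]scale1r f_linear !scale1r. Qed.
Let f0 : f 0 = 0.
Proof. by apply: (addrI (f 0)); rewrite -fD !addr0. Qed.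
Let stD : {morph st : x y / x + y}.
Proof. by move=> x y; rewrite -[x]scale1r st_antilinear rmorph1 !scale1r. Qed.
Let st0 : st 0 = 0.
Proof. by apply: (addrI (st 0)); rewrite -stD !addr0. Qed.

Lemma mono_lift_star x : f (st x) = star (f x).
Proof.
elim/mono_ind: x => [|x y IHx IHy|w c]; first by rewrite st0 f0 star0.
  by rewrite stD !fD starD IHx IHy.
by rewrite st_mono !f_mono starZ phi_star.
Qed.
End LiftStar.
End Monomials.

Section FreeStar.
Variables (C : numClosedFieldType) (X : choiceType).

(* The free $*$-algebra on X is the free algebra on the letters x = (x, false)
   and x^* = (x, true), i.e. the monoid algebra of the words in these. *)
Definition letter := (X * bool)%type.
Definition word := fmonom letter.
Definition free_star := malg word C.
HB.instance Definition _ := GRing.Lalgebra.on free_star.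

Definition mono (w : word) (c : C) : free_star := mkmalgU w c.

Definition fgen (x : X) : free_star := mono (fmu (x, false)) 1.

Definition wstar (w : word) : word := FMonom (rev [seq (l.1, ~~ l.2) | l <- w]).

Definition fstar (g : free_star) : free_star :=
  \sum_(w <- msupp g) mono (wstar w) (mcoeff w g)^*.

Lemma monoD w : {morph mono w : c d / c + d}.
Proof. exact: monalgUD. Qed.
Lemma mono0 w : mono w 0 = 0. Proof. exact: monalgU0. Qed.
Lemma monoZ w c d : c *: mono w d = mono w (c * d).
Proof.
apply/malgP => m; rewrite mcoeffZ (mcoeffU w d) (mcoeffU w (c * d)).
exact: mulrnAr.
Qed.
Lemma monoM v w c d : mono v c * mono w d = mono (monalg.mul v w) (c * d).
Proof. exact: fgmulUU. Qed.
Lemma mono1 : mono monalg.one 1 = 1. Proof. by []. Qed.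

Lemma freeE (g : free_star) : g = \sum_(w <- msupp g) mono w (mcoeff w g).
Proof. exact: monalgE. Qed.

Lemma free_ind (P : free_star -> Prop) : P 0 ->
  (forall x y, P x -> P y -> P (x + y)) -> (forall w c, P (mono w c)) ->
  forall x, P x.
Proof. by move=> P0 PD PU x; rewrite [x]freeE; apply: big_ind. Qed.

Lemma free_scalerAr (c : C) (x y : free_star) : c *: (x * y) = x * (c *: y).
Proof. exact: (mono_scalerAr free_ind monoZ monoM). Qed.
HB.instance Definition _ := GRing.Lalgebra_isAlgebra.Build C free_star free_scalerAr.

Lemma fstarEw (d : {fset word}) (g : free_star) : (msupp g `<=` d)%fset ->
  fstar g = \sum_(w <- d) mono (wstar w) (mcoeff w g)^*.
Proof.
move=> le; rewrite /fstar (big_fset_incl _ le) // => w _ /mcoeff_outdom ->.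
by rewrite rmorph0 mono0.
Qed.

Lemma fstarU w c : fstar (mono w c) = mono (wstar w) c^*.
Proof. by rewrite (fstarEw msuppU_le) big_seq_fset1 mcoeffUU. Qed.

Lemma fstar_antilinear (c : C) x y : fstar (c *: x + y) = c^* *: fstar x + fstar y.
Proof.
pose d := (msupp x `|` msupp y)%fset.
have dx : (msupp x `<=` d)%fset by apply: fsubsetUl.
have dy : (msupp y `<=` d)%fset by apply: fsubsetUr.
have dz : (msupp (c *: x + y) `<=` d)%fset.
  apply: (fsubset_trans (msuppD_le _ _)); apply: fsetSU; exact: msuppZ_le.
rewrite (fstarEw dx) (fstarEw dy) (fstarEw dz) scaler_sumr -big_split /=.
apply: eq_bigr => w _.
by rewrite mcoeffD mcoeffZ rmorphD rmorphM monoD monoZ.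
Qed.

Lemma wstarK : involutive wstar.
Proof.
move=> [w]; rewrite /wstar /= map_rev revK -map_comp.
congr FMonom; rewrite -[RHS]map_id; apply: eq_map => -[x b] /=.
by rewrite negbK.
Qed.

Lemma wstarM v w : wstar (monalg.mul v w) = monalg.mul (wstar w) (wstar v).
Proof. by apply/eqP; rewrite fmP fmM /wstar /= fmM map_cat rev_cat. Qed.

Lemma fstarM x y : fstar (x * y) = fstar y * fstar x.
Proof. exact: (mono_starM free_ind monoM fstar_antilinear fstarU wstarM). Qed.

Lemma fstarK : involutive fstar.
Proof. exact: (mono_starK free_ind fstar_antilinear fstarU wstarK). Qed.

HB.instance Definition _ :=
  isStarAlgebra.Build C free_star fstar_antilinear fstarM fstarK.

End FreeStar.

Section FreeLift.
Variables (C : numClosedFieldType) (X : choiceType) (A : starAlgType C).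
Variable f : X -> A.

Definition letter_lift (l : letter X) : A := if l.2 then star (f l.1) else f l.1.
Definition free_lift (g : free_star C X) : A :=
  \sum_(w <- msupp g) mcoeff w g *: \prod_(l <- (w : seq _)) letter_lift l.

Lemma free_liftEw (d : {fset word X}) (g : free_star C X) : (msupp g `<=` d)%fset ->
  free_lift g = \sum_(w <- d) mcoeff w g *: \prod_(l <- (w : seq _)) letter_lift l.
Proof.
move=> le; rewrite /free_lift (big_fset_incl _ le) // => w _ /mcoeff_outdom ->.
by rewrite scale0r.
Qed.

Lemma free_liftU w c :
  free_lift (mono w c) = c *: \prod_(l <- (w : seq _)) letter_lift l.
Proof. by rewrite (free_liftEw msuppU_le) big_seq_fset1 mcoeffUU. Qed.

Lemma free_lift_gen x : free_lift (fgen C x) = f x.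
Proof. by rewrite free_liftU scale1r fmU big_seq1. Qed.

Lemma free_lift_linear (c : C) x y :
  free_lift (c *: x + y) = c *: free_lift x + free_lift y.
Proof.
pose d := (msupp x `|` msupp y)%fset.
have dx : (msupp x `<=` d)%fset by apply: fsubsetUl.
have dy : (msupp y `<=` d)%fset by apply: fsubsetUr.
have dz : (msupp (c *: x + y) `<=` d)%fset.
  apply: (fsubset_trans (msuppD_le _ _)); apply: fsetSU; exact: msuppZ_le.
rewrite (free_liftEw dx) (free_liftEw dy) (free_liftEw dz) scaler_sumr -big_split.
apply: eq_bigr => w _ /=.
by rewrite mcoeffD mcoeffZ scalerDl scalerA.
Qed.

Lemma free_lift1 : free_lift 1 = 1.
Proof. by rewrite -mono1 free_liftU fm1 big_nil scale1r. Qed.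

Lemma free_liftM x y : free_lift (x * y) = free_lift x * free_lift y.
Proof.
apply: (mono_liftM (@free_ind C X) (@monoM C X) free_lift_linear free_liftU).
by move=> v w; rewrite fmM big_cat.
Qed.

Lemma free_lift_star x : free_lift (star x) = star (free_lift x).
Proof.
apply: (mono_lift_star (@free_ind C X) (@fstar_antilinear C X) (@fstarU C X)
  free_lift_linear free_liftU).
move=> w; rewrite /wstar /=; elim: (w : seq _) => [|[x0 b] s IHs] /=.
  by rewrite !big_nil star1.
rewrite rev_cons -cats1 big_cat big_seq1 big_cons starM -IHs; congr (_ * _).
by rewrite /letter_lift /=; case: b => //=; rewrite starK.
Qed.

Lemma free_lift_hom : star_hom free_lift.
Proof.
split; [exact: free_lift_linear|exact: free_liftM|exact: free_lift1|].
exact: free_lift_star.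
Qed.

End FreeLift.

HB.mixin Record isStarIdeal (C : numClosedFieldType) (A : starAlgType C)
    (I : A -> bool) := {
  ideal_mulr_subproof : forall u a, u \in I -> u * a \in I;
  ideal_star_subproof : forall u, u \in I -> star u \in I
}.

(* Proper two-sided $*$-ideals; [idealr] provides closure under left products. *)
#[short(type="starIdeal")]
HB.structure Definition StarIdeal (C : numClosedFieldType) (A : starAlgType C) :=
  {I of Idealr A I & isStarIdeal C A I}.

Section QuotientStarAlgebra.
Local Open Scope quotient_scope.
Variables (C : numClosedFieldType) (A : starAlgType C) (I : starIdeal A).

Definition quot_star_alg : Type := Quotient.quot I.
Local Notation Q := quot_star_alg.
HB.instance Definition _ := Choice.on Q.
HB.instance Definition _ : EqQuotient A (Quotient.equiv I) Q := EqQuotient.on Q.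
HB.instance Definition _ := GRing.Zmodule.on Q.

Definition to_quot (x : A) : Q := \pi_Q x.

Lemma quot_eqP (x y : A) : to_quot x = to_quot y <-> x - y \in (I : pred A).
Proof. by rewrite (Quotient.idealrBE I); split=> [/eqP|/eqP]. Qed.

Lemma to_quotD : {morph to_quot : x y / x + y}.
Proof. by move=> x y; exact: (@Quotient.pi_add A I). Qed.
Lemma to_quotN : {morph to_quot : x / - x}.
Proof. by move=> x; exact: (@Quotient.pi_opp A I). Qed.
Lemma to_quot_surj (a : Q) : exists x, a = to_quot x.
Proof. by exists (repr a); rewrite /to_quot reprK. Qed.
Lemma repr_quot (x : A) : repr (to_quot x) - x \in (I : pred A).
Proof. by apply/quot_eqP; rewrite /to_quot reprK. Qed.

Definition quot_one : Q := to_quot 1.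
Definition quot_mul : Q -> Q -> Q := locked (fun a b => to_quot (repr a * repr b)).
Definition quot_scale : C -> Q -> Q := locked (fun c a => to_quot (c *: repr a)).
Definition quot_star : Q -> Q := locked (fun a => to_quot (star (repr a))).

Lemma to_quotM x y : to_quot (x * y) = quot_mul (to_quot x) (to_quot y).
Proof.
rewrite /quot_mul -lock; apply/esym/quot_eqP.
set x' := repr _; set y' := repr _.
have -> : x' * y' - x * y = (x' - x) * y' + x * (y' - y).
  by rewrite mulrBl mulrBr addrA subrK.
by apply: rpredD; [apply: ideal_mulr_subproof|apply: idealMr]; apply: repr_quot.
Qed.

Lemma to_quotZ c x : to_quot (c *: x) = quot_scale c (to_quot x).
Proof.
rewrite /quot_scale -lock; apply/esym/quot_eqP; rewrite -scalerBr -mulr_algl.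
by apply: idealMr; apply: repr_quot.
Qed.

Lemma to_quot_star x : to_quot (star x) = quot_star (to_quot x).
Proof.
rewrite /quot_star -lock; apply/esym/quot_eqP; rewrite -starB.
by apply: ideal_star_subproof; apply: repr_quot.
Qed.

Lemma quot_mulA : associative quot_mul.
Proof.
move=> a b c; have [[[x ->] [y ->]] [z ->]] :=
  (to_quot_surj a, to_quot_surj b, to_quot_surj c).
by rewrite -!to_quotM mulrA.
Qed.
Lemma quot_mul1 : left_id quot_one quot_mul.
Proof. by move=> a; have [x ->] := to_quot_surj a; rewrite -to_quotM mul1r. Qed.
Lemma quot_mulr1 : right_id quot_one quot_mul.
Proof. by move=> a; have [x ->] := to_quot_surj a; rewrite -to_quotM mulr1. Qed.
Lemma quot_mulDl : left_distributive quot_mul +%R.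
Proof.
move=> a b c; have [[[x ->] [y ->]] [z ->]] :=
  (to_quot_surj a, to_quot_surj b, to_quot_surj c).
by rewrite -to_quotD -!to_quotM -to_quotD mulrDl.
Qed.
Lemma quot_mulDr : right_distributive quot_mul +%R.
Proof.
move=> a b c; have [[[x ->] [y ->]] [z ->]] :=
  (to_quot_surj a, to_quot_surj b, to_quot_surj c).
by rewrite -to_quotD -!to_quotM -to_quotD mulrDr.
Qed.
Lemma quot_one_neq0 : quot_one != 0.
Proof.
have -> : 0 = to_quot 0 by apply: (addrI (to_quot 0)); rewrite -to_quotD !addr0.
by apply/eqP => /quot_eqP; rewrite subr0 idealr1.
Qed.
HB.instance Definition _ := GRing.Zmodule_isNzRing.Build Q
  quot_mulA quot_mul1 quot_mulr1 quot_mulDl quot_mulDr quot_one_neq0.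

Lemma quot_scalerA c d a : quot_scale c (quot_scale d a) = quot_scale (c * d) a.
Proof. by have [x ->] := to_quot_surj a; rewrite -!to_quotZ scalerA. Qed.
Lemma quot_scale1 : left_id 1 quot_scale.
Proof. by move=> a; have [x ->] := to_quot_surj a; rewrite -to_quotZ scale1r. Qed.
Lemma quot_scalerDr : right_distributive quot_scale +%R.
Proof.
move=> c a b; have [[x ->] [y ->]] := (to_quot_surj a, to_quot_surj b).
by rewrite -to_quotD -!to_quotZ -to_quotD scalerDr.
Qed.
Lemma quot_scalerDl a : {morph quot_scale^~ a : c d / c + d}.
Proof.
by move=> c d; have [x ->] := to_quot_surj a; rewrite -!to_quotZ -to_quotD scalerDl.
Qed.
HB.instance Definition _ := GRing.Zmodule_isLmodule.Build C Q
  quot_scalerA quot_scale1 quot_scalerDr quot_scalerDl.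

Lemma to_quotME x y : to_quot (x * y) = to_quot x * to_quot y.
Proof. exact: to_quotM. Qed.
Lemma to_quotZE c x : to_quot (c *: x) = c *: to_quot x.
Proof. exact: to_quotZ. Qed.

Lemma quot_scalerAl (c : C) (a b : Q) : c *: (a * b) = (c *: a) * b.
Proof.
have [[x ->] [y ->]] := (to_quot_surj a, to_quot_surj b).
by rewrite -to_quotME -!to_quotZE -to_quotME scalerAl.
Qed.
HB.instance Definition _ := GRing.Lmodule_isLalgebra.Build C Q quot_scalerAl.

Lemma quot_scalerAr (c : C) (a b : Q) : c *: (a * b) = a * (c *: b).
Proof.
have [[x ->] [y ->]] := (to_quot_surj a, to_quot_surj b).
by rewrite -to_quotME -!to_quotZE -to_quotME scalerAr.
Qed.
HB.instance Definition _ := GRing.Lalgebra_isAlgebra.Build C Q quot_scalerAr.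

Lemma quot_star_antilinear (c : C) (a b : Q) :
  quot_star (c *: a + b) = c^* *: quot_star a + quot_star b.
Proof.
have [[x ->] [y ->]] := (to_quot_surj a, to_quot_surj b).
by rewrite -to_quotZE -to_quotD -!to_quot_star star_antilinear to_quotD to_quotZE.
Qed.
Lemma quot_starM (a b : Q) : quot_star (a * b) = quot_star b * quot_star a.
Proof.
have [[x ->] [y ->]] := (to_quot_surj a, to_quot_surj b).
by rewrite -to_quotME -!to_quot_star starM to_quotME.
Qed.
Lemma quot_starK : involutive quot_star.
Proof. by move=> a; have [x ->] := to_quot_surj a; rewrite -!to_quot_star starK. Qed.
HB.instance Definition _ := isStarAlgebra.Build C Q
  quot_star_antilinear quot_starM quot_starK.

Lemma to_quot_hom : star_hom to_quot.
Proof.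
split=> [c x y|x y||x] //; last by rewrite to_quot_star.
  by rewrite to_quotD to_quotZE.
exact: to_quotME.
Qed.

Lemma all_to_quot0 (r : seq A) :
  (forall x, x \in r -> x \in (I : pred A)) -> all (pred1 0) (map to_quot r).
Proof.
move=> rI; rewrite all_map; apply/allP => x xr /=.
rewrite -(star_hom0 to_quot_hom); apply/eqP/quot_eqP; rewrite subr0; exact: rI.
Qed.

(* Descent of f to the quotient; meaningful when f vanishes on I. *)
Definition quot_lift (B : Type) (f : A -> B) (a : Q) : B := f (repr a).

Section QuotLift.
Variables (B : starAlgType C) (f : A -> B).
Hypothesis f_hom : star_hom f.
Hypothesis fI : forall u, u \in (I : pred A) -> f u = 0.

Lemma quot_liftE x : quot_lift f (to_quot x) = f x.
Proof.
have [fL _ _ _] := f_hom; rewrite /quot_lift.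
have -> : repr (to_quot x) = 1 *: (repr (to_quot x) - x) + x.
  by rewrite scale1r subrK.
rewrite fL fI ?scaler0 ?add0r //.
exact: repr_quot.
Qed.

Lemma quot_lift_hom : star_hom (quot_lift f).
Proof.
have [fL fM f1 fS] := f_hom; have [qL qM q1 qS] := to_quot_hom.
split=> [c a b|a b||a].
- have [[x ->] [y ->]] := (to_quot_surj a, to_quot_surj b).
  by rewrite -qL !quot_liftE fL.
- have [[x ->] [y ->]] := (to_quot_surj a, to_quot_surj b).
  by rewrite -qM !quot_liftE fM.
- by rewrite -q1 quot_liftE.
- have [x ->] := to_quot_surj a.
  by rewrite -qS !quot_liftE fS.
Qed.
End QuotLift.
End QuotientStarAlgebra.

Section GeneratedIdeal.
Variables (C : numClosedFieldType) (A : starAlgType C).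

(* The two-sided $*$-ideal generated by G. *)
Inductive star_ideal (G : set A) : set A :=
| star_ideal_gen x of G x : star_ideal G x
| star_ideal0 : star_ideal G 0
| star_idealD x y of star_ideal G x & star_ideal G y : star_ideal G (x + y)
| star_idealMl a x of star_ideal G x : star_ideal G (a * x)
| star_idealMr a x of star_ideal G x : star_ideal G (x * a)
| star_ideal_star x of star_ideal G x : star_ideal G (star x).

Lemma star_ideal_hom (G : set A) (B : starAlgType C) (f : A -> B) :
  star_hom f -> (forall x, G x -> f x = 0) -> forall x, star_ideal G x -> f x = 0.
Proof.
move=> fh fG x; have [fL fM _ fS] := fh; elim=> {x}.
- exact: fG.
- exact: star_hom0.
- by move=> x y _ fx _ fy; rewrite -[x]scale1r fL fx fy scaler0 addr0.
- by move=> a x _ fx; rewrite fM fx mulr0.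
- by move=> a x _ fx; rewrite fM fx mul0r.
- by move=> x _ fx; rewrite fS fx star0.
Qed.
End GeneratedIdeal.

Section Sphere.
Variables (R : realType) (q : R).
Local Notation C := R[i].
Local Open Scope complex_scope.

Variant sphere_gen := GenA | GenB.
Definition sphere_gen_bool g := if g is GenA then true else false.
Definition bool_sphere_gen (b : bool) := if b then GenA else GenB.
Lemma sphere_gen_boolK : cancel sphere_gen_bool bool_sphere_gen.
Proof. by case. Qed.
HB.instance Definition _ := Equality.copy sphere_gen (can_type sphere_gen_boolK).
HB.instance Definition _ := Choice.copy sphere_gen (can_type sphere_gen_boolK).

Definition sphere_relators (F : starAlgType C) (A B : F) : seq F :=
  [:: star A - A;
      B * A - (q ^+ 2)%:C *: (A * B);
      star B * B - (- A ^+ 2 + 1);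
      B * star B - (- ((q ^+ 4)%:C *: A ^+ 2) + 1)].

Lemma map_sphere_relators (E F : starAlgType C) (f : E -> F) A B :
  star_hom f -> map f (sphere_relators A B) = sphere_relators (f A) (f B).
Proof.
move=> fh; have [_ fM f1 fS] := fh.
by rewrite /sphere_relators /= !(star_homD fh, star_homN fh, star_homZ fh,
  star_homX _ fh, fM, fS, f1).
Qed.

Lemma sphere_relatorsP (F : starAlgType C) (A B : F) :
  reflect [/\ star A = A, B * A = (q ^+ 2)%:C *: (A * B),
              star B * B = - A ^+ 2 + 1 &
              B * star B = - ((q ^+ 4)%:C *: A ^+ 2) + 1]
    (all (pred1 0) (sphere_relators A B)).
Proof.
rewrite /= !subr_eq0 andbT; apply: (iffP and4P).
  by case=> /eqP ? /eqP ? /eqP ? /eqP ?.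
by case=> *; split; apply/eqP.
Qed.

Lemma sphere_relatorsN (F : starAlgType C) (A B : F) :
  all (pred1 0) (sphere_relators A B) -> all (pred1 0) (sphere_relators (- A) (- B)).
Proof.
by move=> /sphere_relatorsP[h1 h2 h3 h4]; apply/sphere_relatorsP;
  rewrite !starN !mulrNN !sqrrN h1.
Qed.

Local Notation F := (free_star C sphere_gen).

Definition sphere_ideal : set F := 
  star_ideal [set` sphere_relators (fgen C GenA) (fgen C GenB)].
Definition sphere_ideal_pred (x : F) : bool := `[< sphere_ideal x >].

Definition sphere_gen_lift (B : Type) (a b : B) (g : sphere_gen) : B :=
  if g is GenA then a else b.

Lemma sphere_ideal_lift (B : starAlgType C) (a b : B) :
  all (pred1 0) (sphere_relators a b) ->
  forall u, sphere_ideal u -> free_lift (sphere_gen_lift a b) u = 0.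
Proof.
move=> /allP ab0; have fh := free_lift_hom (sphere_gen_lift a b).
apply: (star_ideal_hom fh) => x /= xr; apply/eqP/ab0.
have := map_sphere_relators (fgen C GenA) (fgen C GenB) fh.
by rewrite !free_lift_gen => <-; apply: map_f.
Qed.

Section SphereIdeal.

Let char_relators : all (pred1 0) (sphere_relators (0 : C^o) (1 : C^o)).
Proof.
by rewrite /= star0 star1 expr0n /=
  !(mulr0, mul0r, mulr1, scaler0, oppr0, add0r, subrr) !eqxx.
Qed.

Lemma sphere_ideal_proper : ~ sphere_ideal 1.
Proof.
move=> I1; have fh := @free_lift_hom C _ C^o (sphere_gen_lift 0 1).
have := sphere_ideal_lift char_relators I1.
by have [_ _ -> _] := fh; apply/eqP; rewrite oner_eq0.
Qed.

Lemma sphere_ideal_zmod_closed : zmod_closed sphere_ideal_pred.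
Proof.
split=> [|x y /asboolP Ix /asboolP Iy]; apply/asboolP; first exact: star_ideal0.
by apply: star_idealD => //; rewrite -mulN1r; apply: star_idealMl.
Qed.
HB.instance Definition _ :=
  GRing.isZmodClosed.Build F sphere_ideal_pred sphere_ideal_zmod_closed.

Lemma sphere_ideal_idealr : 1 \notin (sphere_ideal_pred : pred F) /\
  forall a, {in (sphere_ideal_pred : pred F), forall u, a * u \in (sphere_ideal_pred : pred F)}.
Proof.
split=> [|a u /asboolP Iu]; last by apply/asboolP; apply: star_idealMl.
by apply/negP => /asboolP; exact: sphere_ideal_proper.
Qed.
HB.instance Definition _ :=
  isProperIdeal.Build F sphere_ideal_pred sphere_ideal_idealr.

Lemma sphere_ideal_mulr u a : u \in sphere_ideal_pred -> u * a \in sphere_ideal_pred.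
Proof. by move=> /asboolP Iu; apply/asboolP; apply: star_idealMr. Qed.
Lemma sphere_ideal_star u : u \in sphere_ideal_pred -> star u \in sphere_ideal_pred.
Proof. by move=> /asboolP Iu; apply/asboolP; apply: star_ideal_star. Qed.
HB.instance Definition _ :=
  isStarIdeal.Build C F sphere_ideal_pred sphere_ideal_mulr sphere_ideal_star.

End SphereIdeal.

Definition sphere_alg : Type := quot_star_alg sphere_ideal_pred.
HB.instance Definition _ := StarAlgebra.on sphere_alg.

Definition sphere_A : sphere_alg := to_quot sphere_ideal_pred (fgen C GenA).
Definition sphere_B : sphere_alg := to_quot sphere_ideal_pred (fgen C GenB).

Section SphereLift.
Variables (B : starAlgType C) (a b : B).
Hypothesis ab_relators : all (pred1 0) (sphere_relators a b).

Definition sphere_lift : sphere_alg -> B := quot_lift (free_lift (sphere_gen_lift a b)).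

Let lift_ideal u :
  u \in (sphere_ideal_pred : pred F) -> free_lift (sphere_gen_lift a b) u = 0.
Proof. by move=> /asboolP; apply: sphere_ideal_lift. Qed.

Lemma sphere_lift_hom : star_hom sphere_lift.
Proof. exact: (quot_lift_hom (free_lift_hom _) lift_ideal). Qed.
Lemma sphere_liftA : sphere_lift sphere_A = a.
Proof.
by rewrite /sphere_lift (quot_liftE (free_lift_hom _) lift_ideal) free_lift_gen.
Qed.
Lemma sphere_liftB : sphere_lift sphere_B = b.
Proof.
by rewrite /sphere_lift (quot_liftE (free_lift_hom _) lift_ideal) free_lift_gen.
Qed.
End SphereLift.

Lemma sphere_relators0 : all (pred1 0) (sphere_relators sphere_A sphere_B).
Proof.
rewrite -(map_sphere_relators _ _ (to_quot_hom sphere_ideal_pred)).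
by apply: all_to_quot0 => x xr; apply/asboolP; apply: star_ideal_gen.
Qed.

Definition r2 : sphere_alg -> sphere_alg := sphere_lift (- sphere_A) (- sphere_B).

Let r2_relators := sphere_relatorsN sphere_relators0.

Lemma r2_hom : star_hom r2. Proof. exact: sphere_lift_hom r2_relators. Qed.
Lemma r2A : r2 sphere_A = - sphere_A. Proof. exact: sphere_liftA r2_relators. Qed.
Lemma r2B : r2 sphere_B = - sphere_B. Proof. exact: sphere_liftB r2_relators. Qed.

Definition r2_fixed : {pred sphere_alg} := [pred a | r2 a == a].

Lemma r2_fixed_subalg : GRing.subalg_closed r2_fixed.
Proof.
have [rL rM r1 _] := r2_hom.
split=> [|c x y|x y]; rewrite !inE; first by rewrite r1.
  by move=> /eqP hx /eqP hy; rewrite rL hx hy.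
by move=> /eqP hx /eqP hy; rewrite rM hx hy.
Qed.
HB.instance Definition _ := GRing.isSubalgClosed.Build C sphere_alg r2_fixed
  r2_fixed_subalg.

Record rp2_alg := RP2Alg { rp2_val : sphere_alg; _ : rp2_val \in r2_fixed }.
HB.instance Definition _ := [isSub for rp2_val].
HB.instance Definition _ := [Choice of rp2_alg by <:].
HB.instance Definition _ := [SubChoice_isSubAlgebra of rp2_alg by <:].

Lemma rp2_star_subproof (x : rp2_alg) : star (rp2_val x) \in r2_fixed.
Proof.
have [_ _ _ rS] := r2_hom.
by rewrite inE rS; case: x => x /= /eqP ->.
Qed.
Definition rp2_star (x : rp2_alg) : rp2_alg := RP2Alg (rp2_star_subproof x).

Lemma rp2_star_antilinear (c : C) (x y : rp2_alg) :
  rp2_star (c *: x + y) = (c^*)%R *: rp2_star x + rp2_star y.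
Proof. by apply: val_inj; rewrite /= star_antilinear. Qed.
Lemma rp2_starM (x y : rp2_alg) : rp2_star (x * y) = rp2_star y * rp2_star x.
Proof. by apply: val_inj; rewrite /= starM. Qed.
Lemma rp2_starK : involutive rp2_star.
Proof. by move=> x; apply: val_inj; rewrite /= starK. Qed.
HB.instance Definition _ := isStarAlgebra.Build C rp2_alg
  rp2_star_antilinear rp2_starM rp2_starK.

Lemma rp2_P_subproof : sphere_A ^+ 2 \in r2_fixed.
Proof. by rewrite inE (star_homX 2 r2_hom) r2A sqrrN. Qed.
Lemma rp2_R_subproof : sphere_B ^+ 2 \in r2_fixed.
Proof. by rewrite inE (star_homX 2 r2_hom) r2B sqrrN. Qed.
Lemma rp2_T_subproof : sphere_A * sphere_B \in r2_fixed.
Proof. by have [_ rM _ _] := r2_hom; rewrite inE rM r2A r2B mulrNN. Qed.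

Definition rp2_P : rp2_alg := RP2Alg rp2_P_subproof.
Definition rp2_R : rp2_alg := RP2Alg rp2_R_subproof.
Definition rp2_T : rp2_alg := RP2Alg rp2_T_subproof.

End Sphere.

(* Inner products are linear in the first argument and antilinear in the second. *)
HB.mixin Record isHilbert (C : numClosedFieldType) H & CompleteNormedModule C H := {
  dotp : {dot H for @Num.conj_op C};
  dotp_norm : forall x : H, dotp x x = `|x| ^+ 2
}.
#[short(type="hilbertType")]
HB.structure Definition Hilbert (C : numClosedFieldType) :=
  {H of CompleteNormedModule C H & isHilbert C H}.


Section ComplexHilbert.
Variable R : realType.
Local Notation C := R[i].

Let le_norm_Im (x : C) : `|complex.Im x|%:C%C <= `|x|.
Proof.
by rewrite -[complex.Im x]opprK -ReiNIm normrN (le_trans (normc_ge_Re _)) // normrM normCi mulr1.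
Qed.

Let norm_le_ReIm (x : C) : `|x| <= (`|complex.Re x| + `|complex.Im x|)%:C%C.
Proof.
rewrite {1}[x]complexE (le_trans (ler_normD _ _)) // rmorphD lerD //=.
  by rewrite normc_def /= expr0n addr0 sqrtr_sqr.
by rewrite normrM normCi mul1r normc_def /= expr0n addr0 sqrtr_sqr.
Qed.

Lemma complex_complete (F : set_system C^o) : ProperFilter F -> cauchy F -> cvg F.
Proof.
move=> FF /cauchyP Fc.
have aux (p : C -> R) : (forall x y, p (x - y) = p x - p y) ->
    (forall x, `|p x|%:C%C <= `|x|) -> cvg (p @ F).
  move=> pB ple; apply: cauchy_cvg; apply/cauchyP => e e0.
  have [|x Fx] := Fc e%:C%C; first by rewrite ltcR.
  exists (p x); change (F (p @^-1` ball (p x) e)); apply: filterS Fx => y xy.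
  by change (`|p x - p y| < e); rewrite -pB -ltcR (le_lt_trans (ple _)).
have /cvg_ex[a Fa] := aux _ (raddfB (@complex.Re R)) (@normc_ge_Re R).
have /cvg_ex[b Fb] := aux _ (raddfB (@complex.Im R)) le_norm_Im.
apply/cvg_ex; exists (a +i* b)%C; apply/cvgrPdist_lt => e e0.
have eE : e = (complex.Re e)%:C%C 
  by rewrite [LHS]complexE (ger0_Im (ltW e0)) mulr0 addr0.
have e2 : 0 < complex.Re e / 2 by rewrite divr_gt0 // -ltcR -eE.
move/cvgrPdist_lt: Fa => /(_ _ e2) Fa; move/cvgrPdist_lt: Fb => /(_ _ e2) Fb.
near=> z; rewrite eE (le_lt_trans (norm_le_ReIm _)) // ltcR [complex.Re e]splitr ltrD //.
- by rewrite raddfB /=; near: z.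
- by rewrite raddfB /=; near: z.
Unshelve. all: by end_near. Qed.

(* A fresh name for C as a vector space over itself: the instances on _^o
   are reserved for real fields. *)
Definition complex_line : Type := C^o.
HB.instance Definition _ := NormedModule.copy complex_line C^o.
HB.instance Definition _ := Uniform_isComplete.Build complex_line complex_complete.


Definition complex_dot (x y : complex_line) : C := (x : C) * (y : C)^*.
Lemma complex_dot_bilinear :
  bilinear_for *%R (Num.conj \; *%R) complex_dot.
Proof.
split=> [y|x] c u v; rewrite /complex_dot.
  by rewrite mulrDl -mulrA.
by rewrite rmorphD rmorphM mulrDr mulrCA.
Qed.
HB.instance Definition _ := bilinear_isBilinear.Build C complex_line complex_line C _ _ complex_dot complex_dot_bilinear.
Lemma complex_dotC (x y : complex_line) :
  complex_dot x y = (-1) ^+ false * (complex_dot y x)^*.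
Proof. by rewrite /complex_dot expr0 mul1r rmorphM /= conjCK mulrC. Qed.
HB.instance Definition _ := isHermitianSesquilinear.Build C complex_line false Num.conj complex_dot complex_dotC.
Lemma complex_dot_gt0 (x : complex_line) : x != 0 -> 0 < complex_dot x x.
Proof. by move=> x0; rewrite /complex_dot -normCK exprn_gt0 ?normr_gt0. Qed.
HB.instance Definition _ := isDotProduct.Build C complex_line complex_dot complex_dot_gt0.
Lemma complex_dot_norm (x : complex_line) : complex_dot x x = `|x| ^+ 2.
Proof. by rewrite /complex_dot normCK. Qed.
HB.instance Definition _ := isHilbert.Build C complex_line complex_dot_norm.

End ComplexHilbert.

Arguments rp2_P {R} q.
Arguments rp2_R {R} q.
Arguments rp2_T {R} q.

Section Representations.
Variable R : realType.
Local Notation C := R[i].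

Definition linear_subspace (H : hilbertType C) (V : set H) : Prop :=
  V 0 /\ forall (c : C) x y, V x -> V y -> V (c *: x + y).

Definition bounded_on (H : hilbertType C) (D : set H) (T : H -> H) : Prop :=
  exists M : R, forall x, D x -> `|T x| <= M%:C%C * `|x|.

(* Only the values of [rho a] on the domain D are meaningful. *)
Record is_star_rep (A : starAlgType C) (H : hilbertType C) (D : set H)
    (rho : A -> H -> H) : Prop := IsStarRep {
  rep_dom_subspace : linear_subspace D;
  rep_dom_dense : dense D;
  rep_stable : forall a x, D x -> D (rho a x);
  rep_linear : forall a (c : C) x y, D x -> D y ->
    rho a (c *: x + y) = c *: rho a x + rho a y;
  rep_alg_linear : forall (c : C) a b x, D x ->
    rho (c *: a + b) x = c *: rho a x + rho b x;
  rep_one : forall x, D x -> rho 1 x = x;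
  rep_mul : forall a b x, D x -> rho (a * b) x = rho a (rho b x);
  rep_adjoint : forall a x y, D x -> D y ->
    dotp (rho a x) y = dotp x (rho (star a) y)
}.

Definition unbounded_star_rep (A : starAlgType C) (H : hilbertType C)
    (D : set H) (rho : A -> H -> H) : Prop :=
  is_star_rep D rho /\ exists a, ~ bounded_on D (rho a).

(* A bounded representation acts on the whole Hilbert space. *)
Definition bounded_star_rep (A : starAlgType C) (H : hilbertType C)
    (rho : A -> H -> H) : Prop :=
  is_star_rep setT rho /\ forall a, bounded_on setT (rho a).

Definition irreducible_star_rep (A : starAlgType C) (H : hilbertType C)
    (rho : A -> H -> H) : Prop :=
  [/\ bounded_star_rep rho,
      exists x : H, x != 0 &
      forall V : set H, linear_subspace V -> closed V ->
        (forall a x, V x -> V (rho a x)) -> V = [set 0] \/ V = setT].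

Definition unitarily_equivalent (A : starAlgType C) (H K : hilbertType C)
    (rho : A -> H -> H) (sigma : A -> K -> K) : Prop :=
  exists U : {linear H -> K},
    [/\ bijective U,
        forall x y, dotp (U x) (U y) = dotp x y &
        forall a x, U (rho a x) = sigma a (U x)].

Definition orthonormal_basis (H : hilbertType C) (e : nat -> H) : Prop :=
  (forall i j, dotp (e i) (e j) = (i == j)%:R) /\
  dense [set x | exists (n : nat) (c : nat -> C), x = \sum_(k < n) c k *: e k].

Definition rp2_rep_theta (q theta : R)
    (rho : rp2_alg q -> complex_line R -> complex_line R) : Prop :=
  forall z, [/\ rho (rp2_P q) z = 0, rho (rp2_T q) z = 0 &
                rho (rp2_R q) z = (cos theta +i* sin theta)%C *: z].

Record rp2_rep_infty (q : R) (H : hilbertType C) (e : nat -> H)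
    (rho : rp2_alg q -> H -> H) : Prop := RP2RepInfty {
  rho_P : forall k, rho (rp2_P q) (e k) = (q ^+ (4 * k))%:C%C *: e k;
  rho_T0 : rho (rp2_T q) (e 0%N) = 0;
  rho_T : forall k, (0 < k)%N -> rho (rp2_T q) (e k) =
    (q ^+ (2 * (k - 1)) * Num.sqrt (1 - q ^+ (4 * k)))%:C%C *: e (k - 1)%N;
  rho_Tstar : forall k, rho (star (rp2_T q)) (e k) =
    (q ^+ (2 * k) * Num.sqrt (1 - q ^+ (4 * (k + 1))))%:C%C *: e (k + 1)%N;
  rho_R0 : rho (rp2_R q) (e 0%N) = 0;
  rho_R1 : rho (rp2_R q) (e 1%N) = 0;
  rho_R : forall k, (1 < k)%N -> rho (rp2_R q) (e k) =
    (Num.sqrt (1 - q ^+ (4 * k)) * Num.sqrt (1 - q ^+ (4 * (k - 1))))%:C%C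
      *: e (k - 2)%N;
  rho_Rstar : forall k, rho (star (rp2_R q)) (e k) =
    (Num.sqrt (1 - q ^+ (4 * (k + 1))) * Num.sqrt (1 - q ^+ (4 * (k + 2))))%:C%C
      *: e (k + 2)%N
}.

End Representations.

(* Main.v *)
Require Import Defs.
From HB Require Import structures.
From mathcomp Require Import all_boot all_order all_algebra.
From mathcomp Require Import all_classical all_reals.
From mathcomp Require Import topology normedtype trigo complex.
From mathcomp Require Import sesquilinear ssrAC sequences ring lra.
From mathcomp Require Import -(notations) monalg.

(** The relations of the algebra write X^*X and XX^*, for each generator X among
    P, T and R, as a polynomial in the self-adjoint P.  Put x = q^4.

    No representation is unbounded: x T^*T = P - P^2 is positive, hence P has norm
    at most 1, and then the norms of T, R and their adjoints are controlled by
    that of P ([rep_bounded]).  The bound passes to all elements because P, T, R and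
    the adjoints of T and R generate the algebra ([rp2_ind]): a fixed point of r_2 is
    a combination of words of even length in A, B, B^*, and every product of two
    letters is a combination of 1 and of these five elements.

    Let an irreducible representation be given.  If P is not 0, then P has a
    nonzero fixed vector.  Indeed the powers of P converge strongly to the
    projection onto the fixed vectors ([powers_cvg]).  Suppose that there are none.
    Since T P = x P T, a bound M for P on the range of T says that P is bounded by
    x M on the support of T^*T, that is, off the kernels of P and 1 - P; so any bound
    M improves to x M ([moment_bound_step]) and P = 0.  Over a unit fixed vector the
    powers of T^* generate an orthonormal ladder, on which the relations force
    the formulas of the infinite-dimensional representation; by irreducibility it
    spans the space ([irreducible_P_neq0]).

    If P = 0, then T = 0 and R is a unitary commuting with everything, hence a
    scalar, by a form of Schur's lemma that needs no spectral theorem ([Schur]): for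
    a self-adjoint S in the commutant, with absolute value G obtained from
    a square root iteration, (G - S)(G + S) = 0, so that S is positive or negative;
    this holds for all S - c, which makes S a scalar.  The representation then has
    dimension one and is determined by the value of R ([irreducible_P_eq0]).

    Existence: the representation on square summable sequences is the restriction
    of the representation of the sphere algebra in which A is diagonal
    and B is a weighted shift ([l2_relators]).  An invariant closed subspace which is
    not 0 contains, after enough applications of T, a vector with nonzero coordinate
    at 0, then the limit of its images by the powers of P, which is the 0-th
    basis vector, and then all basis vectors by T^* ([l2_irreducible]). *)

Set Implicit Arguments.
Unset Strict Implicit.
Unset Printing Implicit Defensive.

Import Order.TTheory GRing.Theory Num.Theory.
Import numFieldNormedType.Exports.

Local Open Scope classical_set_scope.
Local Open Scope ring_scope.

(** * Inner products and topology of Hilbert spaces *)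

Section ComplexNumbers.
Variable R : realType.
Local Notation C := R[i].
Implicit Types (z : C) (a : R).

Lemma conj_realC a : (a%:C%C : C)^* = a%:C%C.
Proof. by rewrite /Num.conj /= oppr0. Qed.

Definition csq z : R := complex.Re z ^+ 2 + complex.Im z ^+ 2.

Lemma csq_ge0 z : 0 <= csq z. Proof. by rewrite addr_ge0 ?sqr_ge0. Qed.

End ComplexNumbers.

Section RealPart.
Variables (R : realType) (U : lmodType R[i]) (f : {dot U for @Num.conj_op R[i]}).
Local Notation C := R[i].
Implicit Types (u v w : U) (a : R) (c : C).

(** Estimates and limits are carried out in the totally ordered field R, on
    the real part of the inner product. *)
Definition rdot u v : R := complex.Re (f u v).
Definition nsq u : R := rdot u u.

Lemma form_conj u v : f u v = (f v u)^*.
Proof. by rewrite hermC expr0 mul1r. Qed.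

Lemma rdotC u v : rdot u v = rdot v u.
Proof. by rewrite /rdot form_conj; case: (f v u). Qed.

Lemma rdotDl u v w : rdot (u + v) w = rdot u w + rdot v w.
Proof. by rewrite /rdot linearDl raddfD. Qed.

Lemma rdotNl u w : rdot (- u) w = - rdot u w.
Proof. by rewrite /rdot linearNl raddfN. Qed.

Lemma rdotBl u v w : rdot (u - v) w = rdot u w - rdot v w.
Proof. by rewrite rdotDl rdotNl. Qed.

Lemma rdotZl a u w : rdot (a%:C%C *: u) w = a * rdot u w.
Proof. by rewrite /rdot linearZl_LR /=; case: (f u w) => b c /=; rewrite mul0r subr0. Qed.

Lemma rdotDr u v w : rdot w (u + v) = rdot w u + rdot w v.
Proof. by rewrite !(rdotC w) rdotDl. Qed.

Lemma rdotNr u w : rdot w (- u) = - rdot w u.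
Proof. by rewrite !(rdotC w) rdotNl. Qed.

Lemma rdotBr u v w : rdot w (u - v) = rdot w u - rdot w v.
Proof. by rewrite !(rdotC w) rdotBl. Qed.

Lemma rdotZr a u w : rdot w (a%:C%C *: u) = a * rdot w u.
Proof. by rewrite !(rdotC w) rdotZl. Qed.

Definition rdotE := (rdotDl, rdotDr, rdotBl, rdotBr, rdotNl, rdotNr, rdotZl, rdotZr).

Lemma rdot0l u : rdot 0 u = 0.
Proof. by rewrite /rdot linear0l. Qed.

Lemma rdot0r u : rdot u 0 = 0.
Proof. by rewrite rdotC rdot0l. Qed.

Lemma nsqC u : f u u = (nsq u)%:C%C.
Proof.
have := dnorm_ge0 f u; rewrite /nsq /rdot; case: (f u u) => a b /=.
by rewrite lecE /= => /andP[/eqP ->].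
Qed.

Lemma nsq_ge0 u : 0 <= nsq u.
Proof. by rewrite -lecR -nsqC; exact: dnorm_ge0. Qed.

Lemma nsq_eq0 u : nsq u = 0 -> u = 0.
Proof. by move=> u0; apply/eqP; rewrite -(dnorm_eq0 f) nsqC u0. Qed.

Lemma nsq_le0 u : nsq u <= 0 -> u = 0.
Proof. by move=> u0; apply: nsq_eq0; apply/eqP; rewrite eq_le u0 nsq_ge0. Qed.

Lemma nsq0 : nsq 0 = 0. Proof. exact: rdot0l. Qed.

Lemma nsqD u v : nsq (u + v) = nsq u + 2 * rdot u v + nsq v.
Proof. by rewrite /nsq !rdotE (rdotC v u); ring. Qed.

Lemma nsqB u v : nsq (u - v) = nsq u - 2 * rdot u v + nsq v.
Proof. by rewrite /nsq !rdotE (rdotC v u); ring. Qed.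

Lemma nsqN u : nsq (- u) = nsq u.
Proof. by rewrite /nsq !rdotE opprK. Qed.

Lemma nsq_sym u v : nsq (u - v) = nsq (v - u).
Proof. by rewrite -nsqN opprB. Qed.

Lemma nsqZ c u : nsq (c *: u) = csq c * nsq u.
Proof.
rewrite {1}/nsq /rdot dnormZ nsqC sqr_normc.
by case: c => a b; rewrite /csq /=; ring.
Qed.

Lemma nsqZr a u : nsq (a%:C%C *: u) = a ^+ 2 * nsq u.
Proof. by rewrite /nsq !rdotE; ring. Qed.

Lemma Cauchy_Schwarz u v : rdot u v ^+ 2 <= nsq u * nsq v.
Proof.
have [v0|v0] := eqVneq (nsq v) 0.
  by rewrite v0 (nsq_eq0 v0) rdot0r expr0n /= mulr0.
have vgt : 0 < nsq v by rewrite lt_def v0 nsq_ge0.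
have := nsq_ge0 ((nsq v)%:C%C *: u - (rdot u v)%:C%C *: v).
rewrite nsqB !nsqZr !rdotE => h.
rewrite -(ler_pM2l vgt); nra.
Qed.

Lemma rdot_le u v : rdot u v <= Num.sqrt (nsq u) * Num.sqrt (nsq v).
Proof.
apply: (le_trans (ler_norm _)); rewrite -sqrtrM ?nsq_ge0 // -sqrtr_sqr.
by rewrite ler_wsqrtr // Cauchy_Schwarz.
Qed.

Lemma sqrt_nsqD u v :
  Num.sqrt (nsq (u + v)) <= Num.sqrt (nsq u) + Num.sqrt (nsq v).
Proof.
rewrite -(@ler_pXn2r _ 2) ?nnegrE ?addr_ge0 ?sqrtr_ge0 //.
rewrite sqrrD !sqr_sqrtr ?nsq_ge0 // nsqD.
by have := rdot_le u v; lra.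
Qed.

Lemma nsqD_le u v : nsq (u + v) <= 2 * nsq u + 2 * nsq v.
Proof. by have := nsq_ge0 (u - v); rewrite nsqB nsqD; lra. Qed.

(** Multiplication of the second argument by i exposes the imaginary part, so
    that nothing is lost by working with real parts. *)
Lemma form_rdot u v : f u v = Complex (rdot u v) (rdot u ('i%C *: v)).
Proof.
rewrite /rdot linearZr_LR /=; case: (f u v) => a b /=.
by rewrite mul0r sub0r mulNr mul1r opprK.
Qed.

Lemma rdot_polarization u v : rdot u v = (nsq (u + v) - nsq (u - v)) / 4.
Proof. by rewrite nsqD nsqB; field. Qed.
End RealPart.

Section HilbertTopology.
Variables (R : realType) (K : hilbertType R[i]).
Local Notation C := R[i].
Local Notation ip := (rdot (@dotp C K)).
Local Notation sq := (nsq (@dotp C K)).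
Implicit Types (u v w : K) (V : set K) (S : K -> K) (s : nat -> R).

Lemma norm_nsq v : `|v| = (Num.sqrt (sq v))%:C%C.
Proof.
have v0 : 0 <= Num.sqrt (sq v) by rewrite sqrtr_ge0.
apply/eqP; rewrite -(@eqrXn2 _ 2) ?normr_ge0 ?lecR //.
by rewrite -dotp_norm nsqC -rmorphXn /= sqr_sqrtr ?nsq_ge0.
Qed.

Lemma norm_lt_nsq v (e : R) : 0 < e -> (`|v| < e%:C%C) = (sq v < e ^+ 2).
Proof.
move=> e0; rewrite norm_nsq ltcR -[in RHS](sqr_sqrtr (nsq_ge0 _ v)).
by rewrite ltr_pXn2r ?nnegrE ?sqrtr_ge0 // ltW.
Qed.

Lemma norm_le_nsq u v (M : R) : 0 <= M ->
  (`|u| <= M%:C%C * `|v|) = (sq u <= M ^+ 2 * sq v).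
Proof.
move=> M0; rewrite !norm_nsq -rmorphM lecR /=.
rewrite -[in RHS](sqr_sqrtr (nsq_ge0 _ u)) -[in RHS](sqr_sqrtr (nsq_ge0 _ v)).
by rewrite -exprMn ler_pXn2r ?nnegrE ?mulr_ge0 ?sqrtr_ge0.
Qed.

Lemma gt0_complexE (e : C) : 0 < e -> 0 < complex.Re e /\ e = (complex.Re e)%:C%C.
Proof.
case: e => a b; rewrite ltcE /= => /andP[/eqP b0 a0].
by split => //; rewrite b0.
Qed.

Lemma closureP V v :
  closure V v <-> forall e : R, 0 < e -> exists2 u, V u & sq (u - v) < e.
Proof.
split=> [Vv e e0|h B /nbhs_normP[e /= e0 Be]].
  have s0 : 0 < Num.sqrt e by rewrite sqrtr_gt0.
  have [|u [Vu]] := Vv (ball v (Num.sqrt e)%:C%C).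
    by apply: nbhsx_ballx; rewrite ltcR.
  rewrite -ball_normE /= norm_lt_nsq // sqr_sqrtr ?ltW // => uv.
  by exists u => //; rewrite nsq_sym.
have [r0 eE] := gt0_complexE e0.
have [|u Vu uv] := h (complex.Re e ^+ 2); first by rewrite exprn_gt0.
exists u; split=> //; apply: Be => /=.
by rewrite eE norm_lt_nsq // nsq_sym.
Qed.

Lemma denseP V :
  dense V <-> forall v (e : R), 0 < e -> exists2 u, V u & sq (u - v) < e.
Proof.
split=> [dV v|h O [v Ov] oO].
  apply/closureP => B /nbhs_interior; rewrite nbhsE => -[O [oO Ov] OB].
  have [|u [Ou Vu]] := dV O _ oO; first by exists v.
  by exists u; split=> //; apply: interior_subset; exact: OB.
have /closureP cv := h v.
have [u [Vu Ou]] := cv O (open_nbhs_nbhs (conj oO Ov)).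
by exists u.
Qed.

Lemma closed_approx V v : closed V ->
  (forall e : R, 0 < e -> exists2 u, V u & sq (u - v) < e) -> V v.
Proof. by move=> cV /closureP; apply: cV. Qed.

Lemma cvg_nsqP (u : nat -> K) v :
  u @ \oo --> v <-> (fun n => sq (u n - v)) @ \oo --> 0.
Proof.
split=> [/cvgrPdist_lt uv|/cvgrPdist_lt uv].
  apply/cvgrPdist_lt => e e0.
  have s0 : 0 < Num.sqrt e by rewrite sqrtr_gt0.
  have /uv : 0 < (Num.sqrt e)%:C%C by rewrite ltcR.
  apply: filterS => n; rewrite norm_lt_nsq // sqr_sqrtr ?ltW //.
  by rewrite sub0r normrN ger0_norm ?nsq_ge0 // nsq_sym.
apply/cvgrPdist_lt => e /gt0_complexE[e0 ->].
have /uv : 0 < complex.Re e ^+ 2 by rewrite exprn_gt0.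
apply: filterS => n; rewrite sub0r normrN ger0_norm ?nsq_ge0 //.
by rewrite norm_lt_nsq // nsq_sym.
Qed.

Lemma cvg_hilbert_unique (u : nat -> K) v w :
  u @ \oo --> v -> u @ \oo --> w -> v = w.
Proof. by apply: cvg_unique; exact: norm_hausdorff. Qed.

Lemma cvg_closed V (u : nat -> K) v :
  closed V -> (forall n, V (u n)) -> u @ \oo --> v -> V v.
Proof.
by move=> cV Vu; apply: (closed_cvg V) => //; near=> n; exact: Vu.
Unshelve. all: by end_near. Qed.

(** Bounded monotone real sequences are Cauchy, hence so is a sequence whose
    increments they dominate.  Squared norms are used since in every application
    they are the quantities that telescope. *)
Lemma cvg_of_increments (u : nat -> K) s (M : R) :
  (forall n, s n <= M) -> (forall m n, (m <= n)%N -> sq (u n - u m) <= s n - s m) ->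
  exists v, u @ \oo --> v.
Proof.
move=> sM us.
have ss : nondecreasing_seq s.
  by move=> m n /us; have := nsq_ge0 dotp (u n - u m); lra.
have cs : cvgn s.
  by apply: nondecreasing_is_cvgn => //; exists M => _ [n _ <-].
suff : cvgn u by move=> /cvg_ex.
apply: cauchy_cvg; apply/cauchyP => e /gt0_complexE[e0 ->].
set r := complex.Re e in e0 *.
have r2 : 0 < r ^+ 2 by rewrite exprn_gt0.
have /cvgrPdist_lt/(_ _ r2)[N _ hN] := cs.
exists (u N); exists N => //= n /= Nn.
rewrite -ball_normE /= norm_lt_nsq // nsq_sym (le_lt_trans (us _ _ Nn)) //.
have := hN N (leqnn N); rewrite ltr_norml => /andP[_].
by have := nondecreasing_cvgn_le ss cs n; lra.
Qed.

Definition linear_op S := forall (c : C) u v, S (c *: u + v) = c *: S u + S v.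
Definition bounded_op S := exists2 M : R, 0 <= M & forall u, sq (S u) <= M * sq u.

Section Operators.
Variable S : K -> K.
Hypothesis SL : linear_op S.

Lemma linop0 : S 0 = 0.
Proof. by have := SL (-1) 0 0; rewrite scaler0 addr0 scaleN1r addNr. Qed.
Lemma linopD u v : S (u + v) = S u + S v.
Proof. by rewrite -[u]scale1r SL !scale1r. Qed.
Lemma linopZ c u : S (c *: u) = c *: S u.
Proof. by rewrite -[c *: u]addr0 SL linop0 addr0. Qed.
Lemma linopN u : S (- u) = - S u.
Proof. by rewrite -scaleN1r linopZ scaleN1r. Qed.
Lemma linopB u v : S (u - v) = S u - S v.
Proof. by rewrite linopD linopN. Qed.
Lemma linop_sum n (F : 'I_n -> K) : S (\sum_(i < n) F i) = \sum_(i < n) S (F i).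
Proof. exact: (big_morph _ linopD linop0). Qed.

Hypothesis SB : bounded_op S.

Lemma cvg_op (u : nat -> K) v : u @ \oo --> v -> (fun n => S (u n)) @ \oo --> S v.
Proof.
move=> /cvg_nsqP uv; apply/cvg_nsqP; have [M M0 SM] := SB.
apply: (@squeeze_cvgr _ _ _ _ (fun=> 0) (fun n => M * sq (u n - v))).
- by near=> n; rewrite nsq_ge0 -linopB SM.
- exact: cvg_cst.
- by rewrite -(mulr0 M); apply: cvgMr.
Unshelve. all: by end_near. Qed.

Lemma closed_ker : closed [set v | S v = 0].
Proof.
move=> v /closureP cv; have [M M0 SM] := SB; apply: (@nsq_le0 _ _ dotp).
apply/ler_addgt0Pr => e e0; rewrite add0r.
have [|u /= Su uv] := cv (e / (M + 1)); first by rewrite divr_gt0 //; lra.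
have -> : S v = - S (u - v) by rewrite linopB Su sub0r opprK.
rewrite nsqN (le_trans (SM _)) //.
have := nsq_ge0 dotp (u - v); move: uv; rewrite ltr_pdivlMr; last lra.
nra.
Qed.

End Operators.

Lemma cvg_ip (u : nat -> K) v w :
  u @ \oo --> v -> (fun n => ip (u n) w) @ \oo --> ip v w.
Proof.
move=> /cvg_nsqP uv; apply/cvgrPdist_lt => e e0.
have w0 := nsq_ge0 dotp w.
have [] : \forall n \near \oo, `|0 - sq (u n - v)| < e ^+ 2 / (sq w + 1).
  by move/cvgrPdist_lt: uv; apply; rewrite divr_gt0 ?exprn_gt0 //; lra.
move=> N _ hN; exists N => // n /hN /=; rewrite sub0r normrN ger0_norm ?nsq_ge0 //.
rewrite ltr_pdivlMr; last lra.
rewrite -rdotBl => h; rewrite -ltr_sqr ?nnegrE ?(ltW e0) //.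
rewrite -normrX ger0_norm ?sqr_ge0 //.
apply: le_lt_trans (Cauchy_Schwarz _ _ _) _; rewrite nsq_sym.
by have := nsq_ge0 dotp (u n - v); nra.
Qed.

Lemma cvg_nsq (u : nat -> K) v :
  u @ \oo --> v -> (fun n => sq (u n)) @ \oo --> sq v.
Proof.
move=> uv; have h2 := cvg_ip (w := v) uv; move/cvg_nsqP: (uv) => h1.
have -> : (fun n => sq (u n)) = (fun n => sq (u n - v) + 2 * ip (u n) v - sq v).
  by apply/funext => n; rewrite nsqB; ring.
have e : sq v = 0 + 2 * ip v v - sq v by rewrite /nsq; ring.
have h3 : (fun n => 2 * ip (u n) v) @ \oo --> 2 * ip v v by apply: cvgMr h2.

have h5 := cvgB (cvgD h1 h3) (cvg_cst (sq v)).
by rewrite [X in _ --> X]e; exact: h5.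
Qed.

Lemma closure_subspace V : linear_subspace V -> linear_subspace (closure V).
Proof.
move=> [V0 VL]; split; first exact: subset_closure.
move=> c x y /closureP Vx /closureP Vy; apply/closureP => e e0.
pose m := csq c; have m0 : 0 <= m by exact: csq_ge0.
have d0 : 0 < e / (2 * m + 2) by rewrite divr_gt0 //; lra.
have [x' Vx' xx] := Vx _ d0; have [y' Vy' yy] := Vy _ d0.
exists (c *: x' + y'); first exact: VL.
have -> : c *: x' + y' - (c *: x + y) = c *: (x' - x) + (y' - y).
  by rewrite scalerBr opprD addrACA.
apply: le_lt_trans (nsqD_le _ _ _) _; rewrite nsqZ -/m.
move: xx yy; rewrite !ltr_pdivlMr; try lra.
have := nsq_ge0 dotp (x' - x); have := nsq_ge0 dotp (y' - y); nra.
Qed.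

Lemma closure_stable V S : linear_op S -> bounded_op S ->
  (forall v, V v -> V (S v)) -> forall v, closure V v -> closure V (S v).
Proof.
move=> SL [M M0 SM] VS v /closureP cv; apply/closureP => e e0.
have [|u /VS Vu uv] := cv (e / (M + 1)); first by rewrite divr_gt0 //; lra.
exists (S u) => //; rewrite -linopB // (le_lt_trans (SM _)) //.
have := nsq_ge0 dotp (u - v); move: uv; rewrite ltr_pdivlMr; last lra.
nra.
Qed.

End HilbertTopology.

(** * Relations and generators of the algebra *)

Section SphereRelations.
Variables (R : realType) (q : R) (F : starAlgType R[i]) (A B : F).
Local Notation C := R[i].
Local Notation x := ((q ^+ 4)%:C%C : C).
Local Notation p := ((q ^+ 2)%:C%C : C).
Hypothesis AB_relators : all (pred1 0) (sphere_relators q A B).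

Let relA : star A = A.
Proof. by case/sphere_relatorsP: AB_relators. Qed.
Let relBA : B * A = p *: (A * B).
Proof. by case/sphere_relatorsP: AB_relators. Qed.
Let relsBB : star B * B = - A ^+ 2 + 1.
Proof. by case/sphere_relatorsP: AB_relators. Qed.
Let relBsB : B * star B = - (x *: A ^+ 2) + 1.
Proof. by case/sphere_relatorsP: AB_relators. Qed.

Let pp : p * p = x.
Proof. by rewrite -rmorphM -exprD. Qed.

Lemma relAsB : A * star B = p *: (star B * A).
Proof.
have := congr1 star relBA.
by rewrite starM starZ starM relA conj_realC.
Qed.

Let P := A ^+ 2.
Let T := A * B.
Let Rr := B ^+ 2.

Let relBP : B * P = x *: (P * B).
Proof.
by rewrite /P expr2 mulrA relBA -scalerAl -(mulrA A B) relBA -scalerAr scalerA pp mulrA.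
Qed.

Let relPsB : P * star B = x *: (star B * P).
Proof.
by rewrite /P expr2 -(mulrA A A) relAsB -scalerAr (mulrA A) relAsB -scalerAl scalerA pp mulrA.
Qed.

Let relsBPB : x *: (star B * P * B) = P - P ^+ 2.
Proof.
by rewrite scalerAl -relPsB -mulrA relsBB mulrDr mulrN mulr1 -expr2 addrC.
Qed.

Let sT : star T = star B * A.
Proof. by rewrite /T starM relA. Qed.

Lemma star_P : star P = P.
Proof. by rewrite /P expr2 starM relA. Qed.

Lemma starT_T : x *: (star T * T) = P - P ^+ 2.
Proof. by rewrite sT /T mulrA -(mulrA _ A A) -expr2 relsBPB. Qed.

Lemma T_starT : T * star T = P - x *: P ^+ 2.
Proof.
rewrite sT /T mulrA -(mulrA A) relBsB mulrDr mulrDl mulrN mulNr mulr1 -scalerAr.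
have AAAA : A * A ^+ 2 * A = P ^+ 2 by rewrite /P !expr2 !mulrA.
by rewrite -scalerAl AAAA -expr2 addrC.
Qed.

Lemma T_P : T * P = x *: (P * T).
Proof.
have AP : A * P = P * A by rewrite /P expr2 mulrA.
by rewrite /T -(mulrA A B) relBP -scalerAr !(mulrA _ _ B) AP.
Qed.

Lemma R_P : Rr * P = x ^+ 2 *: (P * Rr).
Proof.
by rewrite /Rr expr2 -(mulrA B B) relBP -scalerAr (mulrA B) relBP -scalerAl scalerA -expr2 mulrA.
Qed.

Lemma starR_R : x *: (star Rr * Rr) = x *: 1 - (1 + x) *: P + P ^+ 2.
Proof.
rewrite /Rr expr2 starM mulrA -(mulrA (star B) (star B) B) relsBB.
rewrite (mulrDr (star B)) mulrDl mulrN mulNr mulr1 scalerDr scalerN relsBPB relsBB.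
rewrite scalerDr scalerN scalerDl scale1r opprB opprD.
by rewrite [LHS](AC (2*2) ((4*(2*3))*1)).
Qed.

Lemma R_starR : Rr * star Rr = 1 - (x + x ^+ 2) *: P + x ^+ 3 *: P ^+ 2.
Proof.
rewrite /Rr expr2 starM mulrA -(mulrA B B) relBsB.
rewrite (mulrDr B) mulrDl mulrN mulNr mulr1 -scalerAr relBP -!scalerAl -mulrA relBsB.
rewrite mulrDr mulrN mulr1 -scalerAr -expr2 scalerA -expr2 scalerDr scalerN scalerA -exprSr.
rewrite opprD opprK scalerDl opprD.
by rewrite [LHS](AC (2*2) ((4*(3*2))*1)).
Qed.

Lemma T_T : T ^+ 2 = p *: (P * Rr).
Proof. by rewrite /T expr2 mulrA -(mulrA A) relBA -scalerAr -scalerAl !mulrA -mulrA. Qed.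
End SphereRelations.

Section RP2Relations.
Variables (R : realType) (q : R).
Local Notation C := R[i].
Local Notation x := ((q ^+ 4)%:C%C : C).
Local Notation p := ((q ^+ 2)%:C%C : C).
Local Notation P := (rp2_P q).
Local Notation T := (rp2_T q).
Local Notation Rr := (rp2_R q).

Let rel := sphere_relators0 q.

Lemma rp2_star_P : star P = P.
Proof. by apply: val_inj; exact: (star_P rel). Qed.
Lemma rp2_starT_T : x *: (star T * T) = P - P ^+ 2.
Proof. by apply: val_inj; exact: (starT_T rel). Qed.
Lemma rp2_T_starT : T * star T = P - x *: P ^+ 2.
Proof. by apply: val_inj; exact: (T_starT rel). Qed.
Lemma rp2_T_P : T * P = x *: (P * T).
Proof. by apply: val_inj; exact: (T_P rel). Qed.
Lemma rp2_R_P : Rr * P = x ^+ 2 *: (P * Rr).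
Proof. by apply: val_inj; exact: (R_P rel). Qed.
Lemma rp2_starR_R : x *: (star Rr * Rr) = x *: 1 - (1 + x) *: P + P ^+ 2.
Proof. by apply: val_inj; exact: (starR_R rel). Qed.
Lemma rp2_R_starR : Rr * star Rr = 1 - (x + x ^+ 2) *: P + x ^+ 3 *: P ^+ 2.
Proof. by apply: val_inj; exact: (R_starR rel). Qed.
Lemma rp2_T_T : T ^+ 2 = p *: (P * Rr).
Proof. by apply: val_inj; exact: (T_T rel). Qed.

End RP2Relations.

Lemma letter_products (R : realType) (q : R) (F : starAlgType R[i]) (A B : F)
    (E : F -> Prop) : all (pred1 0) (sphere_relators q A B) ->
  (forall (c : R[i]) s, E s -> E (c *: s)) -> (forall s t, E s -> E t -> E (s + t)) ->
  E 1 -> E (A ^+ 2) -> E (A * B) -> E (star (A * B)) ->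
  E (B ^+ 2) -> E (star (B ^+ 2)) ->
  forall l m, E (letter_lift (sphere_gen_lift A B) l * letter_lift (sphere_gen_lift A B) m).
Proof.
move=> rel EZ ED E1 EP ET ETs ER ERs.
have [sA BA BsB sBB] := sphere_relatorsP _ _ _ rel.
have EN s : E s -> E (- s) by move=> Es; rewrite -scaleN1r; apply: EZ.
rewrite starM sA in ETs; rewrite expr2 starM in ERs; rewrite expr2 in ER.
have AsB := relAsB rel.
move=> [[] []] [[] []] /=; rewrite /letter_lift /= ?sA ?AsB ?BA ?BsB ?sBB -?expr2 //.
all: by do ?[apply: ED => //]; do ?[apply: EN]; do ?[apply: EZ].
Qed.

Section Generation.
Variables (R : realType) (q : R).
Local Notation C := R[i].
Local Notation S := (sphere_alg q).
Local Notation A := (sphere_A q).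
Local Notation B := (sphere_B q).
Local Notation F := (free_star C sphere_gen).

Definition sphere_letter (l : letter sphere_gen) : S :=
  letter_lift (sphere_gen_lift A B) l.

Lemma to_quot_letter (l : letter sphere_gen) :
  to_quot (sphere_ideal_pred q) (mono (fmu l) 1) = sphere_letter l.
Proof.
have e g : sphere_gen_lift A B g = to_quot (sphere_ideal_pred q) (fgen C g) by case: g.
have [_ _ _ hS] := to_quot_hom (sphere_ideal_pred q).
case: l => g []; rewrite /sphere_letter /letter_lift /= e //.
rewrite -hS; congr to_quot; rewrite -[RHS]/(fstar _) fstarU rmorph1.
by congr mono; apply/eqP; rewrite fmP /wstar /= !fmU.
Qed.

Lemma to_quot_word (s : seq (letter sphere_gen)) (c : C) :
  to_quot (sphere_ideal_pred q) (mono (FMonom s) c) =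
  c *: \prod_(l <- s) sphere_letter l.
Proof.
have [hL hM h1 _] := to_quot_hom (sphere_ideal_pred q).
elim: s => [|l s IHs].
  have -> : mono (FMonom [::]) c = c *: (1 : F).
    rewrite -mono1 monoZ mulr1; congr mono; apply/eqP.
    by rewrite fmP fm1.
  by rewrite (star_homZ (to_quot_hom _)) h1 big_nil.
rewrite big_cons scalerAr -IHs -to_quot_letter -hM; congr to_quot.
rewrite monoM mul1r; congr mono; apply/eqP.
by rewrite fmP fmM fmU.
Qed.

Lemma r2_letter l : r2 (sphere_letter l) = - sphere_letter l.
Proof.
have [_ _ _ rS] := r2_hom q.
by case: l => -[] []; rewrite /sphere_letter /letter_lift /= ?rS ?(r2A, r2B) // starN.
Qed.

Lemma r2_word s :
  r2 (\prod_(l <- s) sphere_letter l) = (-1) ^+ (size s) *: \prod_(l <- s) sphere_letter l.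
Proof.
have [_ rM r1 _] := r2_hom q.
elim: s => [|l s IHs]; first by rewrite big_nil r1 scale1r.
by rewrite big_cons rM IHs r2_letter exprS -scalerA -scalerAr mulNr scaleN1r scalerN.
Qed.

Section Induction.
Variable Q : S -> Prop.
Hypothesis QL : forall (c : C) a b, Q a -> Q b -> Q (c *: a + b).
Hypothesis QM : forall a b, Q a -> Q b -> Q (a * b).
Hypothesis Q1 : Q 1.
Hypothesis Q2 : forall l m, Q (sphere_letter l * sphere_letter m).

(** Words of odd length are only known to land in Q after one more letter: this
    is what the induction on words by single letters needs. *)
Lemma word_parity_ind s :
  if odd (size s) then forall l, Q (sphere_letter l * \prod_(l <- s) sphere_letter l)
  else Q (\prod_(l <- s) sphere_letter l).
Proof.
elim: s => [|l s IHs] /=; first by rewrite big_nil.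
rewrite big_cons; case: odd IHs => //= Qs m.
by rewrite mulrA; apply: QM.
Qed.

(** Even words satisfy Q, and r2 changes the sign of odd words. *)
Lemma even_odd_decomposition (a : S) : exists u o, [/\ a = u + o, Q u & r2 o = - o].
Proof.
have rh := r2_hom q; have [x ->] := to_quot_surj a.
have Q0 : Q 0 by rewrite -(addNr 1) -scaleN1r; exact: QL.
have hD := star_homD (to_quot_hom (sphere_ideal_pred q)).
elim/free_ind: x => [|x y [u [o [xE Qu ro]]] [u' [o' [yE Qu' ro']]]|[s] c].
- exists 0, 0; rewrite addr0 oppr0 (star_hom0 rh); split => //.
  exact: star_hom0 (to_quot_hom _).
- exists (u + u'), (o + o'); split; first by rewrite hD xE yE addrACA.
    by rewrite -[u]scale1r; apply: QL.
  by rewrite (star_homD rh) ro ro' opprD.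
rewrite to_quot_word; have := word_parity_ind s; case: ifP => os Qs.
  exists 0, (c *: \prod_(l <- s) sphere_letter l); split; rewrite ?add0r //.
  by rewrite (star_homZ rh) r2_word -signr_odd os expr1 scaleN1r scalerN.
exists (c *: \prod_(l <- s) sphere_letter l), 0; split; rewrite ?addr0 ?oppr0 ?star_hom0 //.
by rewrite -[_ *: _]addr0; apply: QL.
Qed.

End Induction.

(** Induction on generators: a fixed point of r2 equals its own even part, which
    is a combination of products of pairs of letters. *)
Lemma rp2_ind (Q : rp2_alg q -> Prop) :
  (forall (c : C) a b, Q a -> Q b -> Q (c *: a + b)) ->
  (forall a b, Q a -> Q b -> Q (a * b)) -> Q 1 ->
  Q (rp2_P q) -> Q (rp2_T q) -> Q (star (rp2_T q)) -> Q (rp2_R q) -> Q (star (rp2_R q)) ->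
  forall a, Q a.
Proof.
move=> QL QM Q1 QP QT QTs QR QRs a.
pose E (s : S) := exists2 b, rp2_val b = s & Q b.
have EL : forall (c : C) s t, E s -> E t -> E (c *: s + t).
  by move=> c s t [b <- Qb] [b' <- Qb']; exists (c *: b + b') => //; apply: QL.
have EM s t : E s -> E t -> E (s * t).
  by move=> [b <- Qb] [b' <- Qb']; exists (b * b') => //; apply: QM.
have E1 : E 1 by exists 1.
have EZ (c : C) s : E s -> E (c *: s).
  move=> Es; rewrite -[_ *: _]addr0; apply: (EL) => //.
  by rewrite -(addNr 1) -scaleN1r; exact: EL.
have ED s t : E s -> E t -> E (s + t) by move=> Es; rewrite -[s]scale1r; apply: EL.
have EP : E (A ^+ 2) by exists (rp2_P q).
have ET : E (A * B) by exists (rp2_T q).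
have ER : E (B ^+ 2) by exists (rp2_R q).
have ETs : E (star (A * B)) by exists (star (rp2_T q)).
have ERs : E (star (B ^+ 2)) by exists (star (rp2_R q)).
have E2 := letter_products (sphere_relators0 q) EZ ED E1 EP ET ETs ER ERs.
have [u [o [auo [b bu Qb] ro]]] := even_odd_decomposition EL EM E1 E2 (rp2_val a).
suff o0 : o = 0 by have -> : a = b by apply: val_inj; rewrite /= auo o0 addr0 bu.
have fixed (c : rp2_alg q) : r2 (rp2_val c) = rp2_val c by case: c => c /= /eqP.
have := fixed a; rewrite auo (star_homD (r2_hom q)) -bu fixed ro => /addrI /esym /eqP.
rewrite -addr_eq0 -mulr2n -scaler_nat scaler_eq0 pnatr_eq0 /=.
by move/eqP.
Qed.

End Generation.

(** * Boundedness of all representations *)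

Section StarRepresentation.
Variables (R : realType) (A : starAlgType R[i]) (K : hilbertType R[i]).
Variables (D : set K) (rho : A -> K -> K).
Hypothesis rho_rep : is_star_rep D rho.
Local Notation C := R[i].
Local Notation ip := (rdot (@dotp C K)).

Lemma repZ (c : C) a u : D u -> rho (c *: a) u = c *: rho a u.
Proof.
move=> Du; have h b := rep_alg_linear rho_rep c a b Du.
have r0 : rho 0 u = 0.
  have := rep_alg_linear rho_rep (-1) 0 0 Du.
  by rewrite scaler0 addr0 scaleN1r addNr.
by have := h 0; rewrite r0 !addr0.
Qed.

Lemma repD a b u : D u -> rho (a + b) u = rho a u + rho b u.
Proof. by move=> Du; have := rep_alg_linear rho_rep 1 a b Du; rewrite !scale1r. Qed.

Lemma repN a u : D u -> rho (- a) u = - rho a u.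
Proof. by move=> Du; rewrite -scaleN1r repZ // scaleN1r. Qed.

Lemma rep_sqr a u : D u -> rho (a ^+ 2) u = rho a (rho a u).
Proof. by move=> Du; rewrite expr2 (rep_mul rho_rep). Qed.

Lemma rep_ip a u v : D u -> D v -> ip (rho a u) v = ip u (rho (star a) v).
Proof. by move=> Du Dv; rewrite /rdot (rep_adjoint rho_rep). Qed.

Lemma rep_nsq a u : D u -> nsq dotp (rho a u) = ip u (rho (star a * a) u).
Proof.
move=> Du; have Da := rep_stable rho_rep a Du.
by rewrite /nsq rep_ip // -(rep_mul rho_rep).
Qed.

Definition repE := (repD, repN, repZ, rep_sqr, rep_one rho_rep).
End StarRepresentation.

Section RP2Representation.
Variables (R : realType) (q : R) (K : hilbertType R[i]).
Variables (D : set K) (rho : rp2_alg q -> K -> K).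
Hypothesis rho_rep : is_star_rep D rho.
Local Notation C := R[i].
Local Notation ip := (rdot (@dotp C K)).
Local Notation sq := (nsq (@dotp C K)).
Local Notation x := (q ^+ 4).
Local Notation P := (rho (rp2_P q)).
Local Notation T := (rho (rp2_T q)).
Local Notation Ts := (rho (star (rp2_T q))).
Local Notation Rr := (rho (rp2_R q)).
Local Notation Rs := (rho (star (rp2_R q))).
Implicit Types u v : K.

Let stab a u (Du : D u) : D (rho a u) := rep_stable rho_rep a Du.

Lemma repP_sym u v : D u -> D v -> ip (P u) v = ip u (P v).
Proof. by move=> Du Dv; rewrite (rep_ip rho_rep) // rp2_star_P. Qed.

Lemma nsq_T u : D u -> x * sq (T u) = ip (P u) u - sq (P u).
Proof.
move=> Du; rewrite (rep_nsq rho_rep) // -rdotZr -(repZ rho_rep) // rp2_starT_T.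
by rewrite !(repE rho_rep) // !rdotE -(repP_sym Du (stab _ Du)) -(repP_sym Du Du).
Qed.

Lemma nsq_Ts u : D u -> sq (Ts u) = ip (P u) u - x * sq (P u).
Proof.
move=> Du; rewrite (rep_nsq rho_rep) // starK rp2_T_starT.
by rewrite !(repE rho_rep) // !rdotE -(repP_sym Du (stab _ Du)) -(repP_sym Du Du).
Qed.

Lemma nsq_R u : D u -> x * sq (Rr u) = x * sq u - (1 + x) * ip (P u) u + sq (P u).
Proof.
move=> Du; rewrite (rep_nsq rho_rep) // -rdotZr -(repZ rho_rep) // rp2_starR_R.
rewrite !(repE rho_rep) // -[in (1 + _) *: _](rmorph1 (real_complex R)) -rmorphD.
by rewrite !rdotE -(repP_sym Du (stab _ Du)) -(repP_sym Du Du).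
Qed.

Lemma nsq_Rs u : D u ->
  sq (Rs u) = sq u - (x + x ^+ 2) * ip (P u) u + x ^+ 3 * sq (P u).
Proof.
move=> Du; rewrite (rep_nsq rho_rep) // starK rp2_R_starR.
rewrite !(repE rho_rep) // -!rmorphXn -rmorphD.
by rewrite !rdotE -(repP_sym Du (stab _ Du)) -(repP_sym Du Du).
Qed.

Lemma rep_T_P u : D u -> T (P u) = x%:C%C *: P (T u).
Proof.
move=> Du; rewrite -(rep_mul rho_rep) // rp2_T_P (repZ rho_rep) //.
by rewrite (rep_mul rho_rep).
Qed.

Lemma rep_R_P u : D u -> Rr (P u) = (x ^+ 2)%:C%C *: P (Rr u).
Proof.
move=> Du; rewrite -(rep_mul rho_rep) // rp2_R_P (repZ rho_rep) //.
by rewrite (rep_mul rho_rep) // -rmorphXn.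
Qed.

Lemma rep_P_Ts u : D u -> P (Ts u) = x%:C%C *: Ts (P u).
Proof.
move=> Du; rewrite -!(rep_mul rho_rep) // -(repZ rho_rep) //; congr (rho _ u).
have := congr1 star (rp2_T_P q).
by rewrite starM starZ starM rp2_star_P /Num.conj /= oppr0.
Qed.

Lemma rep_T_T u : D u -> T (T u) = (q ^+ 2)%:C%C *: P (Rr u).
Proof.
by move=> Du; rewrite -(rep_sqr rho_rep) // rp2_T_T (repZ rho_rep) // (rep_mul rho_rep).
Qed.

Lemma rep_Ts_Ts u : D u -> Ts (Ts u) = (q ^+ 2)%:C%C *: Rs (P u).
Proof.
move=> Du; rewrite -!(rep_mul rho_rep) // -(repZ rho_rep) //; congr (rho _ u).
have := congr1 star (rp2_T_T q).
by rewrite expr2 starM starZ starM rp2_star_P /Num.conj /= oppr0.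
Qed.

Hypothesis q_neq0 : 0 < `|q|.

Lemma q4_gt0 : 0 < x.
Proof. by rewrite (exprM q 2 2) exprn_gt0 // lt_def sqrf_eq0 sqr_ge0 andbT -normr_gt0. Qed.

(** Positivity of the operator of T^*T bounds P^2 by P, hence P by 1. *)
Lemma repP_sqr_le u : D u -> sq (P u) <= ip (P u) u.
Proof. by move=> Du; have := nsq_T Du; have := nsq_ge0 dotp (T u); have := q4_gt0; nra. Qed.

Lemma repP_ge0 u : D u -> 0 <= ip (P u) u.
Proof. by move=> Du; apply: le_trans (repP_sqr_le Du); exact: nsq_ge0. Qed.

Lemma repP_nsq_le u : D u -> sq (P u) <= sq u.
Proof.
move=> Du; have := repP_sqr_le Du; have := Cauchy_Schwarz dotp (P u) u.
have := repP_ge0 Du; have := nsq_ge0 dotp u; have := nsq_ge0 dotp (P u).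
set a := sq _; set b := ip _ _; set c := sq _ => a0 c0 b0 h ab.
by have [//|ca] := leP a c; nra.
Qed.

Lemma repP_le1 u : D u -> ip (P u) u <= sq u.
Proof.
move=> Du; have := repP_nsq_le Du; have := Cauchy_Schwarz dotp (P u) u.
have := nsq_ge0 dotp u; have := nsq_ge0 dotp (P u); have := repP_ge0 Du.
set a := sq _; set b := ip _ _; set c := sq _ => b0 a0 c0 h ac.
by have [//|cb] := leP b c; nra.
Qed.

(** The relations express every product X^*X of a generator X with its adjoint
    through the bounded operator of P. *)
Lemma rep_bounded a : exists2 M : R, 0 <= M & forall u, D u -> sq (rho a u) <= M * sq u.
Proof.
have x0 := q4_gt0.
elim/rp2_ind: a => [c a b [M M0 aM] [N N0 bN]|a b [M M0 aM] [N N0 bN]|||||| ].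
- pose m := csq c; have m0 : 0 <= m by exact: csq_ge0.
  exists (2 * (m * M) + 2 * N) => [|u Du].
    by rewrite addr_ge0 ?mulr_ge0.
  rewrite (repD rho_rep) // (repZ rho_rep) // (le_trans (nsqD_le _ _ _)) //.
  have h := ler_wpM2l m0 (aM u Du); have := bN u Du; rewrite nsqZ -/m.
  by move: h; lra.
- exists (M * N) => [|u Du]; first exact: mulr_ge0.
  rewrite (rep_mul rho_rep) //; apply: le_trans (aM _ (stab _ Du)) _.
  by rewrite -mulrA ler_wpM2l // bN.
- by exists 1 => // u Du; rewrite (rep_one rho_rep) // mul1r.
- by exists 1 => // u Du; rewrite mul1r repP_nsq_le.
- exists x^-1 => [|u Du]; first by rewrite invr_ge0 ltW.
  rewrite mulrC ler_pdivlMr // mulrC nsq_T //.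
  by have := repP_le1 Du; have := nsq_ge0 dotp (P u); lra.
- exists 1 => // u Du; rewrite nsq_Ts // mul1r.
  by have := repP_le1 Du; have := nsq_ge0 dotp (P u); nra.
- exists ((x + 1) / x) => [|u Du]; first by rewrite divr_ge0 ?addr_ge0 ?ltW.
  rewrite mulrAC ler_pdivlMr // mulrC nsq_R //.
  have := mulr_ge0 (ltW x0) (repP_ge0 Du).
  have := repP_ge0 Du; have := repP_nsq_le Du.
  by nra.
- have x3 : 0 <= x ^+ 3 by apply/exprn_ge0/ltW.
  exists (1 + x ^+ 3) => [|u Du]; first exact: addr_ge0.
  rewrite nsq_Rs //.
  have xx : 0 <= x + x ^+ 2 by apply: addr_ge0; [exact: ltW|apply/exprn_ge0/ltW].
  have := mulr_ge0 xx (repP_ge0 Du); have := ler_wpM2l x3 (repP_nsq_le Du).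
  by nra.
Qed.

Lemma rep_bounded_on a : bounded_on D (rho a).
Proof.
have [M M0 aM] := rep_bounded a; exists (Num.sqrt M) => u Du.
by rewrite norm_le_nsq ?sqrtr_ge0 // sqr_sqrtr // aM.
Qed.

End RP2Representation.

(** * Fixed vectors of P *)

Section BoundedRepresentation.
Variables (R : realType) (A : starAlgType R[i]) (K : hilbertType R[i]).
Variables (rho : A -> K -> K).
Hypothesis rho_rep : is_star_rep setT rho.

Lemma rep_op_linear a : linear_op (rho a).
Proof. by move=> c u v; rewrite (rep_linear rho_rep). Qed.

End BoundedRepresentation.

Lemma le0_of_geometric (R : realType) (x a b : R) :
  0 < x -> x < 1 -> (forall n, a <= x ^+ n * b) -> a <= 0.
Proof.
move=> x0 x1 h; apply/ler_addgt0Pr => e e0; rewrite add0r.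
have b1 : 0 < `|b| + 1 by rewrite ltr_wpDl.
have : (fun n => x ^+ n) @ \oo --> (0 : R) by apply: cvg_expr; rewrite gtr0_norm.
move/cvgrPdist_lt => /(_ (e / (`|b| + 1))) [|N _ /(_ N (leqnn N))].
  by rewrite divr_gt0.
rewrite sub0r normrN ger0_norm ?exprn_ge0 ?(ltW x0) // ltr_pdivlMr // => hN.
apply: le_trans (h N) _; apply: le_trans (ltW hN).
rewrite ler_wpM2l ?exprn_ge0 ?(ltW x0) // (le_trans (ler_norm _)) // lerDl.
exact: ler01.
Qed.

Section PowersOfP.
Variables (R : realType) (q : R) (K : hilbertType R[i]).
Variables (rho : rp2_alg q -> K -> K).
Hypotheses (rho_rep : is_star_rep setT rho) (q_neq0 : 0 < `|q|) (q_lt1 : `|q| < 1).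
Local Notation C := R[i].
Local Notation ip := (rdot (@dotp C K)).
Local Notation sq := (nsq (@dotp C K)).
Local Notation x := (q ^+ 4).
Local Notation P := (rho (rp2_P q)).
Local Notation T := (rho (rp2_T q)).
Implicit Types u v w : K.

Lemma rep_op_bounded a : bounded_op (rho a).
Proof.
by have [M M0 h] := rep_bounded rho_rep q_neq0 a; exists M => // u; exact: h.
Qed.

Lemma q4_lt1 : x < 1.
Proof.
rewrite -[x]ger0_norm; last by rewrite ltW // q4_gt0.
by rewrite normrX exprn_ilt1.
Qed.

(** These are the moments of the spectral measure of P at v; the argument below
    bounds this measure without constructing it. *)
Definition moment k v : R := ip (iter k P v) v.

Lemma ip_iter m n u v : ip (iter m P u) (iter n P v) = ip (iter (m + n) P u) v.
Proof.
elim: n m => [|n IHn] m; first by rewrite addn0.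
by rewrite iterS -(repP_sym rho_rep) // -iterS IHn addSnnS.
Qed.

Lemma moment_shift j k v : moment k (iter j P v) = moment (k + j.*2) v.
Proof. by rewrite /moment -iterD ip_iter -addnA addnn. Qed.

Lemma moment0 v : moment 0 v = sq v. Proof. by []. Qed.
Lemma moment2 v : moment 2 v = sq (P v).
Proof. by rewrite /moment /= (repP_sym rho_rep). Qed.

Lemma moment_sqr j v : moment j.*2 v = sq (iter j P v).
Proof. by rewrite -[j.*2]add0n -moment_shift. Qed.

Lemma moment_decr v k : moment k.+1 v <= moment k v.
Proof.
rewrite -[k]odd_double_half; case: (odd k) => /=.
  by rewrite -add2n -addn1 -!moment_shift moment2 (repP_sqr_le rho_rep).
rewrite !add0n -addn1 addnC -moment_shift moment_sqr.
by rewrite (repP_le1 rho_rep).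
Qed.

Lemma moment_mono v m n : (m <= n)%N -> moment n v <= moment m v.
Proof.
elim: n => [|n IHn]; first by rewrite leqn0 => /eqP ->.
rewrite leq_eqVlt => /predU1P[-> //|]; rewrite ltnS => /IHn.
exact/le_trans/moment_decr.
Qed.

Lemma moment_ge0 v k : 0 <= moment k v.
Proof.
rewrite -[k]odd_double_half; case: (odd k) => /=; last first.
  by rewrite moment_sqr nsq_ge0.
by rewrite -moment_shift (repP_ge0 rho_rep).
Qed.

(** The moments decrease, so that the powers of P converge strongly; the limit
    is the projection onto the fixed vectors of P. *)
Lemma powers_cvg v : exists2 w, (fun n => iter n P v) @ \oo --> w & P w = w.
Proof.
have [|m n mn|w cw] := @cvg_of_increments _ _ (fun n => iter n P v)
  (fun n => - moment n.*2 v) 0.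
- by move=> n; rewrite oppr_le0 moment_ge0.
- rewrite nsqB -!moment_sqr ip_iter -/(moment _ v).
  have : moment n.*2 v <= moment (n + m) v.
    by apply: moment_mono; rewrite -addnn leq_add2l.
  by lra.
exists w => //; apply: (cvg_hilbert_unique (u := fun n => iter n.+1 P v)).
  exact: (cvg_op (rep_op_linear rho_rep _) (rep_op_bounded _) cw).
by rewrite (cvg_shiftS (fun n => iter n P v)).
Qed.

Lemma ip_T u v : x * ip (T u) (T v) = ip (P u) v - ip (P u) (P v).
Proof.
rewrite (rep_ip rho_rep) // -rdotZr -(rep_mul rho_rep) // -(repZ rho_rep) //.
by rewrite rp2_starT_T !(repE rho_rep) // !rdotE -!(repP_sym rho_rep).
Qed.

Section NoFixedVector.
Hypothesis no_fixed : forall w, P w = w -> w = 0.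

Lemma moment_small v (e : R) : 0 < e -> exists n, moment n v < e.
Proof.
move=> e0; have [w cw /no_fixed w0] := powers_cvg v.
have := cvg_nsq cw; rewrite w0 nsq0 => /cvgrPdist_lt /(_ e e0) [n _ /(_ n (leqnn n))].
rewrite sub0r normrN ger0_norm ?nsq_ge0 // -moment_sqr.
by exists n.*2.
Qed.

Definition moment_bound (M : R) :=
  forall v, moment 1 v <= M * moment 0 v /\ moment 2 v <= M * moment 1 v.

(** The bounds for P and P^2 at T w are inequalities between successive
    differences d k of the moments of w, namely d k.+2 <= x M d k.+1.  So the
    sequence a k.+2 - x M a k.+1 is nondecreasing, and its limit is 0 because
    without fixed vectors the moments a k tend to 0.  The bound for the first moment
    follows from that for the second by the Cauchy-Schwarz inequality. *)
Lemma moment_bound_step M : 0 <= M -> moment_bound M -> moment_bound (x * M).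
Proof.
move=> M0 hM; have x0 := q4_gt0 q_neq0.
have xM : 0 <= x * M by rewrite mulr_ge0 // ltW.
pose d k v := moment k v - moment k.+1 v.
have d1 w : x * moment 0 (T w) = d 1 w.
  by rewrite ip_T /d /moment /= !(repP_sym rho_rep).
have d2 w : x ^+ 2 * moment 1 (T w) = d 2 w.
  rewrite expr2 -mulrA -rdotZl -(rep_T_P rho_rep) // ip_T /d /moment /=.
  by rewrite !(repP_sym rho_rep).
have d3 w : x ^+ 3 * moment 2 (T w) = d 3 w.
  rewrite moment2 [x ^+ 3]exprS -mulrA -nsqZr -(rep_T_P rho_rep) // -moment0 d1.
  by rewrite /d -[P w]/(iter 1 P w) !moment_shift.
have d12 w : d 2 w <= x * M * d 1 w.
  rewrite -d1 -d2; have := ler_wpM2l (ltW (exprn_gt0 2 x0)) (hM (T w)).1; lra.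
have d23 w : d 3 w <= x * M * d 2 w.
  rewrite -d2 -d3; have := ler_wpM2l (ltW (exprn_gt0 3 x0)) (hM (T w)).2; lra.
(* The even and the odd k are the two bounds at the iterates of v by P. *)
have dS v k : d k.+2 v <= x * M * d k.+1 v.
  rewrite -[k]odd_double_half; set j := k./2; case: (odd k).
    by have := d23 (iter j P v); rewrite /d !moment_shift.
  by have := d12 (iter j P v); rewrite /d !moment_shift.
have gS v m : moment 2 v - x * M * moment 1 v <= moment m.+2 v - x * M * moment m.+1 v.
  elim: m => // m IHm; have := dS v m; rewrite /d; nra.
have b2 v : moment 2 v <= x * M * moment 1 v.
  rewrite -subr_le0; apply/ler_addgt0Pr => e e0; rewrite add0r.
  have [n hn] := moment_small v e0.
  have := gS v n; have := moment_mono v (leqW (leqnSn n)).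
  have := mulr_ge0 xM (moment_ge0 v n.+1); lra.
move=> v; split=> //; have := b2 v; have := Cauchy_Schwarz dotp (P v) v.
rewrite -[rdot dotp (P v) v]/(moment 1 v) -moment2 -moment0.
have := moment_ge0 v 0; have := moment_ge0 v 1; have := moment_ge0 v 2.
set a := moment 2 v; set b := moment 1 v; set c := moment 0 v.
move=> a0 b0 c0 h ab; have [//|cb] := leP b (x * M * c).
have bp : 0 < b by apply: le_lt_trans cb; rewrite mulr_ge0.
have := ler_wpM2r c0 ab; nra.
Qed.

Lemma P_eq0_of_no_fixed v : P v = 0.
Proof.
have h n : moment_bound (x ^+ n).
  elim: n => [|n IHn]; last first.
    by rewrite exprS; apply: moment_bound_step => //; rewrite exprn_ge0 // ltW // q4_gt0.
  by move=> w; rewrite expr0 !mul1r; split; exact: moment_decr.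
apply: (@nsq_le0 _ _ dotp); rewrite -moment2.
apply: (le0_of_geometric (q4_gt0 q_neq0) q4_lt1) => n; exact: (h n v).2.
Qed.

End NoFixedVector.

Lemma exists_fixed_vector : (exists v, P v <> 0) -> exists2 w, w != 0 & P w = w.
Proof.
move=> [v Pv]; apply: contrapT => h; apply: Pv; apply: P_eq0_of_no_fixed => w Pw.
by apply: contrapT => w0; apply: h; exists w => //; apply/eqP.
Qed.

End PowersOfP.

(** * The Hilbert space of square summable sequences *)

Section ComplexSquares.
Variable R : realType.
Local Notation C := R[i].
Implicit Types (z w : C) (u v : nat -> C).

Lemma csqE z : z * z^* = (csq z)%:C%C.
Proof. by case: z => a b; apply/eqP; rewrite eq_complex /csq /=; apply/andP; split; apply/eqP; ring. Qed.

Lemma csqM z w : csq (z * w) = csq z * csq w.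
Proof. by case: z w => a b [c d]; rewrite /csq /=; ring. Qed.

Lemma csqD_le z w : csq (z + w) <= 2 * csq z + 2 * csq w.
Proof.
case: z w => a b [c d]; rewrite /csq /=.
by have := sqr_ge0 (a - c); have := sqr_ge0 (b - d); nra.
Qed.

Lemma csq_eq0 z : csq z = 0 -> z = 0.
Proof.
case: z => a b; rewrite /csq /= => /eqP; rewrite paddr_eq0 ?sqr_ge0 // !sqrf_eq0.
by move=> /andP[/eqP -> /eqP ->].
Qed.

Lemma csq_real (a : R) : csq a%:C%C = a ^+ 2.
Proof. by rewrite /csq /= expr0n addr0. Qed.

Lemma normc_csq z : `|z| = (Num.sqrt (csq z))%:C%C.
Proof. by rewrite normc_def; case: z. Qed.

(** Complex limits are reduced to real ones, where monotone sequences converge. *)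
Definition ccvg u z := (fun n => complex.Re (u n)) @ \oo --> complex.Re z /\
  (fun n => complex.Im (u n)) @ \oo --> complex.Im z.

Lemma ccvg_unique u z w : ccvg u z -> ccvg u w -> z = w.
Proof.
move=> [hr hi] [hr' hi']; apply/eqP; rewrite eq_complex.
rewrite (cvg_unique (@Rhausdorff R) hr hr').
by rewrite (cvg_unique (@Rhausdorff R) hi hi') !eqxx.
Qed.

Lemma ccvgD u v z w : ccvg u z -> ccvg v w -> ccvg (fun n => u n + v n) (z + w).
Proof.
move=> [hr hi] [hr' hi']; split; rewrite raddfD;
  under eq_fun do rewrite raddfD; exact: cvgD.
Qed.

Lemma ccvgZ c u z : ccvg u z -> ccvg (fun n => c * u n) (c * z).
Proof.
move=> [hr hi]; case: c => a b.
have eR (y : C) : complex.Re ((a +i* b)%C * y) = a * complex.Re y - b * complex.Im y by case: y.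
have eI (y : C) : complex.Im ((a +i* b)%C * y) = a * complex.Im y + b * complex.Re y by case: y.
split; rewrite ?eR ?eI; under eq_fun do rewrite ?eR ?eI.
  by apply: cvgB; apply: cvgMr.
by apply: cvgD; apply: cvgMr.
Qed.

Lemma ccvg_conj u z : ccvg u z -> ccvg (fun n => (u n)^*) z^*.
Proof.
have eR (y : C) : complex.Re y^* = complex.Re y by case: y.
have eI (y : C) : complex.Im y^* = - complex.Im y by case: y.
move=> [hr hi]; split.
  by rewrite eR; under eq_fun do rewrite eR.
by rewrite eI; under eq_fun do rewrite eI; exact: cvgN.
Qed.

End ComplexSquares.

Section SquareSummable.
Variable R : realType.
Local Notation C := R[i].
Implicit Types (f g h : nat -> C^o).

Definition sqsum f n : R := \sum_(k < n) csq (f k).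

Lemma sqsum_ge0 f n : 0 <= sqsum f n.
Proof. by apply: sumr_ge0 => k _; exact: csq_ge0. Qed.

Lemma sqsum_mono f : nondecreasing_seq (sqsum f).
Proof.
by apply/nondecreasing_seqP => n; rewrite /sqsum big_ord_recr /= lerDl csq_ge0.
Qed.

Lemma sqsum_csq_le f n k : (k < n)%N -> csq (f k) <= sqsum f n.
Proof.
move=> kn; apply: le_trans (sqsum_mono f kn).
by rewrite /sqsum big_ord_recr /= lerDr sqsum_ge0.
Qed.

Definition square_summable : pred (nat -> C^o) :=
  [pred f | `[< exists M : R, forall n, sqsum f n <= M >]].

Lemma sqsumZ c f n : sqsum (c *: f) n = csq c * sqsum f n.
Proof. by rewrite /sqsum mulr_sumr; apply: eq_bigr => k _; rewrite -csqM. Qed.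

Lemma sqsumD_le f g n : sqsum (f + g) n <= 2 * sqsum f n + 2 * sqsum g n.
Proof.
rewrite /sqsum !mulr_sumr -big_split /=.
by apply: ler_sum => k _; exact: csqD_le.
Qed.

Lemma square_summable_submod : submod_closed square_summable.
Proof.
split=> [|c f g /asboolP[M fM] /asboolP[N gN]].
  apply/asboolP; exists 0 => n; rewrite /sqsum big1 // => k _.
  by rewrite /csq /= !expr0n addr0.
apply/asboolP; exists (2 * (csq c * M) + 2 * N) => n.
apply: le_trans (sqsumD_le _ _ _) _; rewrite sqsumZ.
by apply: lerD; rewrite ler_wpM2l // ler_wpM2l ?csq_ge0.
Qed.
HB.instance Definition _ := GRing.isSubmodClosed.Build C (nat -> C^o) square_summable
  square_summable_submod.

Record l2 := L2 { l2_fun : nat -> C^o; _ : l2_fun \in square_summable }.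
HB.instance Definition _ := [isSub for l2_fun].
HB.instance Definition _ := [Choice of l2 by <:].
HB.instance Definition _ := [SubChoice_isSubLmodule of l2 by <:].

End SquareSummable.

Section L2Dot.
Variable R : realType.
Local Notation C := R[i].
Local Notation l2 := (l2 R).
Implicit Types f g h : l2.

Lemma l2_coordZ (c : C) f k : l2_fun (c *: f) k = c * l2_fun f k. Proof. by []. Qed.
Lemma l2_coord0 k : l2_fun 0 k = 0 :> C. Proof. by []. Qed.

Lemma l2_ext f g : (forall k, l2_fun f k = l2_fun g k) -> f = g.
Proof. by move=> fg; apply: val_inj; apply: funext => k; exact: fg. Qed.

Lemma l2_bound f : exists M : R, forall n, sqsum (l2_fun f) n <= M.
Proof. by case: f => f /= /asboolP. Qed.

Definition l2_nsq f : R := limn (sqsum (l2_fun f)).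

Lemma cvg_l2_nsq f : sqsum (l2_fun f) @ \oo --> l2_nsq f.
Proof.
apply: nondecreasing_is_cvgn; first exact: sqsum_mono.
by have [M fM] := l2_bound f; exists M => _ [n _ <-].
Qed.

Lemma sqsum_le_l2_nsq f n : sqsum (l2_fun f) n <= l2_nsq f.
Proof. by apply: nondecreasing_cvgn_le; [exact: sqsum_mono|exact: cvg_l2_nsq]. Qed.

Lemma l2_nsq_le f (M : R) : (forall n, sqsum (l2_fun f) n <= M) -> l2_nsq f <= M.
Proof. by move=> fM; apply: limr_le; [exact: cvg_l2_nsq|exact: nearW]. Qed.

Lemma csq_polarization (z w : C) : z * w^* =
  Complex ((csq (z + w) - csq (z - w)) / 4) ((csq (z + 'i%C * w) - csq (z - 'i%C * w)) / 4).
Proof.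
case: z w => a b [c d]; rewrite /csq /=.
by apply/eqP; rewrite eq_complex /=; apply/andP; split; apply/eqP; field.
Qed.

(** The series of f_k g_k^* converges by polarization, which writes its partial
    sums through those of four square summable sequences. *)
Definition l2_dot f g : C :=
  Complex ((l2_nsq (f + g) - l2_nsq (f - g)) / 4)
    ((l2_nsq (f + 'i%C *: g) - l2_nsq (f - 'i%C *: g)) / 4).

Definition partial_dot f g n : C := \sum_(k < n) (l2_fun f k : C) * (l2_fun g k : C)^*.

Lemma cvg_partial_dot f g : ccvg (partial_dot f g) (l2_dot f g).
Proof.
have cE h h' : (fun n => (sqsum (l2_fun h) n - sqsum (l2_fun h') n) / 4) @ \oo -->
    (l2_nsq h - l2_nsq h') / 4.
  by apply: cvgMl; apply: cvgB; exact: cvg_l2_nsq.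
have -> : partial_dot f g = (fun n =>
    Complex ((sqsum (l2_fun (f + g)) n - sqsum (l2_fun (f - g)) n) / 4)
      ((sqsum (l2_fun (f + 'i%C *: g)) n - sqsum (l2_fun (f - 'i%C *: g)) n) / 4)).
  apply: funext => n; rewrite /partial_dot /sqsum -!sumrB !mulr_suml.
  under eq_bigr do rewrite csq_polarization.
  by apply/eqP; rewrite eq_complex [complex.Re _]raddf_sum [complex.Im _]raddf_sum !eqxx.
by split; exact: cE.
Qed.

Lemma l2_dotP f g z : ccvg (partial_dot f g) z -> l2_dot f g = z.
Proof. by apply: ccvg_unique; exact: cvg_partial_dot. Qed.

Lemma l2_dotC f g : l2_dot f g = (-1) ^+ false * (l2_dot g f)^*.
Proof.
rewrite mul1r; apply: l2_dotP; have := ccvg_conj (cvg_partial_dot g f).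
congr ccvg; apply/funext => n; rewrite rmorph_sum; apply: eq_bigr => k _.
by rewrite rmorphM /= conjCK mulrC.
Qed.

Lemma l2_dot_linearl h (c : C) f g : l2_dot (c *: f + g) h = c * l2_dot f h + l2_dot g h.
Proof.
apply: l2_dotP; have := ccvgD (ccvgZ c (cvg_partial_dot f h)) (cvg_partial_dot g h).
congr ccvg; apply/funext => n; rewrite mulr_sumr -big_split /=.
by apply: eq_bigr => k _; rewrite mulrA -mulrDl.
Qed.

Lemma l2_dot_bilinear : bilinear_for *%R (Num.conj \; *%R) l2_dot.
Proof.
split=> [h|h] c f g; first exact: l2_dot_linearl.
rewrite l2_dotC mul1r l2_dot_linearl rmorphD rmorphM /=.
by rewrite [in RHS]l2_dotC mul1r [l2_dot h g]l2_dotC mul1r.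
Qed.
HB.instance Definition _ := bilinear_isBilinear.Build C l2 l2 C _ _ l2_dot l2_dot_bilinear.
HB.instance Definition _ := isHermitianSesquilinear.Build C l2 false Num.conj l2_dot l2_dotC.

Lemma l2_dot_nsq f : l2_dot f f = (l2_nsq f)%:C%C.
Proof.
apply: l2_dotP.
have -> : partial_dot f f = (fun n => (sqsum (l2_fun f) n)%:C%C).
  by apply/funext => n; rewrite rmorph_sum; apply: eq_bigr => k _; rewrite csqE.
by split; [exact: cvg_l2_nsq|exact: cvg_cst].
Qed.

Lemma l2_dot_gt0 f : f != 0 -> 0 < l2_dot f f.
Proof.
move=> f0; rewrite l2_dot_nsq ltcR ltNge; apply: contra f0 => fle.
apply/eqP/l2_ext => k; apply: csq_eq0; apply/eqP; rewrite eq_le csq_ge0 andbT.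
apply: le_trans fle; apply: le_trans (sqsum_le_l2_nsq f k.+1).
exact: (sqsum_csq_le _ (ltnSn k)).
Qed.
HB.instance Definition _ := isDotProduct.Build C l2 l2_dot l2_dot_gt0.

Lemma nsq_l2 f : nsq (l2_dot : {dot l2 for @Num.conj_op C}) f = l2_nsq f.
Proof. by have := congr1 (@complex.Re R) (l2_dot_nsq f). Qed.

Definition l2_norm f : C := (Num.sqrt (l2_nsq f))%:C%C.

Lemma l2_normD f g : l2_norm (f + g) <= l2_norm f + l2_norm g.
Proof. by rewrite -rmorphD lecR /= -!nsq_l2 sqrt_nsqD. Qed.

Lemma l2_normZ (c : C) f : l2_norm (c *: f) = `|c| * l2_norm f.
Proof.
rewrite normc_csq -rmorphM /l2_norm -!nsq_l2 nsqZ -/(csq c) sqrtrM //.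
exact: csq_ge0.
Qed.

Lemma l2_norm0_eq0 f : l2_norm f = 0 -> f = 0.
Proof.
move=> /(congr1 (@complex.Re R)) /= /eqP; rewrite sqrtr_eq0 -nsq_l2.
exact: nsq_le0.
Qed.
HB.instance Definition _ := Lmodule_isNormed.Build C l2 l2_normD l2_normZ l2_norm0_eq0.

Lemma l2_normE f : `|f| = l2_norm f. Proof. by []. Qed.

Lemma l2_norm_lt f (e : R) : 0 < e -> l2_norm f < e%:C%C -> l2_nsq f <= e ^+ 2.
Proof.
move=> e0; rewrite ltcR => fe; rewrite -[l2_nsq f]sqr_sqrtr -?nsq_l2 ?nsq_ge0 //.
by rewrite nsq_l2 ler_pXn2r ?nnegrE ?sqrtr_ge0 ?ltW.
Qed.

Lemma csq_coord_le f k : csq (l2_fun f k) <= l2_nsq f.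
Proof.
exact: le_trans (sqsum_csq_le _ (ltnSn k)) (sqsum_le_l2_nsq f k.+1).
Qed.

Section Completeness.
Variable F : set_system l2.
Hypotheses (FF : ProperFilter F) (Fc : cauchy F).

Let small (e : R) : 0 < e -> exists f, F [set g | l2_nsq (f - g) <= e ^+ 2].
Proof.
move=> e0; move/cauchyP: Fc => /(_ e%:C%C) [|f Ff]; first by rewrite ltcR.
exists f; apply: filterS Ff => g; rewrite -ball_normE /= => fg.
exact: l2_norm_lt.
Qed.

Let coord_cvg (p : C -> R) k : (forall z w, p (z - w) = p z - p w) ->
  (forall z, p z ^+ 2 <= csq z) -> cvg ((fun f => p (l2_fun f k)) @ F).
Proof.
move=> pB p2; apply: cauchy_cvg; apply/cauchyP => e e0.
have e2 : 0 < e / 2 by rewrite divr_gt0.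
have [f Ff] := small e2; exists (p (l2_fun f k)).
change (F ((fun g => p (l2_fun g k)) @^-1` ball (p (l2_fun f k)) e)).
apply: filterS Ff => g /= fg; change (`|p (l2_fun f k) - p (l2_fun g k)| < e).
rewrite -pB -[e]gtr0_norm // -ltr_sqr ?nnegrE // !real_normK ?num_real //.
apply: le_lt_trans (p2 _) _; apply: le_lt_trans (csq_coord_le (f - g) k) _.
apply: le_lt_trans fg _; rewrite ltr_pXn2r ?nnegrE ?ltW //; lra.
Qed.

Let coord_limit k : exists a : C,
  ((fun f => complex.Re (l2_fun f k)) @ F --> (complex.Re a : R)) /\
  ((fun f => complex.Im (l2_fun f k)) @ F --> (complex.Im a : R)).
Proof.
have hRe (z : C) : complex.Re z ^+ 2 <= csq z by rewrite lerDl sqr_ge0.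
have hIm (z : C) : complex.Im z ^+ 2 <= csq z by rewrite lerDr sqr_ge0.
have /cvg_ex[a Fa] := @coord_cvg _ k (raddfB (@complex.Re R)) hRe.
have /cvg_ex[b Fb] := @coord_cvg _ k (raddfB (@complex.Im R)) hIm.
by exists (Complex a b).
Qed.

(** The coordinates converge to a sequence a.  The bounds on the partial sums of
    f - g, for g in a small set of F, pass to the limit in g at each fixed n; hence
    they bound f - a, which shows that a is square summable and close to F. *)
Lemma l2_cauchy_cvg : cvg F.
Proof.
have thirds (r : R) : 0 < r -> r / 3 + r / 3 < r by move=> r0; lra.
have [a Fa] := choice coord_limit.
have sqsum_cvg f n :
    (fun g => sqsum (l2_fun f - l2_fun g) n) @ F --> sqsum (l2_fun f - a) n.
  elim: n => [|n IHn].
    rewrite /sqsum big_ord0; under eq_fun do rewrite big_ord0.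
    exact: cvg_cst.
  rewrite /sqsum big_ord_recr; under eq_fun do rewrite big_ord_recr.
  apply: cvgD; first exact: IHn.
  have [hr hi] := Fa n; rewrite /csq.
  have h (p : C -> R) : (forall z w, p (z - w) = p z - p w) ->
      (fun g => p (l2_fun g n)) @ F --> p (a n) ->
      (fun g => p (l2_fun f n - l2_fun g n) ^+ 2) @ F --> p (l2_fun f n - a n) ^+ 2.
    move=> pB pa; rewrite pB expr2; under eq_fun do rewrite pB expr2.
    by apply: cvgM; apply: cvgB => //; exact: cvg_cst.
  by apply: cvgD; apply: h => //; exact: raddfB.
have tail f (e : R) : F [set g | l2_nsq (f - g) <= e ^+ 2] ->
    forall n, sqsum (l2_fun f - a) n <= e ^+ 2.
  move=> Ff n; apply: (cvgr_to_le (sqsum_cvg f n)).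
  by apply: filterS Ff => g /=; apply: le_trans; exact: (sqsum_le_l2_nsq (f - g)).
have a_summable : a \in @square_summable R.
  have [f Ff] := small ltr01.
  have fa : l2_fun f - a \in @square_summable R.
    by apply/asboolP; exists (1 ^+ 2); exact: tail.
  have -> : a = l2_fun f - (l2_fun f - a) by rewrite opprB addrC subrK.
  by apply: rpredB => //; case: (f).
apply/cvg_ex; exists (L2 a_summable); apply/cvgrPdist_lt => e /gt0_complexE[e0 ->].
have e3 : 0 < complex.Re e / 3 by rewrite divr_gt0 //.
have [f Ff] := small e3; have ta := tail _ _ Ff.
apply: filterS Ff => g /= fg; rewrite l2_normE ltcR.
have -> : L2 a_summable - g = (f - g) - (f - L2 a_summable).
  by rewrite opprB [RHS]addrC addrA subrK.
have fa : l2_nsq (f - L2 a_summable) <= (complex.Re e / 3) ^+ 2.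
  by apply: l2_nsq_le => n; exact: ta.
rewrite -!nsq_l2 in fg fa *.
apply: le_lt_trans (sqrt_nsqD _ _ _) _; rewrite nsqN.
have sq3 (z : R) : z <= (complex.Re e / 3) ^+ 2 -> Num.sqrt z <= complex.Re e / 3.
  by move=> /ler_wsqrtr; rewrite sqrtr_sqr gtr0_norm.
apply: le_lt_trans (lerD (sq3 _ fg) (sq3 _ fa)) _.
exact: thirds.
Qed.
End Completeness.

HB.instance Definition _ := Uniform_isComplete.Build l2 l2_cauchy_cvg.

Lemma l2_dot_norm f : l2_dot f f = `|f| ^+ 2.
Proof.
by rewrite l2_normE /l2_norm -rmorphXn /= sqr_sqrtr -?nsq_l2 ?nsq_ge0 // l2_dot_nsq nsq_l2.
Qed.
HB.instance Definition _ := isHilbert.Build C l2 l2_dot_norm.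

End L2Dot.

(** * Orthonormal sequences *)

Section OrthonormalSequences.
Variables (R : realType) (K : hilbertType R[i]) (e : nat -> K).
Local Notation C := R[i].
Local Notation ip := (rdot (@dotp C K)).
Local Notation sq := (nsq (@dotp C K)).
Hypothesis e_orthonormal : forall i j, dotp (e i) (e j) = (i == j)%:R.
Implicit Types (u v w : K) (c : nat -> C^o).

Definition coef v k : C := dotp v (e k).
Definition lincomb c n : K := \sum_(k < n) (c k : C) *: e k.

Lemma coef_linear (a : C) u v k : coef (a *: u + v) k = a * coef u k + coef v k.
Proof. by rewrite /coef linearDl linearZl_LR. Qed.

Lemma coefZ (a : C) k : dotp (a *: e k) (e k) = a.
Proof. by rewrite linearZl_LR /= e_orthonormal eqxx mulr1. Qed.

Lemma coef_lincomb c n k : coef (lincomb c n) k = if (k < n)%N then c k else 0.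
Proof.
elim: n => [|n IHn]; first by rewrite /coef /lincomb big_ord0 linear0l.
rewrite /lincomb big_ord_recr /= addrC coef_linear [coef (\sum__ _) _]IHn.
rewrite /coef e_orthonormal ltnS.
by case: ltngtP => [_|_|->] /=; rewrite ?mulr1 ?addr0 ?mulr0 ?add0r.
Qed.

(** The right side is least when c is the sequence of coefficients of v; this
    gives both the inequality of Bessel and the best approximation. *)
Lemma nsq_sub_lincomb v c n :
  sq (v - lincomb c n) = sq v - sqsum (coef v) n + sqsum (fun k => c k - coef v k) n.
Proof.
elim: n => [|n IHn].
  by rewrite /lincomb /sqsum !big_ord0 subr0 subr0 addr0.
rewrite /lincomb big_ord_recr /= opprD addrA -/(lincomb c n) nsqB IHn.
rewrite /sqsum !big_ord_recr /= -!/(sqsum _ _).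
have -> : ip (v - lincomb c n) (c n *: e n) = complex.Re ((c n : C)^* * coef v n).
  rewrite /rdot linearZr_LR /= -[dotp _ (e n)]/(coef (v - lincomb c n) n).
  have -> : coef (v - lincomb c n) n = coef v n.
    by rewrite addrC -scaleN1r coef_linear coef_lincomb ltnn mulr0 add0r.
  by [].
rewrite nsqZ /nsq /rdot e_orthonormal eqxx /=.
by case: (c n) (coef v n) => a b [a' b']; rewrite /csq /=; ring.
Qed.

Lemma nsq_lincomb c n : sq (lincomb c n) = sqsum c n.
Proof.
have := nsq_sub_lincomb 0 c n; rewrite sub0r nsqN nsq0 => ->.
have c0 k : coef 0 k = 0 by rewrite /coef linear0l.
rewrite /sqsum big1 => [|k _]; last by rewrite c0 /csq /= expr0n addr0.
by rewrite subr0 add0r; apply: eq_bigr => k _; rewrite c0 subr0.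
Qed.

Lemma Bessel v n : sqsum (coef v) n <= sq v.
Proof.
have z : sqsum (fun k => coef v k - coef v k) n = 0.
  by rewrite /sqsum big1 // => k _; rewrite subrr /csq /= expr0n addr0.
have := nsq_sub_lincomb v (coef v) n; rewrite z.
by have := nsq_ge0 dotp (v - lincomb (coef v) n); lra.
Qed.

Lemma lincombB c m n : (m <= n)%N ->
  sq (lincomb c n - lincomb c m) = sqsum c n - sqsum c m.
Proof.
move=> mn; rewrite nsq_sub_lincomb nsq_lincomb -[RHS]addr0; congr (_ - _ + _).
  by apply: eq_bigr => k _; rewrite coef_lincomb (leq_trans (ltn_ord k) mn).
rewrite /sqsum big1 // => k _.
by rewrite /= coef_lincomb (leq_trans (ltn_ord k) mn) subrr /csq /= expr0n addr0.
Qed.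

Lemma Riesz_Fischer c (M : R) : (forall n, sqsum c n <= M) ->
  exists v, forall k, coef v k = c k.
Proof.
move=> cM; have [|v cv] := @cvg_of_increments _ _ (lincomb c) (sqsum c) M cM.
  by move=> m n mn; rewrite lincombB.
exists v => k.
have h w : (forall n, (k < n)%N -> ip (lincomb c n) w = ip ((c k : C) *: e k) w) ->
    ip v w = ip ((c k : C) *: e k) w.
  move=> hw; apply: (cvg_unique (@Rhausdorff R) (cvg_ip (w := w) cv)).
  by apply: cvg_near_cst; exists k.+1 => //= n kn; apply/eqP/hw.
have ck n : (k < n)%N -> dotp (lincomb c n) (e k) = dotp ((c k : C) *: e k) (e k).
  move=> kn; have := coef_lincomb c n k; rewrite /coef kn => ->.
  by rewrite coefZ.
have -> : c k = coef ((c k : C) *: e k) k.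
  by rewrite /coef coefZ.
have hr n : (k < n)%N -> ip (lincomb c n) (e k) = ip ((c k : C) *: e k) (e k).
  by move=> /ck hn; rewrite /rdot hn.
have hi n : (k < n)%N ->
    ip (lincomb c n) ('i%C *: e k) = ip ((c k : C) *: e k) ('i%C *: e k).
  by move=> /ck hn; rewrite /rdot !linearZr_LR /= hn.
by rewrite /coef !form_rdot (h _ hr) (h _ hi).
Qed.

Hypothesis e_total : dense [set x | exists (n : nat) (c : nat -> C),
  x = \sum_(k < n) c k *: e k].

Lemma Parseval v : sqsum (coef v) @ \oo --> sq v.
Proof.
apply/cvgrPdist_lt => r r0; have /denseP/(_ v r r0)[u [n [c ->]] uv] := e_total.
exists n => // m /= nm; have := Bessel v m; move: uv; rewrite nsq_sym nsq_sub_lincomb.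
have := sqsum_mono (coef v) nm; have := sqsum_ge0 (fun k => c k - coef v k) n.
by move=> h1 h2 h3 h4; rewrite ger0_norm; lra.
Qed.

Lemma coef_summable v : coef v \in @square_summable R.
Proof. by apply/asboolP; exists (sq v); exact: Bessel. Qed.

Definition coef_l2 v : l2 R := L2 (coef_summable v).

Lemma coef_l2_linear : linear coef_l2.
Proof. by move=> a u v; apply: l2_ext => k; exact: coef_linear. Qed.
HB.instance Definition _ := GRing.isLinear.Build C K (l2 R) *:%R coef_l2 coef_l2_linear.

Lemma nsq_coef_l2 v : nsq dotp (coef_l2 v) = sq v.
Proof.
rewrite -[LHS]/(nsq (@l2_dot R : {dot _ for _}) _) nsq_l2.
have h1 := @Parseval v.
have h2 : sqsum (coef v) @ \oo --> l2_nsq (coef_l2 v) := @cvg_l2_nsq R (coef_l2 v).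
exact: (cvg_unique (@Rhausdorff R) h2 h1).
Qed.

Lemma dotp_coef_l2 u v : dotp (coef_l2 u) (coef_l2 v) = dotp u v.
Proof.
have h w w' : rdot dotp (coef_l2 w) (coef_l2 w') = ip w w'.
  by rewrite !rdot_polarization -!nsq_coef_l2 linearD linearB.
by rewrite !form_rdot -!h linearZ.
Qed.

Lemma coef_l2_bijective : bijective coef_l2.
Proof.
have surj f : exists v, coef_l2 v = f.
  have [M fM] := l2_bound f; have [v vf] := Riesz_Fischer fM.
  by exists v; apply: l2_ext.
have [g gK] := choice surj; exists g => // v.
apply/eqP; rewrite -subr_eq0; apply/eqP/(@nsq_eq0 _ _ dotp).
by rewrite -nsq_coef_l2 linearB /= gK subrr nsq0.
Qed.

End OrthonormalSequences.

(** * The algebra of adjointable operators *)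

Section AdjointableOperators.
Variables (R : realType) (H : hilbertType R[i]).
Local Notation C := R[i].
Implicit Types u v w : H.

(** An operator is kept together with its adjoint, so that the involution exchanges
    the two; linearity follows from adjointness. *)
Record adjointable := Adjointable {
  op : H -> H;
  adj : H -> H;
  op_adj : forall u v, dotp (op u) v = dotp u (adj v) }.

Lemma dotp_inj u v : (forall w, dotp u w = dotp v w :> C) -> u = v.
Proof.
move=> uv; apply/eqP; rewrite -subr_eq0; apply/eqP/(@nsq_eq0 _ _ dotp).
by rewrite /nsq rdotBl /rdot uv subrr.
Qed.

Lemma dotpC (u v : H) : dotp u v = (dotp v u)^* :> C.
Proof. exact: form_conj. Qed.

Lemma adj_op S u v : dotp (adj S u) v = dotp u (op S v) :> C.
Proof. by rewrite dotpC -op_adj -dotpC. Qed.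

Lemma adjointable_ext S S' : (forall u, op S u = op S' u) -> S = S'.
Proof.
case: S S' => o a oa [o' a' oa'] /= oo'.
have ho : o = o' by apply: funext.
move: oa; rewrite ho => oa.
have ha : a = a'.
  apply: funext => u; apply: dotp_inj => w.
  by rewrite dotpC -oa oa' -dotpC.
by move: oa; rewrite ha => oa; rewrite (Prop_irrelevance oa oa').
Qed.

Lemma op_linear S (c : C) u v : op S (c *: u + v) = c *: op S u + op S v.
Proof.
apply: dotp_inj => w; rewrite op_adj linearDl linearZl_LR /= -!op_adj.
by rewrite linearDl linearZl_LR.
Qed.

Lemma opD S u v : op S (u + v) = op S u + op S v.
Proof. by rewrite -[u]scale1r op_linear !scale1r. Qed.

Lemma opZ S (c : C) u : op S (c *: u) = c *: op S u.
Proof. exact: linopZ (op_linear S) c u. Qed.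

Fact adj_add_subproof S S' u v :
  dotp (op S u + op S' u) v = dotp u (adj S v + adj S' v) :> C.
Proof. by rewrite linearDl /= !op_adj linearDr. Qed.
Fact adj_opp_subproof S u v : dotp (- op S u) v = dotp u (- adj S v) :> C.
Proof. by rewrite linearNl /= op_adj linearNr. Qed.
Fact adj_zero_subproof u v : dotp (0 : H) v = dotp u (0 : H) :> C.
Proof. by rewrite linear0l linear0r. Qed.
Fact adj_mul_subproof S S' u v :
  dotp (op S (op S' u)) v = dotp u (adj S' (adj S v)) :> C.
Proof. by rewrite !op_adj. Qed.
Fact adj_scale_subproof (c : C) S u v :
  dotp (c *: op S u) v = dotp u (c^* *: adj S v) :> C.
Proof. by rewrite linearZl_LR linearZr_LR /= op_adj conjCK. Qed.

Definition adj_add S S' := Adjointable (adj_add_subproof S S').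
Definition adj_opp S := Adjointable (adj_opp_subproof S).
Definition adj_zero := Adjointable adj_zero_subproof.
Definition adj_one := @Adjointable id id (fun u v => erefl).
Definition adj_mul S S' := Adjointable (adj_mul_subproof S S').
Definition adj_scale c S := Adjointable (adj_scale_subproof c S).
Definition adj_star S := @Adjointable (adj S) (op S) (adj_op S).

Lemma adj_starK S : adj_star (adj_star S) = S.
Proof. exact: adjointable_ext. Qed.

End AdjointableOperators.

Section AdjointableAlgebra.
Variables (R : realType) (H : hilbertType R[i]) (z : H) (z_neq0 : z != 0).
Local Notation C := R[i].

(** An algebra has 1 <> 0, which requires a nonzero vector: a witness is made a
    parameter of the type, where the search for instances finds it. *)
Definition op_alg of z != 0 : Type := adjointable H.
Local Notation L := (op_alg z_neq0).
HB.instance Definition _ := gen_eqMixin L.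
HB.instance Definition _ := gen_choiceMixin L.

Fact op_addA : associative (@adj_add R H).
Proof. by move=> S S' S''; apply: adjointable_ext => u /=; rewrite addrA. Qed.
Fact op_addC : commutative (@adj_add R H).
Proof. by move=> S S'; apply: adjointable_ext => u /=; rewrite addrC. Qed.
Fact op_add0 : left_id (@adj_zero R H) (@adj_add R H).
Proof. by move=> S; apply: adjointable_ext => u /=; rewrite add0r. Qed.
Fact op_addN : left_inverse (@adj_zero R H) (@adj_opp R H) (@adj_add R H).
Proof. by move=> S; apply: adjointable_ext => u /=; rewrite addNr. Qed.
HB.instance Definition _ := GRing.isZmodule.Build L op_addA op_addC op_add0 op_addN.

Fact op_mulA : associative (@adj_mul R H).
Proof. by move=> S S' S''; apply: adjointable_ext. Qed.
Fact op_mul1 : left_id (@adj_one R H) (@adj_mul R H).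
Proof. by move=> S; apply: adjointable_ext. Qed.
Fact op_mulr1 : right_id (@adj_one R H) (@adj_mul R H).
Proof. by move=> S; apply: adjointable_ext. Qed.
Fact op_mulDl : left_distributive (@adj_mul R H) (@adj_add R H).
Proof. by move=> S S' S''; apply: adjointable_ext. Qed.
Fact op_mulDr : right_distributive (@adj_mul R H) (@adj_add R H).
Proof. by move=> S S' S''; apply: adjointable_ext => u /=; rewrite opD. Qed.
Fact op_one_neq0 : (adj_one H : L) != (adj_zero H : L).
Proof.
apply/eqP => /(congr1 (fun S : adjointable H => op S z)) /= z0.
by move: z_neq0; rewrite z0 eqxx.
Qed.
HB.instance Definition _ := GRing.Zmodule_isNzRing.Build L
  op_mulA op_mul1 op_mulr1 op_mulDl op_mulDr op_one_neq0.

Fact op_scaleA (c d : C) (S : L) : adj_scale c (adj_scale d S) = adj_scale (c * d) S.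
Proof. by apply: adjointable_ext => u /=; rewrite scalerA. Qed.
Fact op_scale1 : left_id 1 (@adj_scale R H).
Proof. by move=> S; apply: adjointable_ext => u /=; rewrite scale1r. Qed.
Fact op_scaleDr : right_distributive (@adj_scale R H) (@adj_add R H).
Proof. by move=> c S S'; apply: adjointable_ext => u /=; rewrite scalerDr. Qed.
Fact op_scaleDl (S : L) (c d : C) :
  adj_scale (c + d) S = adj_add (adj_scale c S) (adj_scale d S).
Proof. by apply: adjointable_ext => u /=; rewrite scalerDl. Qed.
HB.instance Definition _ := GRing.Zmodule_isLmodule.Build C L
  op_scaleA op_scale1 op_scaleDr op_scaleDl.

Fact op_scaleAl (c : C) (S S' : L) : c *: (S * S') = (c *: S) * S'.
Proof. exact: adjointable_ext. Qed.
HB.instance Definition _ := GRing.Lmodule_isLalgebra.Build C L op_scaleAl.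
Fact op_scaleAr (c : C) (S S' : L) : c *: (S * S') = S * (c *: S').
Proof. by apply: adjointable_ext => u /=; rewrite opZ. Qed.
HB.instance Definition _ := GRing.Lalgebra_isAlgebra.Build C L op_scaleAr.

Fact op_star_antilinear (c : C) (S S' : L) :
  adj_star (c *: S + S') = c^* *: (adj_star S : L) + (adj_star S' : L).
Proof. exact: adjointable_ext. Qed.
Fact op_starM (S S' : L) : adj_star (S * S') = (adj_star S' : L) * (adj_star S : L).
Proof. exact: adjointable_ext. Qed.
HB.instance Definition _ := isStarAlgebra.Build C L
  op_star_antilinear op_starM (@adj_starK R H).

Lemma star_rep_of_hom (A : starAlgType C) (f : A -> L) : star_hom f ->
  is_star_rep setT (fun a u => op (f a) u).
Proof.
move=> [fL fM f1 fS]; split => //.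
- by rewrite /dense => O O0 _; rewrite setIT.
- by move=> a c u v _ _; exact: op_linear.
- by move=> c a b u _; rewrite fL.
- by move=> u _; rewrite f1.
- by move=> a b u _; rewrite fM.
- by move=> a u v _ _; rewrite fS op_adj.
Qed.

End AdjointableAlgebra.

(** * The representation on square summable sequences *)

Section L2Basis.
Variable R : realType.
Local Notation C := R[i].
Local Notation H := (l2 R).

Lemma dotp_l2 (f g : H) : dotp f g = l2_dot f g. Proof. by []. Qed.

Lemma l2_basis_subproof k : (fun j => (j == k)%:R : C^o) \in @square_summable R.
Proof.
apply/asboolP; exists 1 => n; rewrite /sqsum.
have [kn|kn] := ltnP k n; last first.
  rewrite big1 // => j _; rewrite ltn_eqF ?(leq_trans (ltn_ord j) kn) //.
  by rewrite /csq /= expr0n addr0.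
rewrite (bigD1 (Ordinal kn)) //= eqxx big1 => [|j jk].
  by rewrite /csq /= expr0n expr1n !addr0.
by rewrite -[_ == k]/(j == Ordinal kn) (negPf jk) /csq /= expr0n addr0.
Qed.

Definition l2_basis k : H := L2 (l2_basis_subproof k).

Lemma l2_basisE j k : l2_fun (l2_basis k) j = (j == k)%:R. Proof. by []. Qed.

Lemma coef_l2_basis (f : H) k : dotp f (l2_basis k) = l2_fun f k.
Proof.
rewrite dotp_l2; apply: l2_dotP.
have e n : (k < n)%N -> partial_dot f (l2_basis k) n = l2_fun f k.
  move=> kn; rewrite /partial_dot (bigD1 (Ordinal kn)) //= eqxx conjC1 mulr1.
  rewrite big1 ?addr0 // => j jk.
  by rewrite -[_ == k]/(j == Ordinal kn) (negPf jk) conjC0 mulr0.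
by split; apply: cvg_near_cst; exists k.+1 => //= n kn; rewrite e.
Qed.

Lemma l2_basis_orthonormal i j : dotp (l2_basis i) (l2_basis j) = (i == j)%:R :> C.
Proof. by rewrite coef_l2_basis l2_basisE eq_sym. Qed.

Lemma l2_orthonormal_basis : orthonormal_basis l2_basis.
Proof.
split; first exact: l2_basis_orthonormal.
apply/denseP => f e e0.
have /cvgrPdist_lt/(_ e e0)[n _ /(_ n (leqnn n))] := @cvg_l2_nsq R f.
have -> : l2_nsq f = nsq dotp f by rewrite -nsq_l2.
have fE : sqsum (l2_fun f) n = sqsum (coef l2_basis f) n.
  by apply: eq_bigr => k _; rewrite /coef coef_l2_basis.
rewrite fE ger0_norm ?subr_ge0; last exact: (Bessel l2_basis_orthonormal).
exists (lincomb l2_basis (coef l2_basis f) n); first by exists n, (coef l2_basis f).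
rewrite nsq_sym (nsq_sub_lincomb l2_basis_orthonormal).
rewrite [X in _ + X](_ : _ = 0) ?addr0 // /sqsum big1 // => k _.
by rewrite subrr /csq /= expr0n addr0.
Qed.

End L2Basis.

Section WeightedShifts.
Variables (R : realType) (q : R).
Hypotheses (q_neq0 : 0 < `|q|) (q_lt1 : `|q| < 1).
Local Notation C := R[i].
Local Notation H := (l2 R).
Implicit Types f g : H.

Definition diag_weight k : R := q ^+ (2 * k).
Definition shift_weight k : R := Num.sqrt (1 - q ^+ (4 * k)).

Lemma q4X_ge0 k : 0 <= q ^+ (4 * k).
Proof. by rewrite exprM exprn_ge0 // ltW // q4_gt0. Qed.

Lemma q4X_le1 k : q ^+ (4 * k) <= 1.
Proof. by rewrite exprM exprn_ile1 // ltW ?q4_gt0 ?q4_lt1. Qed.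

Lemma diag_weight_sqr k : diag_weight k ^+ 2 = q ^+ (4 * k).
Proof. by rewrite -exprM mulnC mulnA. Qed.

Lemma shift_weight_sqr k : shift_weight k ^+ 2 = 1 - q ^+ (4 * k).
Proof. by rewrite sqr_sqrtr // subr_ge0 q4X_le1. Qed.

Lemma shift_weight0 : shift_weight 0 = 0.
Proof. by rewrite /shift_weight muln0 expr0 subrr sqrtr0. Qed.

Lemma shift_weight_gt0 k : 0 < shift_weight k.+1.
Proof.
rewrite sqrtr_gt0 subr_gt0 exprM exprn_ilt1 //.
- by rewrite ltW // q4_gt0.
- exact: q4_lt1.
Qed.

Lemma csq_weight_le (a : R) (z : C) : a ^+ 2 <= 1 -> csq (a%:C%C * z) <= csq z.
Proof. by move=> a1; rewrite csqM csq_real ler_piMl ?csq_ge0. Qed.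

Lemma diag_weight_le1 k : diag_weight k ^+ 2 <= 1.
Proof. by rewrite diag_weight_sqr q4X_le1. Qed.

Lemma shift_weight_le1 k : shift_weight k ^+ 2 <= 1.
Proof. by rewrite shift_weight_sqr gerBl q4X_ge0. Qed.

Lemma diag_subproof f :
  (fun k => (diag_weight k)%:C%C * l2_fun f k : C^o) \in @square_summable R.
Proof.
have [M fM] := l2_bound f; apply/asboolP; exists M => n; apply: le_trans (fM n).
by apply: ler_sum => k _; rewrite csq_weight_le ?diag_weight_le1.
Qed.

Lemma shift_subproof f :
  (fun k => (shift_weight k.+1)%:C%C * l2_fun f k.+1 : C^o) \in @square_summable R.
Proof.
have [M fM] := l2_bound f; apply/asboolP; exists M => n; apply: le_trans (fM n.+1).
rewrite [leRHS]/sqsum big_ord_recl /= ler_wpDl ?csq_ge0 //.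
by apply: ler_sum => k _; rewrite csq_weight_le ?shift_weight_le1.
Qed.

(** At k = 0 the predecessor is 0 again, which is harmless since the weight vanishes. *)
Lemma unshift_subproof f :
  (fun k => (shift_weight k)%:C%C * l2_fun f k.-1 : C^o) \in @square_summable R.
Proof.
have [M fM] := l2_bound f; apply/asboolP; exists M => -[|n].
  by have := fM 0%N; rewrite /sqsum !big_ord0.
apply: le_trans (fM n); rewrite /sqsum big_ord_recl /= shift_weight0.
rewrite csqM csq_real expr0n mul0r add0r.
by apply: ler_sum => k _; rewrite csq_weight_le ?shift_weight_le1.
Qed.

Definition diag_op f : H := L2 (diag_subproof f).
Definition shift_op f : H := L2 (shift_subproof f).
Definition unshift_op f : H := L2 (unshift_subproof f).

Lemma diag_op_sym f g : dotp (diag_op f) g = dotp f (diag_op g) :> C.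
Proof.
rewrite !dotp_l2; apply: l2_dotP; have := cvg_partial_dot f (diag_op g).
congr ccvg; apply: funext => n; apply: eq_bigr => k _ /=.
by rewrite rmorphM /= conj_realC mulrCA mulrA.
Qed.

Lemma shift_op_adj f g : dotp (shift_op f) g = dotp f (unshift_op g) :> C.
Proof.
rewrite !dotp_l2; apply: l2_dotP.
have e n : partial_dot (shift_op f) g n = partial_dot f (unshift_op g) n.+1.
  rewrite /partial_dot big_ord_recl /= shift_weight0 rmorphM /= conj_realC mul0r mulr0 add0r.
  by apply: eq_bigr => k _ /=; rewrite rmorphM /= conj_realC mulrCA mulrA.
have [hr hi] := cvg_partial_dot f (unshift_op g).
have -> : partial_dot (shift_op f) g = (fun n => partial_dot f (unshift_op g) n.+1).
  exact: funext.
split; first by move: hr; rewrite -cvg_shiftS.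
by move: hi; rewrite -cvg_shiftS.
Qed.

Lemma l2_basis_neq0 : l2_basis R 0 != 0.
Proof.
apply/eqP => /(congr1 (fun f : H => l2_fun f 0%N)) /eqP.
by rewrite l2_basisE l2_coord0 oner_eq0.
Qed.

Definition l2_A : op_alg l2_basis_neq0 := Adjointable diag_op_sym.
Definition l2_B : op_alg l2_basis_neq0 := Adjointable shift_op_adj.

Lemma diag_weightS k : diag_weight k.+1 = q ^+ 2 * diag_weight k.
Proof. by rewrite /diag_weight mulnS exprD. Qed.

(** On the k-th coordinate this is B^*B = 1 - A^2. *)
Lemma weight_sqrD k (z : C) :
  (shift_weight k)%:C%C * ((shift_weight k)%:C%C * z) =
  - ((diag_weight k)%:C%C * ((diag_weight k)%:C%C * z)) + z.
Proof.
rewrite !mulrA -!rmorphM -!expr2 shift_weight_sqr diag_weight_sqr rmorphB rmorph1.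
by rewrite mulrBl mul1r addrC.
Qed.

Lemma l2_relators : all (pred1 0) (sphere_relators q l2_A l2_B).
Proof.
apply/sphere_relatorsP; split; apply: adjointable_ext => f; apply: l2_ext => k //=.
- transitivity ((q ^+ 2)%:C%C * ((diag_weight k)%:C%C *
    ((shift_weight k.+1)%:C%C * l2_fun f k.+1)) : C) => //.
  by rewrite [LHS]mulrCA diag_weightS rmorphM -mulrA.
- transitivity (- ((diag_weight k)%:C%C * ((diag_weight k)%:C%C * l2_fun f k)) +
    l2_fun f k : C) => //.
  rewrite -weight_sqrD; case: k => //.
  by rewrite shift_weight0 !mul0r.
- transitivity (- ((q ^+ 4)%:C%C * ((diag_weight k)%:C%C * ((diag_weight k)%:C%C *
    l2_fun f k))) + l2_fun f k : C) => //.
  rewrite weight_sqrD !diag_weightS; congr (- _ + _).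
  by rewrite !mulrA -!rmorphM; congr (_%:C%C * _); ring.
Qed.

Definition l2_sphere_hom : sphere_alg q -> op_alg l2_basis_neq0 := sphere_lift l2_A l2_B.
Definition l2_rep (a : rp2_alg q) f : H := op (l2_sphere_hom (rp2_val a)) f.

Lemma l2_rep_star : is_star_rep setT l2_rep.
Proof.
apply: (star_rep_of_hom (f := fun a => l2_sphere_hom (rp2_val a))).
have [fL fM f1 fS] := sphere_lift_hom l2_relators.
split=> [c a b|a b||a].
- exact: (fL c (rp2_val a) (rp2_val b)).
- exact: (fM (rp2_val a) (rp2_val b)).
- exact: f1.
- exact: (fS (rp2_val a)).
Qed.

Lemma l2_hom_A : l2_sphere_hom (sphere_A q) = l2_A.
Proof. exact: sphere_liftA l2_relators. Qed.
Lemma l2_hom_B : l2_sphere_hom (sphere_B q) = l2_B.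
Proof. exact: sphere_liftB l2_relators. Qed.

Lemma l2_repP f k : l2_fun (l2_rep (rp2_P q) f) k = (q ^+ (4 * k))%:C%C * l2_fun f k.
Proof.
have h := sphere_lift_hom l2_relators.
rewrite /l2_rep [l2_sphere_hom _](star_homX 2 h) -/l2_sphere_hom l2_hom_A /=.
by rewrite mulrA -rmorphM -expr2 diag_weight_sqr.
Qed.

Lemma l2_repT f k : l2_fun (l2_rep (rp2_T q) f) k =
  (q ^+ (2 * k) * shift_weight k.+1)%:C%C * l2_fun f k.+1.
Proof.
have [_ hM _ _] := sphere_lift_hom l2_relators.
rewrite /l2_rep [l2_sphere_hom _]hM -/l2_sphere_hom l2_hom_A l2_hom_B /=.
by rewrite mulrA -rmorphM.
Qed.

Lemma l2_repTs f k : l2_fun (l2_rep (star (rp2_T q)) f) k =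
  (q ^+ (2 * k.-1) * shift_weight k)%:C%C * l2_fun f k.-1.
Proof.
have [_ hM _ hS] := sphere_lift_hom l2_relators.
rewrite /l2_rep [l2_sphere_hom _]hS hM -/l2_sphere_hom l2_hom_A l2_hom_B /=.
by rewrite mulrA -rmorphM [_ * shift_weight k]mulrC.
Qed.

Lemma l2_repR f k : l2_fun (l2_rep (rp2_R q) f) k =
  (shift_weight k.+1 * shift_weight k.+2)%:C%C * l2_fun f k.+2.
Proof.
have h := sphere_lift_hom l2_relators.
rewrite /l2_rep [l2_sphere_hom _](star_homX 2 h) -/l2_sphere_hom l2_hom_B /=.
by rewrite mulrA -rmorphM.
Qed.

Lemma l2_repRs f k : l2_fun (l2_rep (star (rp2_R q)) f) k =
  (shift_weight k * shift_weight k.-1)%:C%C * l2_fun f k.-2.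
Proof.
have h := sphere_lift_hom l2_relators; have [_ _ _ hS] := h.
rewrite /l2_rep [l2_sphere_hom _]hS (star_homX 2 h) -/l2_sphere_hom l2_hom_B /=.
by rewrite mulrA -rmorphM.
Qed.

Lemma l2_rep_infty : rp2_rep_infty (l2_basis R) l2_rep.
Proof.
split.
- move=> k; apply: l2_ext => j; rewrite l2_repP l2_coordZ !l2_basisE.
  by case: eqP => [->|_] //; rewrite !mulr0.
- by apply: l2_ext => j; rewrite l2_repT l2_coord0 l2_basisE mulr0.
- move=> [//|k] _; apply: l2_ext => j.
  rewrite l2_repT l2_coordZ !l2_basisE eqSS subn1 /=.
  by case: eqP => [->|_] //; rewrite !mulr0.
- move=> k; apply: l2_ext => -[|j]; rewrite l2_repTs l2_coordZ !l2_basisE /= addn1.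
    by rewrite shift_weight0 mulr0 mul0r mulr0.
  by rewrite eqSS; case: eqP => [->|_] //; rewrite !mulr0.
- by apply: l2_ext => j; rewrite l2_repR l2_coord0 l2_basisE mulr0.
- by apply: l2_ext => j; rewrite l2_repR l2_coord0 l2_basisE mulr0.
- move=> [|[|k]] // _; apply: l2_ext => j.
  rewrite l2_repR l2_coordZ !l2_basisE !eqSS subn2 subn1 /=.
  by case: eqP => [->|_]; rewrite ?mulr0 // [shift_weight _ * _]mulrC.
- move=> k; apply: l2_ext => -[|[|j]];
    rewrite l2_repRs l2_coordZ !l2_basisE /= addn1 addn2.
  + by rewrite shift_weight0 mul0r mul0r mulr0.
  + by rewrite shift_weight0 mulr0 mul0r mulr0.
  rewrite !eqSS; case: eqP => [->|_]; rewrite ?mulr0 //.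
  by rewrite [shift_weight _ * _]mulrC.
Qed.

End WeightedShifts.

Section Subspaces.
Variables (R : realType) (H : hilbertType R[i]) (V : set H).
Local Notation C := R[i].
Hypothesis V_sub : linear_subspace V.

Lemma subspaceZ (c : C) u : V u -> V (c *: u).
Proof. by move=> Vu; rewrite -[_ *: _]addr0; case: V_sub => V0; apply. Qed.

Lemma subspaceD u v : V u -> V v -> V (u + v).
Proof. by move=> Vu Vv; rewrite -[u]scale1r; case: V_sub => _; apply. Qed.

Lemma subspace_sum n (F : 'I_n -> H) : (forall k, V (F k)) -> V (\sum_(k < n) F k).
Proof. by move=> VF; elim/big_ind: _ => //; [case: V_sub|exact: subspaceD]. Qed.

Lemma subspaceZ_inv (c : C) u : c != 0 -> V (c *: u) -> V u.
Proof. by move=> c0 /(subspaceZ c^-1); rewrite scalerA mulVf // scale1r. Qed.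

Lemma subspace_eq0 : (forall v, V v -> v = 0) -> V = [set 0].
Proof.
move=> h; apply/seteqP; split => v /=; first exact: h.
by move=> ->; case: V_sub.
Qed.
End Subspaces.

Lemma dotp_cvg_const (R : realType) (H : hilbertType R[i]) (u : nat -> H) v w c :
  u @ \oo --> v -> (forall n, dotp (u n) w = c) -> dotp v w = c.
Proof.
move=> uv uc.
have h z (a : R) : (forall n, rdot dotp (u n) z = a) -> rdot dotp v z = a.
  move=> uz; have := cvg_ip (w := z) uv; rewrite (_ : (fun n => _) = cst a).
    by move=> vz; exact: (cvg_unique (@Rhausdorff R) vz (cvg_cst _)).
  by apply: funext => n; exact: uz.
rewrite form_rdot (h w (complex.Re c)) => [|n]; last by rewrite /rdot uc.
rewrite (h _ (complex.Im c)) => [|n]; first by case: c {uc h}.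
by rewrite /rdot linearZr_LR /= uc; case: c {uc} => a b /=; rewrite mul0r sub0r mulNr mul1r opprK.
Qed.

Lemma closed_total (R : realType) (H : hilbertType R[i]) (V : set H) (e : nat -> H) :
  orthonormal_basis e -> linear_subspace V -> closed V -> (forall k, V (e k)) -> V = setT.
Proof.
move=> [_ /denseP de] Vs Vc Ve; apply/seteqP; split => // v _.
apply: closed_approx => // r r0; have [u [n [c ->]] uv] := de v r r0.
by exists (\sum_(k < n) c k *: e k) => //; apply: subspace_sum => // k; apply: subspaceZ.
Qed.

Section L2Irreducible.
Variables (R : realType) (q : R).
Hypotheses (q_neq0 : 0 < `|q|) (q_lt1 : `|q| < 1).
Local Notation C := R[i].
Local Notation H := (l2 R).
Local Notation rho := (l2_rep q_neq0 q_lt1).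

Let rho_rep := l2_rep_star q_neq0 q_lt1.

Lemma q_expn_neq0 n : q ^+ n != 0.
Proof. by rewrite expf_neq0 // -normr_gt0. Qed.

Lemma real_complex_neq0 (a : R) : a != 0 -> (a%:C%C : C) != 0.
Proof. by move=> a0; rewrite eq_complex /= (negPf a0). Qed.

(** The eigenvalue of P at the k-th basis vector is 1 only for k = 0. *)
Lemma l2_fixedE f : rho (rp2_P q) f = f -> f = l2_fun f 0%N *: l2_basis R 0.
Proof.
move=> Pf; apply: l2_ext => -[|k]; rewrite l2_coordZ l2_basisE ?mulr1 // mulr0.
have := congr1 (fun g : H => l2_fun g k.+1) Pf; rewrite l2_repP => /eqP.
rewrite -subr_eq0 -{2}[l2_fun f _]mul1r -mulrBl mulf_eq0 => /orP[|/eqP //].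
rewrite -(rmorph1 (real_complex R)) -rmorphB => /eqP /(congr1 (@complex.Re R)) /= /eqP.
rewrite subr_eq0 mulnS exprD => /eqP h; exfalso.
have x0 := q4_gt0 q_neq0; have x1 := q4_lt1 q_neq0 q_lt1.
have := ler_piMr (ltW x0) (q4X_le1 q_neq0 q_lt1 k).
by rewrite h leNgt x1.
Qed.

Lemma l2_coord_cvg (u : nat -> H) v k (c : C) :
  u @ \oo --> v -> (forall n, l2_fun (u n) k = c) -> l2_fun v k = c.
Proof.
move=> uv uc; rewrite -coef_l2_basis; apply: (dotp_cvg_const uv) => n.
by rewrite coef_l2_basis.
Qed.

Section InvariantSubspace.
Variable V : set H.
Hypotheses (V_sub : linear_subspace V) (V_closed : closed V).
Hypothesis V_inv : forall a f, V f -> V (rho a f).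

(** T maps the basis vector k.+1 to a nonzero multiple of the basis vector k. *)
Lemma lower_coordinate k f : V f -> l2_fun f k != 0 -> exists2 g, V g & l2_fun g 0%N != 0.
Proof.
elim: k f => [|k IHk] f Vf fk; first by exists f.
apply: (IHk (rho (rp2_T q) f)); first exact: V_inv.
rewrite l2_repT mulf_neq0 // real_complex_neq0 // mulf_neq0 ?q_expn_neq0 //.
by rewrite gt_eqF // shift_weight_gt0.
Qed.

Lemma invariant_basis0 f : V f -> f <> 0 -> V (l2_basis R 0).
Proof.
move=> Vf f0; have [k fk] : exists k, l2_fun f k != 0.
  apply: contrapT => h; apply: f0; apply: l2_ext => k.
  by apply/eqP; apply: contrapT => /negP fk; apply: h; exists k.
have [g Vg g0] := lower_coordinate Vf fk.
have [w cw Pw] := powers_cvg rho_rep q_neq0 g.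
have Vw : V w.
  by apply: cvg_closed cw => //; elim=> [|n IHn] //; rewrite iterS; exact: V_inv.
have w0 : l2_fun w 0%N = l2_fun g 0%N.
  apply: l2_coord_cvg cw _; elim=> [|n IHn] //.
  by rewrite iterS l2_repP muln0 expr0 mul1r.
by move: Vw; rewrite (l2_fixedE Pw) w0; exact: subspaceZ_inv.
Qed.

Lemma invariant_basis k : V (l2_basis R 0) -> V (l2_basis R k).
Proof.
move=> V0; elim: k => // k /(V_inv (star (rp2_T q))).
rewrite (rho_Tstar (l2_rep_infty q_neq0 q_lt1)) addn1; apply: subspaceZ_inv => //.
rewrite real_complex_neq0 // mulf_neq0 ?q_expn_neq0 //.
by have := shift_weight_gt0 q_neq0 q_lt1 k; rewrite /shift_weight => /lt0r_neq0.
Qed.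
End InvariantSubspace.

Lemma l2_irreducible : irreducible_star_rep rho.
Proof.
split; first by split => // a; exact: rep_bounded_on rho_rep q_neq0 a.
  by exists (l2_basis R 0); exact: l2_basis_neq0.
move=> V Vs Vc Vi.
have [h|/existsNP[f /not_implyP[Vf f0]]] := pselect (forall v, V v -> v = 0).
  by left; exact: subspace_eq0.
right; apply: (closed_total (@l2_orthonormal_basis R)) => // k.
by apply: invariant_basis => //; exact: invariant_basis0 Vf f0.
Qed.

End L2Irreducible.

(** * The one-dimensional representations *)

Section Characters.
Variables (R : realType) (q : R).
Local Notation C := R[i].

Definition expi (t : R) : C := (cos t +i* sin t)%C.

Lemma expi_conj t : expi t * (expi t)^* = 1.
Proof.
apply/eqP; rewrite eq_complex /expi /=; have := cos2Dsin2 t => h.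
by apply/andP; split; apply/eqP; [rewrite -h|]; ring.
Qed.

Lemma expiD s t : expi (s + t) = expi s * expi t.
Proof. by rewrite /expi cosD sinD; apply/eqP; rewrite eq_complex /= eqxx addrC eqxx. Qed.

Lemma expi_half t : expi (t / 2) ^+ 2 = expi t.
Proof. by rewrite expr2 -expiD; congr expi; field. Qed.

(** In dimension one A = 0 and B is a complex number of modulus 1; since R = B^2,
    the angle is halved. *)
Lemma char_relators t : all (pred1 0) (sphere_relators q (0 : C^o) (expi (t / 2) : C^o)).
Proof.
apply/sphere_relatorsP; split.
- exact: star0.
- by rewrite mulr0 mul0r scaler0.
- by rewrite expr0n oppr0 add0r -(expi_conj (t / 2)) mulrC.
- by rewrite expr0n /= scaler0 oppr0 add0r -(expi_conj (t / 2)).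
Qed.

Definition character t (a : rp2_alg q) : C :=
  sphere_lift (0 : C^o) (expi (t / 2) : C^o) (rp2_val a).

Lemma characterL t (c : C) a b : character t (c *: a + b) = c * character t a + character t b.
Proof.
by have [h _ _ _] := sphere_lift_hom (char_relators t); exact: (h c (rp2_val a) (rp2_val b)).
Qed.
Lemma characterM t a b : character t (a * b) = character t a * character t b.
Proof.
by have [_ h _ _] := sphere_lift_hom (char_relators t); exact: (h (rp2_val a) (rp2_val b)).
Qed.
Lemma character1 t : character t 1 = 1.
Proof. by have [_ _ h _] := sphere_lift_hom (char_relators t); exact: h. Qed.
Lemma character_star t a : character t (star a) = (character t a)^*.
Proof. by have [_ _ _ h] := sphere_lift_hom (char_relators t); exact: h. Qed.
Lemma characterP t : character t (rp2_P q) = 0.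
Proof.
have h := sphere_lift_hom (char_relators t).
by rewrite /character (star_homX 2 h) (sphere_liftA (char_relators t)) expr0n.
Qed.
Lemma characterT t : character t (rp2_T q) = 0.
Proof.
have [_ h _ _] := sphere_lift_hom (char_relators t).
by rewrite /character h (sphere_liftA (char_relators t)) mul0r.
Qed.
Lemma characterR t : character t (rp2_R q) = expi t.
Proof.
have h := sphere_lift_hom (char_relators t).
by rewrite /character (star_homX 2 h) (sphere_liftB (char_relators t)) expi_half.
Qed.

Definition theta_rep t (a : rp2_alg q) (z : complex_line R) : complex_line R :=
  character t a *: z.

Lemma complex_lineE (x y : complex_line R) : dotp x y = (x : C) * (y : C)^*.
Proof. by []. Qed.

Lemma theta_rep_star t : is_star_rep setT (theta_rep t).
Proof.
split => //.
- by rewrite /dense => O O0 _; rewrite setIT.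
- by move=> a c x y _ _; rewrite /theta_rep scalerDr !scalerA mulrC.
- by move=> c a b x _; rewrite /theta_rep characterL scalerDl scalerA.
- by move=> x _; rewrite /theta_rep character1 scale1r.
- by move=> a b x _; rewrite /theta_rep characterM scalerA.
- move=> a x y _ _; rewrite /theta_rep character_star linearZl_LR linearZr_LR /=.
  by rewrite conjCK.
Qed.

Lemma theta_rep_irreducible t : 0 < `|q| -> irreducible_star_rep (theta_rep t).
Proof.
move=> q0; split.
- split; first exact: theta_rep_star.
  by move=> a; exact: rep_bounded_on (theta_rep_star t) q0 a.
- by exists (1 : C); exact: oner_neq0.
move=> V Vs Vc Vi.
have [h|/existsNP[f /not_implyP[Vf /eqP f0]]] := pselect (forall v, V v -> v = 0).
  by left; exact: subspace_eq0.
right; apply/seteqP; split => // z _.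
have -> : z = ((z : C) / (f : C)) *: f.
  by change (z = (z : C) / (f : C) * f :> C); rewrite mulfVK.
exact: subspaceZ.
Qed.

Lemma theta_rep_values t : rp2_rep_theta t (theta_rep t).
Proof.
by move=> z; rewrite /theta_rep characterP characterT characterR !scale0r.
Qed.

End Characters.

(** * Irreducible representations with nonzero P *)

Section Intertwining.
Variables (R : realType) (q : R) (K : hilbertType R[i]).
Hypotheses (q_neq0 : 0 < `|q|) (q_lt1 : `|q| < 1).
Variables (sigma : rp2_alg q -> K -> K) (e : nat -> K).
Hypotheses (sigma_rep : is_star_rep setT sigma) (e_basis : orthonormal_basis e).
Hypothesis sigma_e : rp2_rep_infty e sigma.
Local Notation C := R[i].

Let e_on i j : dotp (e i) (e j) = (i == j)%:R. Proof. by case: e_basis. Qed.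

Let coef_adj a v k (c : R) m :
  sigma (star a) (e k) = c%:C%C *: e m -> coef e (sigma a v) k = c%:C%C * coef e v m.
Proof.
move=> h; rewrite /coef (rep_adjoint sigma_rep) // h linearZr_LR /=.
by rewrite conj_realC.
Qed.

(** The coefficient of the image of v at e k is the coefficient of v at the image
    of e k by the adjoint, so that the action on the basis decides everything. *)
Lemma basis_intertwining a v :
  coef_l2 e_on (sigma a v) = l2_rep q_neq0 q_lt1 a (coef_l2 e_on v).
Proof.
elim/rp2_ind: a v => [c a b IHa IHb|a b IHa IHb||||||] v.
- rewrite (rep_alg_linear sigma_rep) // (rep_alg_linear (l2_rep_star q_neq0 q_lt1)) //.
  by rewrite -IHa -IHb coef_l2_linear.
- by rewrite (rep_mul sigma_rep) // (rep_mul (l2_rep_star q_neq0 q_lt1)) // -IHb -IHa.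
- by rewrite (rep_one sigma_rep) // (rep_one (l2_rep_star q_neq0 q_lt1)).
- apply: l2_ext => k; rewrite l2_repP; apply: coef_adj.
  by rewrite rp2_star_P (rho_P sigma_e).
- apply: l2_ext => k; rewrite l2_repT; apply: coef_adj.
  by rewrite (rho_Tstar sigma_e) addn1.
- apply: l2_ext => k; rewrite l2_repTs; apply: coef_adj; rewrite starK.
  case: k => [|k]; first by rewrite (rho_T0 sigma_e) shift_weight0 mulr0 scale0r.
  by rewrite (rho_T sigma_e) // subn1.
- apply: l2_ext => k; rewrite l2_repR; apply: coef_adj.
  by rewrite (rho_Rstar sigma_e) addn1 addn2.
apply: l2_ext => k; rewrite l2_repRs; apply: coef_adj; rewrite starK.
case: k => [|[|k]].
- by rewrite (rho_R0 sigma_e) shift_weight0 mul0r scale0r.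
- by rewrite (rho_R1 sigma_e) shift_weight0 mulr0 scale0r.
by rewrite (rho_R sigma_e) // subn1 subn2.
Qed.

Lemma basis_unitarily_equivalent : unitarily_equivalent sigma (l2_rep q_neq0 q_lt1).
Proof.
have [_ e_tot] := e_basis.
exists (coef_l2 e_on : {linear K -> l2 R}); split.
- exact: coef_l2_bijective.
- exact: dotp_coef_l2.
- exact: basis_intertwining.
Qed.
End Intertwining.

Section Ladder.
Variables (R : realType) (q : R) (K : hilbertType R[i]).
Hypotheses (q_neq0 : 0 < `|q|) (q_lt1 : `|q| < 1).
Variable sigma : rp2_alg q -> K -> K.
Hypothesis sigma_rep : is_star_rep setT sigma.
Variable e0 : K.
Local Notation C := R[i].
Local Notation P := (sigma (rp2_P q)).
Local Notation T := (sigma (rp2_T q)).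
Local Notation Ts := (sigma (star (rp2_T q))).
Local Notation Rr := (sigma (rp2_R q)).
Local Notation Rs := (sigma (star (rp2_R q))).
Local Notation sq := (nsq (@dotp C K)).
Local Notation s := (shift_weight q).
Hypotheses (e0_unit : sq e0 = 1) (e0_fixed : P e0 = e0).

Definition ladder_weight k : R := q ^+ (2 * k) * s k.+1.
Local Notation w := ladder_weight.

Lemma ladder_weight_neq0 k : w k != 0.
Proof. by rewrite mulf_neq0 ?q_expn_neq0 // gt_eqF // shift_weight_gt0. Qed.

Lemma ladder_weight_sqr k : w k ^+ 2 = q ^+ (4 * k) - q ^+ 4 * q ^+ (4 * k) ^+ 2.
Proof.
rewrite exprMn -/(diag_weight q k) diag_weight_sqr shift_weight_sqr // mulnS exprD.
by ring.
Qed.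

(** Division by the norm of the image by T^* keeps the ladder normalized. *)
Fixpoint ladder k : K :=
  if k is k'.+1 then ((w k')^-1)%:C%C *: Ts (ladder k') else e0.

Let sL a := rep_op_linear sigma_rep a.

Lemma ladderTs k : Ts (ladder k) = (w k)%:C%C *: ladder k.+1.
Proof. by rewrite /= scalerA -rmorphM divff ?ladder_weight_neq0 // scale1r. Qed.

Lemma ladderP k : P (ladder k) = (q ^+ (4 * k))%:C%C *: ladder k.
Proof.
elim: k => [|k IHk]; first by rewrite muln0 expr0 scale1r.
rewrite [ladder _]/= (linopZ (sL _)) (rep_P_Ts sigma_rep) // IHk (linopZ (sL _)).
by rewrite !scalerA -!rmorphM mulnS exprD; congr (_%:C%C *: _); ring.
Qed.

Lemma ladderT0 : T (ladder 0) = 0.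
Proof.
apply: (@nsq_eq0 _ _ dotp); apply: (mulfI (lt0r_neq0 (q4_gt0 q_neq0))).
by rewrite (nsq_T sigma_rep) // /= e0_fixed mulr0 subrr.
Qed.

Lemma ladderT k : T (ladder k.+1) = (w k)%:C%C *: ladder k.
Proof.
rewrite [ladder _]/= (linopZ (sL _)) -(rep_mul sigma_rep) // rp2_T_starT.
rewrite !(repE sigma_rep) // ladderP (linopZ (sL _)) ladderP !scalerA -!rmorphM.
rewrite -scalerBl scalerA -rmorphB -rmorphM; congr (_%:C%C *: _).
rewrite [X in _ * X](_ : _ = w k * w k) ?mulKf ?ladder_weight_neq0 //.
by rewrite -[RHS]expr2 ladder_weight_sqr; ring.
Qed.

Lemma ladder_unit k : sq (ladder k) = 1.
Proof.
elim: k => [|k IHk] //=; rewrite nsqZr (nsq_Ts sigma_rep) // ladderP nsqZr.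
rewrite rdotZl -/(nsq _ _) IHk !mulr1 -ladder_weight_sqr -exprMn mulVf ?expr1n //.
exact: ladder_weight_neq0.
Qed.

Lemma ladder_eigenvalue_inj i j : q ^+ (4 * i) = q ^+ (4 * j) -> i = j.
Proof.
have x0 := q4_gt0 q_neq0; have x1 := q4_lt1 q_neq0 q_lt1.
by rewrite !exprM; apply: (ieexprIn x0); rewrite lt_eqF.
Qed.

Lemma ladder_orthonormal i j : dotp (ladder i) (ladder j) = (i == j)%:R.
Proof.
case: eqVneq => [->|ij]; first by rewrite nsqC ladder_unit.
have := rep_adjoint sigma_rep (rp2_P q) (I : setT (ladder i)) (I : setT (ladder j)).
rewrite rp2_star_P !ladderP linearZl_LR linearZr_LR /= conj_realC => /eqP.
rewrite -subr_eq0 -mulrBl mulf_eq0 => /orP[|/eqP //].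
rewrite -rmorphB => /eqP /(congr1 (@complex.Re R)) /= /eqP.
by rewrite subr_eq0 => /eqP /ladder_eigenvalue_inj /eqP; rewrite (negPf ij).
Qed.

(** From T^2 = q^2 P R and R P = x^2 P R. *)
Lemma ladder_Rr k : (q ^+ (4 * k) * q ^+ 2)%:C%C *: Rr (ladder k) =
  (q ^+ 8)%:C%C *: T (T (ladder k)).
Proof.
rewrite (rep_T_T sigma_rep) // rmorphM mulrC -scalerA -(linopZ (sL _)) -ladderP.
rewrite (rep_R_P sigma_rep) // !scalerA -!rmorphM; congr (_%:C%C *: _).
by rewrite -!exprM -!exprD.
Qed.

Lemma ladder_rep_infty : rp2_rep_infty ladder sigma.
Proof.
have c0 k : ((q ^+ (4 * k) * q ^+ 2)%:C%C : C) != 0.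
  by rewrite real_complex_neq0 // mulf_neq0 ?q_expn_neq0.
split.
- exact: ladderP.
- exact: ladderT0.
- by case=> // k _; rewrite subn1 ladderT.
- by move=> k; rewrite addn1 ladderTs.
- apply: (scalerI (c0 0%N)).
  by rewrite ladder_Rr ladderT0 (linop0 (sL _)) !scaler0.
- apply: (scalerI (c0 1%N)).
  by rewrite ladder_Rr ladderT (linopZ (sL _)) ladderT0 !scaler0.
- case=> [|[|k]] // _; rewrite subn1 subn2; apply: (scalerI (c0 k.+2)).
  rewrite ladder_Rr ladderT (linopZ (sL _)) ladderT !scalerA -!rmorphM.
  congr (_%:C%C *: _); rewrite -/(s k.+1) -/(s k.+2) /ladder_weight.
  have -> : q ^+ (4 * k.+2) = q ^+ 8 * (q ^+ (2 * k) * q ^+ (2 * k)).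
    by rewrite -!exprD; congr (_ ^+ _); rewrite !mulnS -mulnDl !addnA.
  by rewrite mulnS exprD; ring.
- move=> k; rewrite addn1 addn2; apply: (scalerI (c0 k)).
  have := rep_Ts_Ts sigma_rep (I : setT (ladder k)).
  rewrite ladderP (linopZ (sL _)) ladderTs (linopZ (sL _)) ladderTs !scalerA -!rmorphM.
  rewrite [q ^+ 2 * _]mulrC => <-; congr (_%:C%C *: _).
  rewrite -/(s k.+1) -/(s k.+2) /ladder_weight mulnS exprD.
  have -> : q ^+ (4 * k) = q ^+ (2 * k) * q ^+ (2 * k) by rewrite -exprD -mulnDl.
  by ring.
Qed.

Definition ladder_span : set K :=
  [set x | exists (n : nat) (c : nat -> C), x = \sum_(k < n) c k *: ladder k].

Lemma ladder_span_subspace : linear_subspace ladder_span.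
Proof.
split=> [|a u v [n [c ->]] [m [d ->]]]; first by exists 0%N, (fun=> 0); rewrite big_ord0.
(* Two combinations are added after padding their coefficients by 0. *)
have pad (b : nat -> C) p r : (p <= r)%N -> \sum_(k < p) b k *: ladder k =
    \sum_(k < r) (if (k < p)%N then b k else 0) *: ladder k.
  move=> pr; rewrite (big_ord_widen_cond _ predT (fun k => b k *: ladder k) pr) big_mkcond.
  by apply: eq_bigr => k _ /=; case: ifP => // _; rewrite scale0r.
exists (n + m)%N, (fun k => a * (if (k < n)%N then c k else 0) + if (k < m)%N then d k else 0).
rewrite (pad c n _ (leq_addr m n)) (pad d m _ (leq_addl n m)) scaler_sumr -big_split /=.
by apply: eq_bigr => k _; rewrite scalerDl scalerA.
Qed.

Lemma ladder_in_span k : ladder_span (ladder k).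
Proof.
exists k.+1, (fun j => (j == k)%:R); rewrite big_ord_recr /= eqxx scale1r big1 ?add0r //.
by move=> j _; rewrite ltn_eqF // scale0r.
Qed.

Lemma ladder_span_stable a v : ladder_span v -> ladder_span (sigma a v).
Proof.
have sub := ladder_span_subspace; have lr := ladder_rep_infty.
have gen b : (forall k, ladder_span (sigma b (ladder k))) ->
    forall v, ladder_span v -> ladder_span (sigma b v).
  move=> hb _ [n [c ->]]; rewrite (linop_sum (sL _)); apply: subspace_sum => // k.
  by rewrite (linopZ (sL _)); apply: subspaceZ.
have Z c k : ladder_span (c *: ladder k) by apply: subspaceZ => //; exact: ladder_in_span.
have S0 : ladder_span 0 by case: sub.
elim/rp2_ind: a v => [c a b IHa IHb v Sv|a b IHa IHb v Sv|v Sv|||||].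
- by rewrite (rep_alg_linear sigma_rep) //; apply: sub.2; [exact: IHa|exact: IHb].
- by rewrite (rep_mul sigma_rep) //; apply: IHa; exact: IHb.
- by rewrite (rep_one sigma_rep).
- by apply: gen => k; rewrite (rho_P lr).
- by apply: gen => -[|k]; [rewrite (rho_T0 lr)|rewrite (rho_T lr)].
- by apply: gen => k; rewrite (rho_Tstar lr).
- by apply: gen => -[|[|k]]; [rewrite (rho_R0 lr)|rewrite (rho_R1 lr)|rewrite (rho_R lr)].
- by apply: gen => k; rewrite (rho_Rstar lr).
Qed.

(** The closed span of the ladder is invariant and not 0, hence everything. *)
Lemma ladder_basis : irreducible_star_rep sigma -> orthonormal_basis ladder.
Proof.
move=> [_ _ irr]; split; first exact: ladder_orthonormal.
have [||a v Sv|h|h] := irr (closure ladder_span).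
- exact: closure_subspace ladder_span_subspace.
- exact: closed_closure.
- apply: closure_stable Sv; [exact: sL|exact: rep_op_bounded sigma_rep q_neq0 a|].
  exact: ladder_span_stable.
- have : closure ladder_span e0 by apply: subset_closure; exact: (ladder_in_span 0).
  rewrite h => /= e00; move: e0_unit; rewrite e00 nsq0 => /esym/eqP.
  by rewrite oner_eq0.
apply/denseP => v; apply/closureP.
by rewrite -/ladder_span h.
Qed.

End Ladder.

Lemma irreducible_P_neq0 (R : realType) (q : R) (q_neq0 : 0 < `|q|) (q_lt1 : `|q| < 1)
    (K : hilbertType R[i]) (sigma : rp2_alg q -> K -> K) :
  irreducible_star_rep sigma -> (exists v, sigma (rp2_P q) v <> 0) ->
  unitarily_equivalent sigma (l2_rep q_neq0 q_lt1).
Proof.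
move=> irr hP; have [[sigma_rep _] _ _] := irr.
have [w w0 Pw] := exists_fixed_vector sigma_rep q_neq0 q_lt1 hP.
have n0 : 0 < nsq dotp w.
  rewrite lt_def nsq_ge0 andbT; apply: contra w0 => /eqP w0.
  by apply/eqP; exact: nsq_eq0 w0.
pose e0 := ((Num.sqrt (nsq dotp w))^-1)%:C%C *: w.
have e0_unit : nsq dotp e0 = 1.
  by rewrite nsqZr exprVn sqr_sqrtr ?nsq_ge0 // mulVf // lt0r_neq0.
have e0_fixed : sigma (rp2_P q) e0 = e0.
  by rewrite (linopZ (rep_op_linear sigma_rep _)) Pw.
exact: (basis_unitarily_equivalent q_neq0 q_lt1 sigma_rep
  (ladder_basis q_neq0 q_lt1 sigma_rep e0_unit e0_fixed irr)
  (ladder_rep_infty q_neq0 q_lt1 sigma_rep e0_fixed)).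
Qed.

(** * A form of Schur's lemma *)

Section SquareRoot.
Variables (R : realType) (H : hilbertType R[i]).
Local Notation C := R[i].
Local Notation ip := (rdot (@dotp C H)).
Local Notation sq := (nsq (@dotp C H)).
Implicit Types (u v w : H) (S Z : H -> H).

Definition self_adjoint S := forall u v, ip (S u) v = ip u (S v).

Definition commuting S Z := forall v, S (Z v) = Z (S v).

Let N v : R := Num.sqrt (sq v).

Lemma hnorm_ge0 v : 0 <= N v. Proof. exact: sqrtr_ge0. Qed.

Lemma hnormD_le u v : N (u + v) <= N u + N v. Proof. exact: sqrt_nsqD. Qed.

Lemma hnormZ_real (a : R) v : 0 <= a -> N (a%:C%C *: v) = a * N v.
Proof. by move=> a0; rewrite /N nsqZr sqrtrM ?sqr_ge0 // sqrtr_sqr ger0_norm. Qed.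

Lemma hnorm_sqr v : N v ^+ 2 = sq v.
Proof. by rewrite sqr_sqrtr ?nsq_ge0. Qed.

Lemma hnorm_le u v : sq u <= sq v -> N u <= N v.
Proof. exact: ler_wsqrtr. Qed.

Variable S : H -> H.
Hypotheses (S_lin : linear_op S) (S_sa : self_adjoint S).
Hypothesis S_contraction : forall v, sq (S v) <= sq v.

Definition defect v := v - S (S v).

Fixpoint sqrt_scalar n : R := if n is m.+1 then (1 + sqrt_scalar m ^+ 2) / 2 else 0.
Local Notation y := sqrt_scalar.

(** The iterates Y of t = (X + t^2) / 2 increase to 1 - |S|, where X = 1 - S^2;
    the same iteration for X = 1 bounds all increments. *)
Fixpoint sqrt_iter n v : H :=
  if n is m.+1 then (2^-1)%:C%C *: (defect v + sqrt_iter m (sqrt_iter m v)) else 0.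
Local Notation Y := sqrt_iter.

Lemma sqrt_scalar_bounds n : 0 <= y n <= 1.
Proof. elim: n => [|n /andP[h1 h2]] /=; first by rewrite lexx ler01. by apply/andP; nra. Qed.

Lemma sqrt_scalarS n : y n <= y n.+1.
Proof. by have := sqr_ge0 (y n - 1); rewrite /=; nra. Qed.

Lemma sqrt_scalar_mono m n : (m <= n)%N -> y m <= y n.
Proof.
elim: n => [|n IHn]; first by rewrite leqn0 => /eqP ->.
rewrite leq_eqVlt => /predU1P[-> //|]; rewrite ltnS => /IHn h.
exact: le_trans h (sqrt_scalarS n).
Qed.

Lemma defect_linear : linear_op defect.
Proof.
move=> c u v; rewrite /defect !S_lin scalerBr opprD.
exact: addrACA.
Qed.

Lemma defect_contraction v : sq (defect v) <= sq v.
Proof.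
rewrite /defect nsqB -S_sa -/(nsq _ (S v)).
by have := S_contraction (S v); have := nsq_ge0 dotp (S v); lra.
Qed.

Lemma sqrt_iter_linear n : linear_op (Y n).
Proof.
elim: n => [|n IHn] c u v /=; first by rewrite scaler0 addr0.
rewrite !IHn defect_linear scalerA mulrC -scalerA -scalerDr; congr (_ *: _).
by rewrite (scalerDr c (defect u)) addrACA.
Qed.

Lemma sqrt_iter_comm Z : linear_op Z -> commuting Z S ->
  forall n, commuting Z (Y n).
Proof.
move=> Zl ZS; elim=> [|n IHn] v /=; first exact: linop0 Zl.
by rewrite (linopZ Zl) (linopD Zl) /defect (linopB Zl) !ZS !IHn.
Qed.

Lemma sqrt_iter_bound n v : N (Y n v) <= y n * N v.
Proof.
have v0 := hnorm_ge0.
elim: n v => [|n IHn] v /=; first by rewrite mul0r /N nsq0 sqrtr0.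
rewrite hnormZ_real ?invr_ge0 //.
have h1 := hnormD_le (defect v) (Y n (Y n v)).
have h2 := hnorm_le (defect_contraction v).
have /andP[y0 y1] := sqrt_scalar_bounds n.
have h3 := le_trans (IHn (Y n v)) (ler_wpM2l y0 (IHn v)).
by lra.
Qed.

Lemma sqrt_iter_increment n v : N (Y n.+1 v - Y n v) <= (y n.+1 - y n) * N v.
Proof.
elim: n v => [|n IHn] v.
  have := sqrt_iter_bound 1 v; rewrite [Y 0 v]/= [y 0]/= !subr0.
  by [].
have eY : Y n.+2 v - Y n.+1 v = (2^-1)%:C%C *:
    (Y n.+1 (Y n.+1 v - Y n v) + (Y n.+1 (Y n v) - Y n (Y n v))).
  transitivity ((2^-1)%:C%C *: (defect v + Y n.+1 (Y n.+1 v)) -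
    (2^-1)%:C%C *: (defect v + Y n (Y n v))) => //.
  rewrite -scalerBr (linopB (sqrt_iter_linear n.+1)); congr (_ *: _).
  move: (Y n.+1 (Y n.+1 v)) (Y n.+1 (Y n v)) (Y n (Y n v)) => a b c.
  by rewrite opprD addrACA subrr add0r [RHS]addrA subrK.
have /andP[y0 y1] := sqrt_scalar_bounds n; have yS := sqrt_scalarS n.
have yn0 : 0 <= y n.+1 by have /andP[] := sqrt_scalar_bounds n.+1.
have d0 : 0 <= y n.+1 - y n by rewrite subr_ge0.
rewrite eY hnormZ_real ?invr_ge0 //.
have h1 := hnormD_le (Y n.+1 (Y n.+1 v - Y n v)) (Y n.+1 (Y n v) - Y n (Y n v)).
have h2 := le_trans (sqrt_iter_bound n.+1 _) (ler_wpM2l yn0 (IHn v)).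
have h3 := le_trans (IHn (Y n v)) (ler_wpM2l d0 (sqrt_iter_bound n v)).
have key (a b c : R) : b = (1 + a ^+ 2) / 2 -> c = (1 + b ^+ 2) / 2 ->
    c - b = (b - a) * (b + a) / 2.
  by move=> hb hc; rewrite !mulrDr mulrBl; lra.
rewrite {eY IHn} (key (y n)) //.
move: h1 h2 h3; set a := N _; set b := N _; set c := N _; set d := N v => h1 h2 h3.
by lra.
Qed.

Lemma sqrt_iter_dist m n v : (m <= n)%N -> N (Y n v - Y m v) <= (y n - y m) * N v.
Proof.
elim: n => [|n IHn]; first by rewrite leqn0 => /eqP ->; rewrite !subrr /N nsq0 sqrtr0 mul0r.
rewrite leq_eqVlt => /predU1P[->|]; first by rewrite !subrr /N nsq0 sqrtr0 mul0r.
rewrite ltnS => /IHn h; have := sqrt_iter_increment n v.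
have := hnormD_le (Y n.+1 v - Y n v) (Y n v - Y m v).
rewrite addrA subrK; lra.
Qed.

Lemma sqrt_iter_cvg v : exists w, (fun n => Y n v) @ \oo --> w.
Proof.
apply: (@cvg_of_increments _ _ _ (fun n => y n * sq v) (sq v)) => [n|m n mn].
  by rewrite ler_piMl ?nsq_ge0 //; case/andP: (sqrt_scalar_bounds n).
rewrite -mulrBl -!hnorm_sqr.
have := sqrt_iter_dist v mn; have := sqrt_scalar_mono mn.
have /andP[_] := sqrt_scalar_bounds n; have /andP[+ _] := sqrt_scalar_bounds m.
have := hnorm_ge0 v; have := hnorm_ge0 (Y n v - Y m v).
set a := N _; set b := N _ => a0 b0 ym0 yn1 ymn h.
have d0 : 0 <= y n - y m by rewrite subr_ge0.
have d1 : y n - y m <= 1 by lra.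
apply: (@le_trans _ _ (((y n - y m) * b) ^+ 2)).
  by rewrite ler_pXn2r ?nnegrE // mulr_ge0.
by rewrite exprMn ler_wpM2r ?sqr_ge0 // expr2 ler_piMl.
Qed.

End SquareRoot.

Section AbsoluteValue.
Variables (R : realType) (H : hilbertType R[i]).
Local Notation C := R[i].
Local Notation ip := (rdot (@dotp C H)).
Local Notation sq := (nsq (@dotp C H)).
Implicit Types (u v w : H) (Z : H -> H).
Variable S : H -> H.
Hypotheses (S_lin : linear_op S) (S_sa : self_adjoint S).
Hypothesis S_contraction : forall v, sq (S v) <= sq v.
Local Notation Y := (sqrt_iter S).

Lemma sqrt_iter_nsq_le n v : sq (Y n v) <= sq v.
Proof.
have /andP[y0 y1] := sqrt_scalar_bounds R n.
have h : Num.sqrt (sq (Y n v)) <= Num.sqrt (sq v).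
  apply: le_trans (sqrt_iter_bound S_sa S_contraction n v) _.
  by rewrite ler_piMl ?sqrtr_ge0.
by rewrite -[leLHS]sqr_sqrtr ?nsq_ge0 // -[leRHS]sqr_sqrtr ?nsq_ge0 // ler_pXn2r ?nnegrE ?sqrtr_ge0.
Qed.

(** The iterates converge strongly to a solution L of L = (1 - S^2 + L^2) / 2,
    that is, of (1 - L)^2 = S^2; and L, a limit of operators built from S, commutes
    with what commutes with S. *)
Lemma exists_abs : exists G : H -> H,
  [/\ linear_op G, bounded_op G, forall v, 0 <= ip (G v) v,
      forall v, G (G v) = S (S v) &
      forall Z, linear_op Z -> bounded_op Z -> commuting Z S -> commuting Z G].
Proof.
have [L LY] := choice (sqrt_iter_cvg S_lin S_sa S_contraction).
have YL n := sqrt_iter_linear S_lin n.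
have L_le v : sq (L v) <= sq v.
  apply: (cvgr_to_le (cvg_nsq (LY v))); near=> n; exact: sqrt_iter_nsq_le.
have L_lin : linear_op L.
  move=> c u v; apply: (cvg_hilbert_unique (LY _)).
  rewrite (_ : (fun n => _) = fun n => c *: Y n u + Y n v); last first.
    by apply: funext => n; exact: YL.
  by apply: cvgD; [apply: cvgZr|]; exact: LY.
have L_bd : bounded_op L by exists 1 => // v; rewrite mul1r.
have L_comm Z : linear_op Z -> bounded_op Z -> commuting Z S -> commuting Z L.
  move=> Zl Zb ZS v; apply: (cvg_hilbert_unique (cvg_op Zl Zb (LY v))).
  rewrite (_ : (fun n => _) = fun n => Y n (Z v)); first exact: LY.
  by apply: funext => n; exact: sqrt_iter_comm.
have YY v : (fun n => Y n (Y n v)) @ \oo --> L (L v).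
  apply/cvg_nsqP.
  have h1 := (cvg_nsqP _ _).1 (LY v); have h2 := (cvg_nsqP _ _).1 (LY (L v)).
  have h : (fun n => 2 * sq (Y n v - L v) + 2 * sq (Y n (L v) - L (L v))) @ \oo --> (0 : R).
    have h := cvgD (cvgM (cvg_cst (2 : R)) h1) (cvgM (cvg_cst (2 : R)) h2).
    by rewrite mulr0 addr0 in h; exact: h.
  apply: (squeeze_cvgr _ (cvg_cst 0) h); near=> n.
  rewrite nsq_ge0 /=.
  have -> : Y n (Y n v) - L (L v) = Y n (Y n v - L v) + (Y n (L v) - L (L v)).
    by rewrite (linopB (YL n)) addrA subrK.
  apply: le_trans (nsqD_le _ _ _) _; rewrite lerD2r ler_wpM2l //.
  exact: sqrt_iter_nsq_le.
have L_eq v : L v = (2^-1)%:C%C *: (defect S v + L (L v)).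
  apply: (cvg_hilbert_unique (u := fun n => Y n.+1 v)).
    by rewrite (cvg_shiftS (fun n => Y n v)); exact: LY.
  apply: cvgZr; apply: cvgD; first exact: cvg_cst.
  exact: YY.
exists (fun v => v - L v); split.
- by move=> c u v; rewrite L_lin scalerBr opprD addrACA.
- exists 4 => // v; apply: le_trans (nsqD_le _ _ _) _; rewrite nsqN.
  by have := L_le v; lra.
- move=> v; rewrite rdotBl subr_ge0 -/(nsq _ v).
  have := L_le v; have := Cauchy_Schwarz dotp (L v) v; have := nsq_ge0 dotp v.
  have := nsq_ge0 dotp (L v).
  set a := sq _; set b := ip _ _; set c := sq _ => a0 c0 h ac.
  by have [//|cb] := leP b c; nra.
- move=> v; rewrite (linopB L_lin).
  have e : L v + L v = v - S (S v) + L (L v).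
    rewrite {1 2}(L_eq v) -scalerDl -rmorphD.
    have -> : 2^-1 + 2^-1 = 1 :> R by field.
    by rewrite rmorph1 scale1r.
  have -> : v - L v - (L v - L (L v)) = v - (L v + L v) + L (L v).
    by rewrite !opprD opprK !addrA.
  by rewrite e !opprD opprK !addrA subrr add0r subrK.
move=> Z Zl Zb ZS v.
by rewrite (linopB Zl) L_comm.
Unshelve. all: by end_near. Qed.

End AbsoluteValue.

Section Schur.
Variables (R : realType) (H : hilbertType R[i]) (A : Type) (rho : A -> H -> H).
Local Notation C := R[i].
Local Notation ip := (rdot (@dotp C H)).
Local Notation sq := (nsq (@dotp C H)).
Implicit Types u v w : H.
Hypotheses (rho_lin : forall a, linear_op (rho a)) (rho_bd : forall a, bounded_op (rho a)).
Hypothesis rho_irr : forall V : set H, linear_subspace V -> closed V ->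
  (forall a x, V x -> V (rho a x)) -> V = [set 0] \/ V = setT.

Lemma ker_dichotomy S : linear_op S -> bounded_op S ->
  (forall a, commuting (rho a) S) -> (forall v, S v = 0 -> v = 0) \/ (forall v, S v = 0).
Proof.
move=> Sl Sb Sc; have [|||h|h] := rho_irr (V := [set v | S v = 0]).
- split=> [|c u v /= Su Sv]; first exact: linop0 Sl.
  by rewrite Sl Su Sv scaler0 addr0.
- exact: closed_ker Sl Sb.
- by move=> a v /= Sv; rewrite -Sc Sv (linop0 (rho_lin a)).
- by left=> v Sv; have : [set v | S v = 0] v by []; rewrite h.
by right=> v; have : [set: H] v by []; rewrite -h.
Qed.

(** With G = |S| the product (G - S)(G + S) vanishes, and by irreducibility one
    of the factors does. *)
Lemma contraction_sign S : linear_op S -> self_adjoint S ->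
  (forall v, sq (S v) <= sq v) -> (forall a, commuting (rho a) S) ->
  (forall v, 0 <= ip (S v) v) \/ (forall v, ip (S v) v <= 0).
Proof.
move=> Sl Ssa S1 Sc.
have Sb : bounded_op S by exists 1 => // v; rewrite mul1r.
have [G [Gl Gb G0 GG Gc]] := exists_abs Sl Ssa S1.
have SG v : S (G v) = G (S v) by apply: Gc.
have Dl : linear_op (fun v => G v - S v).
  by move=> c u v; rewrite Gl Sl scalerBr opprD addrACA.
have Db : bounded_op (fun v => G v - S v).
  have [M M0 GM] := Gb; exists (2 * M + 2) => [|v]; first by lra.
  apply: le_trans (nsqD_le _ _ _) _; rewrite nsqN.
  by have := GM v; have := S1 v; lra.
have [|inj|zero] := ker_dichotomy Dl Db.
- by move=> a v; rewrite (linopB (rho_lin a)) Sc (Gc _ (rho_lin a) (rho_bd a) (Sc a)).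
- right=> v; have /eqP : G v + S v = 0.
    apply: inj; rewrite (linopD Gl) (linopD Sl) GG SG.
    by rewrite [S (S v) + _]addrC subrr.
  rewrite addrC addr_eq0 => /eqP ->; rewrite rdotNl oppr_le0; exact: G0.
left=> v; have /eqP := zero v; rewrite subr_eq0 => /eqP <-; exact: G0.
Qed.

Lemma self_adjoint_sign S : linear_op S -> self_adjoint S -> bounded_op S ->
  (forall a, commuting (rho a) S) ->
  (forall v, 0 <= ip (S v) v) \/ (forall v, ip (S v) v <= 0).
Proof.
move=> Sl Ssa [M M0 SM] Sc; pose r := (M + 1)^-1.
have M1 : 0 < M + 1 by lra.
have r0 : 0 < r by rewrite invr_gt0.
pose S' v := r%:C%C *: S v.
have [|||a v|h|h] := @contraction_sign S'.
- by move=> c u v; rewrite /S' Sl scalerDr !scalerA mulrC.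
- by move=> u v; rewrite /S' rdotZl rdotZr Ssa.
- move=> v; rewrite /S' nsqZr (le_trans (ler_wpM2l (sqr_ge0 _) (SM v))) //.
  rewrite mulrA ler_piMl ?nsq_ge0 // /r exprVn mulrC ler_pdivrMr ?exprn_gt0 //.
  by nra.
- by rewrite /S' (linopZ (rho_lin a)) Sc.
- by left=> v; have := h v; rewrite /S' rdotZl pmulr_rge0.
by right=> v; have := h v; rewrite /S' rdotZl pmulr_rle0.
Qed.

(** Every S - c has a sign.  At the supremum c of the lower bounds of the quadratic
    form of S, the form of S - c is 0, and a self-adjoint operator is determined by its
    form. *)
Lemma Schur S : linear_op S -> self_adjoint S -> bounded_op S ->
  (forall a, commuting (rho a) S) -> (exists v : H, v != 0) ->
  exists c : R, forall v, S v = c%:C%C *: v.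
Proof.
move=> Sl Ssa Sb Sc [v0 v0n].
have sq0 : 0 < sq v0.
  by rewrite lt_def nsq_ge0 andbT; apply: contra v0n => /eqP /nsq_eq0 ->.
pose Sm (c : R) v := S v - c%:C%C *: v.
have Sm_ip c v : ip (Sm c v) v = ip (S v) v - c * sq v by rewrite rdotBl rdotZl.
have Sm_sa c : self_adjoint (Sm c) by move=> u v; rewrite rdotBl rdotBr rdotZl rdotZr Ssa.
have sgn c : (forall v, 0 <= ip (Sm c v) v) \/ (forall v, ip (Sm c v) v <= 0).
  apply: self_adjoint_sign => //.
  - by move=> d u v; rewrite /Sm Sl scalerDr scalerBr opprD !scalerA mulrC addrACA.
  - have [M M0 SM] := Sb; exists (2 * M + 2 * c ^+ 2) => [|v].
      by apply: addr_ge0; apply: mulr_ge0 => //; exact: sqr_ge0.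
    apply: le_trans (nsqD_le _ _ _) _; rewrite nsqN nsqZr.
    by have := SM v; lra.
  by move=> a v; rewrite /Sm (linopB (rho_lin a)) (linopZ (rho_lin a)) Sc.
have [M M0 SM] := Sb.
have bnd v : `|ip (S v) v| <= (M + 1) * sq v.
  have := Cauchy_Schwarz dotp (S v) v; have := SM v; have := nsq_ge0 dotp v.
  rewrite -(real_normK (num_real (ip (S v) v))).
  move: (normr_ge0 (ip (S v) v)); move: `|_| (sq v) (sq (S v)) => a b c a0 b0 cb h.
  have [//|ab] := leP a ((M + 1) * b).
  have h2 : ((M + 1) * b) ^+ 2 < a ^+ 2.
    by rewrite ltr_pXn2r ?nnegrE // mulr_ge0 //; lra.
  have := ler_wpM2r b0 cb; have := mulr_ge0 M0 (sqr_ge0 b); have := sqr_ge0 (M * b).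
  by have := sqr_ge0 b; nra.
pose E := [set c : R | forall v, c * sq v <= ip (S v) v].
have E0 : E (- (M + 1)).
  by move=> v; have := bnd v; rewrite ler_norml => /andP[]; rewrite mulNr.
have Eub : ubound E (M + 1).
  move=> c /(_ v0) Ec; rewrite -(ler_pM2r sq0) (le_trans Ec) //.
  exact: le_trans (ler_norm _) (bnd v0).
have Es : has_sup E by split; [exists (- (M + 1))|exists (M + 1)].
pose c := sup E.
have lo v : c * sq v <= ip (S v) v.
  apply/ler_addgt0Pr => e e0.
  have [d Ed cd] := sup_adherent (divr_gt0 e0 (ltr_wpDl (nsq_ge0 dotp v) ltr01)) Es.
  have := Ed v; have := nsq_ge0 dotp v.
  have s1 : 0 < sq v + 1 by rewrite ltr_wpDl ?nsq_ge0.
  have : (c - d) * (sq v + 1) < e by rewrite -ltr_pdivlMr //; rewrite -/c in cd; lra.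
  rewrite -/c in cd => h s0 hd.
  have [cd'|dc] := leP c d; first by nra.
  by nra.
have hi v : ip (S v) v <= c * sq v.
  apply/ler_addgt0Pr => e e0.
  have s1 : 0 < sq v + 1 by rewrite ltr_wpDl ?nsq_ge0.
  pose d := c + e / (sq v + 1).
  have ed : 0 < e / (sq v + 1) by rewrite divr_gt0.
  have [pos|neg] := sgn d.
    have : E d by move=> u; have := pos u; rewrite Sm_ip subr_ge0.
    move=> /(ub_le_sup (ex_intro _ _ Eub)); rewrite -/c /d; lra.
  have := neg v; rewrite Sm_ip subr_le0 /d => h; apply: le_trans h _.
  rewrite mulrDl lerD2l mulrAC ler_pdivrMr //.
  by have := nsq_ge0 dotp v; nra.
exists c => v; apply/eqP; rewrite -subr_eq0; apply/eqP.
have z u : ip (Sm c u) u = 0 by rewrite Sm_ip; have := lo u; have := hi u; lra.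
apply: (@nsq_eq0 _ _ dotp); rewrite -/(Sm c v) /nsq.
have Sml : Sm c (v + Sm c v) = Sm c v + Sm c (Sm c v).
  by rewrite {1 2 3}/Sm (linopD Sl) scalerDr opprD addrACA.
move: (Sm c) z Sml (Sm_sa c) => D z Dl Dsa.
have := z (v + D v); rewrite Dl rdotDl !rdotDr !z (Dsa (D v) v).
by lra.
Qed.

End Schur.

(** * Irreducible representations with vanishing P *)

Section Angles.
Variable R : realType.
Local Notation C := R[i].

Lemma expi_surj (z : C) : csq z = 1 -> exists2 t : R, 0 <= t < 2 * pi & expi t = z.
Proof.
case: z => a b; rewrite /csq /= => ab.
have a1 : -1 <= a <= 1 by apply/andP; split; have := sqr_ge0 b; nra.
have b2 : Num.sqrt (1 - a ^+ 2) = `|b|.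
  by rewrite -ab addrC addKr sqrtr_sqr.
have pi0 := pi_gt0 R.
have [b0|b0] := leP 0 b.
  exists (acos a); first by rewrite acos_ge0 //= (le_lt_trans (acos_lepi a1)) //; lra.
  by rewrite /expi acosK // sin_acos // b2 ger0_norm.
have a_lt1 : a < 1 by nra.
exists (2 * pi - acos a).
  have : 0 < acos a by rewrite acos_gt0 // a_lt1; case/andP: a1 => ->.
  by have := acos_lepi a1; move=> h1 h2; apply/andP; split; lra.
rewrite /expi -[2 * pi]mulrC mulr_natr cosB sinB cos2pi sin2pi.
by rewrite acosK // sin_acos // b2 ltr0_norm // !mul0r !mul1r addr0 sub0r opprK.
Qed.

Lemma expi_inj (s t : R) : 0 <= s < 2 * pi -> 0 <= t < 2 * pi -> expi s = expi t -> s = t.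
Proof.
wlog st : s t / s <= t => [h s0 t0 e|].
  have [|ts] := leP s t => [st|]; first exact: h.
  by apply/esym/h => //; exact: ltW.
move=> /andP[s0 _] /andP[_ t1] [c1 s1].
have : cos (t - s) = 1 by rewrite cosB c1 s1 -!expr2 cos2Dsin2.
have -> : t - s = ((t - s) / 2) *+ 2 by rewrite -mulr_natr; field.
rewrite cos_mulr2n => h.
apply/eqP; apply: contraT => st'; exfalso.
have ts : s < t by rewrite lt_def eq_sym st' st.
have : 0 < sin ((t - s) / 2) by apply: sin_gt0_pi; apply/andP; split; lra.
have := cos2Dsin2 ((t - s) / 2); rewrite mulr2n in h.
by move: (sin _) (cos _) h => a b; nra.
Qed.
End Angles.

Section OperatorCombinations.
Variables (R : realType) (H : hilbertType R[i]) (S S' : H -> H).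
Local Notation C := R[i].

Lemma linear_opD : linear_op S -> linear_op S' -> linear_op (fun v => S v + S' v).
Proof. by move=> Sl Sl' c u v; rewrite Sl Sl' scalerDr addrACA. Qed.

Lemma linear_opZ (a : C) : linear_op S -> linear_op (fun v => a *: S v).
Proof. by move=> Sl c u v; rewrite Sl scalerDr !scalerA mulrC. Qed.

Lemma bounded_opD : bounded_op S -> bounded_op S' -> bounded_op (fun v => S v + S' v).
Proof.
move=> [M M0 SM] [N N0 SN]; exists (2 * M + 2 * N) => [|v].
  by apply: addr_ge0; apply: mulr_ge0.
by apply: le_trans (nsqD_le _ _ _) _; have := SM v; have := SN v; lra.
Qed.

Lemma bounded_opZ (a : C) : bounded_op S -> bounded_op (fun v => a *: S v).
Proof.
move=> [M M0 SM]; exists (csq a * M) => [|v]; first by rewrite mulr_ge0 ?csq_ge0.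
by rewrite nsqZ -/(csq a) -mulrA ler_wpM2l ?csq_ge0.
Qed.
End OperatorCombinations.

Section VanishingP.
Variables (R : realType) (q : R) (K : hilbertType R[i]).
Hypotheses (q_neq0 : 0 < `|q|).
Variable sigma : rp2_alg q -> K -> K.
Hypotheses (sigma_irr : irreducible_star_rep sigma).
Hypothesis P0 : forall v, sigma (rp2_P q) v = 0.
Local Notation C := R[i].
Local Notation T := (sigma (rp2_T q)).
Local Notation Ts := (sigma (star (rp2_T q))).
Local Notation Rr := (sigma (rp2_R q)).
Local Notation Rs := (sigma (star (rp2_R q))).
Local Notation ip := (rdot (@dotp C K)).
Local Notation sq := (nsq (@dotp C K)).
Implicit Types u v : K.

Let sigma_rep : is_star_rep setT sigma. Proof. by case: sigma_irr => -[]. Qed.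
Let sL a : linear_op (sigma a) := rep_op_linear sigma_rep a.
Let sB a : bounded_op (sigma a) := rep_op_bounded sigma_rep q_neq0 a.

Let T0 v : T v = 0.
Proof.
apply: (@nsq_eq0 _ _ dotp); apply: (mulfI (lt0r_neq0 (q4_gt0 q_neq0))).
by rewrite (nsq_T sigma_rep) // P0 rdot0l nsq0 subrr mulr0.
Qed.

Let Ts0 v : Ts v = 0.
Proof.
apply: (@nsq_eq0 _ _ dotp).
by rewrite (nsq_Ts sigma_rep) // P0 rdot0l nsq0 mulr0 subrr.
Qed.

Let RsR v : Rs (Rr v) = v.
Proof.
have x0 : ((q ^+ 4)%:C%C : C) != 0 by rewrite real_complex_neq0 // lt0r_neq0 // q4_gt0.
apply: (scalerI x0); rewrite -(rep_mul sigma_rep) // -(repZ sigma_rep) // rp2_starR_R.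
by rewrite !(repE sigma_rep) // !P0 scaler0 subr0 addr0.
Qed.

Let RRs v : Rr (Rs v) = v.
Proof.
rewrite -(rep_mul sigma_rep) // rp2_R_starR !(repE sigma_rep) // !P0 !scaler0.
by rewrite subr0 addr0.
Qed.

(** The image of the algebra is generated by a unitary and its inverse, so it is
    commutative. *)
Let R_central a v : sigma a (Rr v) = Rr (sigma a v) /\ sigma a (Rs v) = Rs (sigma a v).
Proof.
elim/rp2_ind: a v => [c a b IHa IHb v|a b IHa IHb v|v|v|v|v|v|v].
- rewrite !(rep_alg_linear sigma_rep) // !(sL _) (IHa v).1 (IHa v).2.
  by rewrite (IHb v).1 (IHb v).2.
- by rewrite !(rep_mul sigma_rep) // (IHb v).1 (IHb v).2 (IHa _).1 (IHa _).2.
- by rewrite !(rep_one sigma_rep).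
- by rewrite !P0 !(linop0 (sL _)).
- by rewrite !T0 !(linop0 (sL _)).
- by rewrite !Ts0 !(linop0 (sL _)).
- by rewrite RRs RsR.
- by rewrite RRs RsR.
Qed.

Let scalar_self_adjoint (S : K -> K) := @Schur R K _ sigma sL sB
  (let: And3 _ _ h := sigma_irr in h) S.

Let nontrivial : exists v : K, v != 0.
Proof. by case: sigma_irr. Qed.

(** Schur's lemma applies to the sum of R and R^* and to i times their difference. *)
Let R_scalar : exists z : C, forall v, Rr v = z *: v.
Proof.
have adj u v : dotp (Rr u) v = dotp u (Rs v) :> C by rewrite (rep_adjoint sigma_rep).
have adj' u v : dotp (Rs u) v = dotp u (Rr v) :> C.
  by rewrite (rep_adjoint sigma_rep) // starK.
have scal (c d : C) :
    (forall u v, dotp (c *: (Rr u + d *: Rs u)) v = dotp u (c *: (Rr v + d *: Rs v)) :> C) ->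
    exists r : R, forall v, c *: (Rr v + d *: Rs v) = r%:C%C *: v.
  move=> sa; apply: scalar_self_adjoint nontrivial.
  - by apply: linear_opZ; apply: linear_opD; [|apply: linear_opZ]; exact: sL.
  - by move=> u v; rewrite /rdot sa.
  - by apply: bounded_opZ; apply: bounded_opD; [|apply: bounded_opZ]; exact: sB.
  move=> a v; rewrite (linopZ (sL _)) (linopD (sL _)) (linopZ (sL _)).
  by rewrite (R_central a v).1 (R_central a v).2.
have [|c1 h1] := scal 1 1.
  by move=> u v; rewrite !scale1r linearDl linearDr /= adj adj' addrC.
have [|c2 h2] := scal 'i%C (- 1).
  move=> u v; rewrite !scaleN1r linearZl_LR linearZr_LR /= linearBl linearBr /= adj adj'.
  have -> : ('i%C : C)^* = - 'i%C by apply/eqP; rewrite eq_complex /= oppr0 !eqxx.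
  by rewrite mulNr -mulrN opprB.
exists (2^-1 * (c1%:C%C - 'i%C * c2%:C%C)) => v.
have e1 := h1 v; have e2 := h2 v; rewrite scale1r scale1r in e1.
have ii : ('i%C : C) * 'i%C = - 1.
  by apply/eqP; rewrite eq_complex /=; apply/andP; split; apply/eqP; ring.
rewrite -scalerA scalerBl -scalerA -e1 -e2.
rewrite (scalerA 'i%C) ii !scaleN1r opprK.
have two : Rr v + Rr v = (2 : C) *: Rr v.
  by rewrite -[2 : C]/(1 + 1 : C) scalerDl scale1r.
by rewrite addrACA subrr addr0 two scalerA mulVf ?scale1r // pnatr_eq0.
Qed.

Lemma scalar_of_P_eq0 : exists2 t : R, 0 <= t < 2 * pi &
  forall a v, sigma a v = character t a *: v.
Proof.
have [z Rz] := R_scalar; have [v0 v0n] := nontrivial.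
have [|t t2 tz] := @expi_surj R z.
  have sq0 : nsq (@dotp C K) v0 != 0 by apply: contra v0n => /eqP /nsq_eq0 ->.
  apply: (mulIf sq0); rewrite mul1r -nsqZ -Rz.
  apply: (mulfI (lt0r_neq0 (q4_gt0 q_neq0))).
  by rewrite (nsq_R sigma_rep) // P0 rdot0l nsq0 mulr0 subr0 addr0.
exists t => // a; have zz := expi_conj t; rewrite tz in zz.
elim/rp2_ind: a => [c a b IHa IHb|a b IHa IHb||||||] v.
- by rewrite (rep_alg_linear sigma_rep) // characterL IHa IHb scalerDl scalerA.
- rewrite (rep_mul sigma_rep a b (I : setT v)) IHb IHa (characterM t a b).
  exact: scalerA.
- by rewrite (rep_one sigma_rep) // character1 scale1r.
- by rewrite P0 characterP scale0r.
- by rewrite T0 characterT scale0r.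
- by rewrite Ts0 character_star characterT rmorph0 scale0r.
- by rewrite Rz characterR tz.
- rewrite character_star characterR tz -{2}(RsR v) Rz (linopZ (sL _)) scalerA.
  by rewrite mulrC zz scale1r.
Qed.

(** As the algebra acts by scalars, the kernel of the projection along the line of
    e is invariant. *)
Lemma one_dimensional (e : K) : nsq dotp e = 1 -> forall v, v = dotp v e *: e.
Proof.
move=> e1; have [t _ ht] := scalar_of_P_eq0.
have ee : dotp e e = 1 :> C by rewrite nsqC e1.
pose E v := v - dotp v e *: e.
have El : linear_op E.
  move=> c u v; rewrite /E linearDl linearZl_LR /= scalerDl -scalerA scalerBr.
  by rewrite opprD addrACA.
have Eb : bounded_op E.
  exists 1 => // v; rewrite mul1r /E nsqB nsqZ e1 mulr1 -/(csq _).
  have -> : rdot dotp v (dotp v e *: e) = csq (dotp v e).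
    by rewrite /rdot linearZr_LR /= mulrC csqE.
  by have := csq_ge0 (dotp v e); lra.
have irr V := let: And3 _ _ h := sigma_irr in h V.
have [|||h|h] := irr [set v | E v = 0].
- split=> [|c u v /= Eu Ev]; first exact: linop0 El.
  by rewrite El Eu Ev scaler0 addr0.
- exact: closed_ker El Eb.
- by move=> a v /= Ev; rewrite ht (linopZ El) Ev scaler0.
- have : [set v | E v = 0] e by rewrite /= /E ee scale1r subrr.
  by rewrite h /= => e0; move: e1; rewrite e0 nsq0 => /esym/eqP; rewrite oner_eq0.
move=> v; have : [set: K] v by [].
by rewrite -h /= /E => /eqP; rewrite subr_eq0 => /eqP.
Qed.

Lemma irreducible_P_eq0 : exists2 t : R, 0 <= t < 2 * pi &
  unitarily_equivalent sigma (@theta_rep R q t).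
Proof.
have [t t2 ht] := scalar_of_P_eq0; exists t => //.
have [v0 v0n] := nontrivial.
have [e e1] : exists e : K, nsq dotp e = 1.
  have sq0 : nsq (@dotp C K) v0 != 0 by apply: contra v0n => /eqP /nsq_eq0 ->.
  exists ((Num.sqrt (nsq (@dotp C K) v0))^-1%:C%C *: v0).
  by rewrite nsqZr exprVn sqr_sqrtr ?nsq_ge0 // mulVf.
have ve := one_dimensional e1.
have ee : dotp e e = 1 :> C by rewrite nsqC e1.
pose U v : complex_line R := dotp v e.
have Ul : linear U by move=> c u v; rewrite /U linearDl linearZl_LR.
pose UL := GRing.isLinear.Build C K (complex_line R) *:%R U Ul.
pose U' : {linear K -> complex_line R} := HB.pack U UL.
exists U'; split.
- exists (fun c : complex_line R => (c : C) *: e) => [v|c]; first by rewrite /= -ve.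
  by rewrite /= /U linearZl_LR /= ee mulr1.
- move=> u v; rewrite complex_lineE /= /U [in RHS](ve u) linearZl_LR /=.
  by congr (_ * _); rewrite [RHS]dotpC.
- by move=> a v; rewrite /= /U ht linearZl_LR.
Qed.

End VanishingP.

(** * The classification *)

Lemma theta_rep_unitary_inj (R : realType) (q s t : R) :
  0 <= s < 2 * pi -> 0 <= t < 2 * pi ->
  unitarily_equivalent (@theta_rep R q s) (@theta_rep R q t) -> s = t.
Proof.
move=> s2 t2 [U [/bij_inj Ui _ Ur]]; apply: expi_inj => //.
have := Ur (rp2_R q) (1 : R[i]); rewrite /theta_rep !characterR linearZ /= => /eqP.
rewrite -subr_eq0 -scalerBl scaler_eq0 => /orP[|/eqP U1].
  by rewrite subr_eq0 => /eqP.
have /Ui/eqP : U (1 : R[i]) = U 0 by rewrite U1 linear0.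
by rewrite (oner_eq0 R[i]).
Qed.

Lemma theta_rep_not_l2 (R : realType) (q t : R) (q_neq0 : 0 < `|q|) (q_lt1 : `|q| < 1) :
  ~ unitarily_equivalent (@theta_rep R q t) (l2_rep q_neq0 q_lt1).
Proof.
move=> [U [[V _ VK] _ Ur]]; have := Ur (rp2_P q) (V (l2_basis R 0)).
rewrite VK (rho_P (l2_rep_infty q_neq0 q_lt1)) muln0 expr0 scale1r.
rewrite /theta_rep characterP scale0r linear0 => /esym/eqP.
by rewrite (negPf (l2_basis_neq0 R)).
Qed.

Theorem theorem4p5 (R : realType) (q : R) (hq0 : 0 < `|q|) (hq1 : `|q| < 1) :
  (forall (K : hilbertType R[i]) (D : set K) (sigma : rp2_alg q -> K -> K),
     ~ unbounded_star_rep D sigma) /\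
  exists (rho_ : R -> rp2_alg q -> complex_line R -> complex_line R)
         (H : hilbertType R[i]) (e : nat -> H) (rho : rp2_alg q -> H -> H),
    [/\ forall theta, 0 <= theta < 2 * pi ->
          irreducible_star_rep (rho_ theta) /\ rp2_rep_theta theta (rho_ theta),
        [/\ orthonormal_basis e, irreducible_star_rep rho & rp2_rep_infty e rho],
        forall (K : hilbertType R[i]) (sigma : rp2_alg q -> K -> K),
          irreducible_star_rep sigma ->
          (exists2 theta, 0 <= theta < 2 * pi &
             unitarily_equivalent sigma (rho_ theta)) \/
          unitarily_equivalent sigma rho,
        forall theta theta', 0 <= theta < 2 * pi -> 0 <= theta' < 2 * pi ->
          unitarily_equivalent (rho_ theta) (rho_ theta') -> theta = theta' &
        forall theta, 0 <= theta < 2 * pi ->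
          ~ unitarily_equivalent (rho_ theta) rho].
Proof.
split=> [K D sigma [sigma_rep [a]]|].
  by apply; exact: rep_bounded_on sigma_rep hq0 a.
exists (@theta_rep R q), (l2 R), (l2_basis R), (l2_rep hq0 hq1); split.
- by move=> t _; split; [exact: theta_rep_irreducible|exact: theta_rep_values].
- split; [exact: l2_orthonormal_basis|exact: l2_irreducible|exact: l2_rep_infty].
- move=> K sigma irr.
  have [P0|/existsNP P0] := pselect (forall v, sigma (rp2_P q) v = 0).
    by left; exact: irreducible_P_eq0.
  by right; exact: irreducible_P_neq0.
- by move=> s t; exact: theta_rep_unitary_inj.
- by move=> t _; exact: theta_rep_not_l2.
Qed.
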